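(* For any constant $a\in\mathbb{N}^+$, any constant $c\in\mathbb{N}$, any $k=\delta n=\Theta(n/\log^c n)$, any $\epsilon=1/2^{\Theta(\log^a n)}$ and any constant $\gamma\in(0,1)$, there exists an explicit strong $(k,\epsilon)$-extractor $\mathsf{Ext}:\{0,1\}^n\times\{0,1\}^d\to\{0,1\}^m$ computable in $\mathsf{AC}^0$ of depth $\Theta(a+c)$, where $d=(\log n)^{\Theta(a+c)}$ and $m=(1-\gamma)k$.
   Context: An $(n,k)$-source is a distribution on $\{0,1\}^n$ with min-entropy at least $k$. $\mathsf{Ext}$ is a strong $(k,\epsilon)$-extractor if for every $(n,k)$-source $X$ and independent uniform seed $U\in\{0,1\}^d$, $U\circ\mathsf{Ext}(X,U)$ is $\epsilon$-close in statistical distance to uniform on $\{0,1\}^{d+m}$. $\mathsf{AC}^0$: polynomial-size, constant-depth circuits with NOT and unbounded fan-in AND/OR gates. Explicit means polynomial-time computable. Asymptotics are as $n\to\infty$.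
   Formalization: Since k is arbitrary (possibly uncomputable), ''explicit'' is taken as computable in time polynomial in n by one machine given x, the seed and the output length m in unary; m=(1-γ)k is rounded down and all claims hold for all sufficiently large n. *)

(* Defs.v *)
From HB Require Import structures.
From mathcomp Require Import all_boot all_order all_algebra.
From mathcomp Require Import all_classical all_reals all_analysis.

Set Implicit Arguments.
Unset Strict Implicit.
Unset Printing Implicit Defensive.

Import Order.TTheory GRing.Theory Num.Theory.
Import numFieldNormedType.Exports.

Local Open Scope classical_set_scope.
Local Open Scope ring_scope.

Definition log2 (R : realType) (x : R) : R := ln x / ln 2.

(** * Finite distributions and extractors *)

Definition is_distr (R : realType) (T : finType) (p : T -> R) : Prop :=
  (forall x, 0 <= p x) /\ \sum_x p x = 1.

Definition uniform (R : realType) (T : finType) : T -> R :=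
  fun=> (#|T|%:R)^-1.
Arguments uniform R T : clear implicits.

(* joint law of two independent random variables *)
Definition indep_pair (R : realType) (S T : finType) (p : S -> R) (q : T -> R) :
  S * T -> R := fun st => p st.1 * q st.2.

(* law of [f Z] when [Z] has law [p] *)
Definition image_distr (R : realType) (S T : finType) (f : S -> T)
  (p : S -> R) : T -> R := fun t => \sum_(s | f s == t) p s.

Definition stat_dist (R : realType) (T : finType) (p q : T -> R) : R :=
  2^-1 * \sum_x `|p x - q x|.

(* [min_x log2 (1 / p x)] over the support, i.e. [- log2 (max_x p x)] *)
Definition min_entropy (R : realType) (T : finType) (p : T -> R) : R :=
  - log2 (\big[Num.max/0]_x p x).

Definition is_source (R : realType) (n : nat) (k : R)
  (p : n.-tuple bool -> R) : Prop :=
  is_distr p /\ k <= min_entropy p.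

Definition strong_extractor (R : realType) (n d m : nat) (k eps : R)
  (Ext : n.-tuple bool -> d.-tuple bool -> m.-tuple bool) : Prop :=
  forall p : n.-tuple bool -> R, is_source k p ->
  stat_dist
    (image_distr (fun xu : n.-tuple bool * d.-tuple bool =>
          [tuple of xu.2 ++ Ext xu.1 xu.2])
       (indep_pair p (uniform R (d.-tuple bool))))
    (uniform R ((d + m).-tuple bool)) <= eps.

(** * Boolean circuits *)

(* Wires are numbered: [0, ..., N-1] are the [N] input bits and [N + i] is the
   output of the [i]-th gate of the list. The empty conjunction and the empty
   disjunction are the constants. *)
Inductive gate :=
  | NotGate of nat
  | AndGate of seq nat
  | OrGate of seq nat.

Record circuit := Circuit { gates : seq gate; outputs : seq nat }.

Definition gate_args (g : gate) : seq nat :=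
  match g with NotGate i => [:: i] | AndGate s => s | OrGate s => s end.

Definition gate_val (v : seq bool) (g : gate) : bool :=
  match g with
  | NotGate i => ~~ nth false v i
  | AndGate s => all (nth false v) s
  | OrGate s => has (nth false v) s
  end.

(* every gate only reads inputs and earlier gates *)
Definition circuit_wf (N : nat) (C : circuit) : Prop :=
  (forall i : nat, (i < size (gates C))%N ->
     all (fun j => j < N + i)%N (gate_args (nth (AndGate [::]) (gates C) i))) /\
  all (fun j => j < N + size (gates C))%N (outputs C).

Definition circuit_eval (C : circuit) (x : seq bool) : seq bool :=
  let v := foldl (fun v g => rcons v (gate_val v g)) x (gates C) in
  map (nth false v) (outputs C).

(* number of gates and wires *)
Definition circuit_size (C : circuit) : nat :=
  (\sum_(g <- gates C) (size (gate_args g)).+1)%N.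

(* length of a longest path from an input (or constant) to an output *)
Definition circuit_depth (N : nat) (C : circuit) : nat :=
  let l := foldl
    (fun l g => rcons l (\max_(j <- gate_args g) nth 0%N l j).+1)
    (nseq N 0%N) (gates C) in
  (\max_(j <- outputs C) nth 0%N l j)%N.

(* Polynomial-size circuits whose depths lie in the interval [[lo, hi]], which
   does not depend on [n]. *)
Definition in_AC0_of_depth (R : realType) (lo hi : R) (d m : nat -> nat)
  (f : forall n : nat, n.-tuple bool -> (d n).-tuple bool -> (m n).-tuple bool)
  : Prop :=
  exists (C : nat -> circuit) (e : nat), \forall n \near \oo,
    [/\ circuit_wf (n + d n) (C n),
        (circuit_size (C n) <= n ^ e)%N,
        lo <= (circuit_depth (n + d n) (C n))%:R <= hi
      & forall (x : n.-tuple bool) (u : (d n).-tuple bool),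
          circuit_eval (C n) (x ++ u) = f n x u].

(** * Multi-tape Turing machines *)

(* Tapes are two-way infinite, over the alphabet {0, 1, blank}, with [None] for
   the blank symbol. *)
Inductive move := MoveLeft | Stay | MoveRight.

Record turing_machine := TuringMachine {
  tm_state : finType;
  tm_tapes : nat;  (* the tapes are [0, ..., tm_tapes] *)
  tm_start : tm_state;
  tm_halt : pred tm_state;
  tm_trans : tm_state -> {ffun 'I_tm_tapes.+1 -> option bool} ->
    tm_state * ('I_tm_tapes.+1 -> option bool * move)
}.

Record tm_config (M : turing_machine) := TMConfig {
  cf_state : tm_state M;
  cf_head : 'I_(tm_tapes M).+1 -> int;
  cf_tape : 'I_(tm_tapes M).+1 -> int -> option bool
}.

Definition move_head (h : int) (mv : move) : int :=
  match mv with MoveLeft => h - 1 | Stay => h | MoveRight => h + 1 end.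

Definition tm_step (M : turing_machine) (c : tm_config M) : tm_config M :=
  if tm_halt (cf_state c) then c else
  let: (q, act) :=
    tm_trans (cf_state c) [ffun i => cf_tape c i (cf_head c i)] in
  TMConfig q
    (fun i => move_head (cf_head c i) (act i).2)
    (fun i z => if z == cf_head c i then (act i).1 else cf_tape c i z).

(* the word [w], written from cell 0 on, surrounded by blanks *)
Definition word_tape (w : seq bool) (z : int) : option bool :=
  if z is Posz j then onth w j else None.

(* the [i]-th input word is on the [i]-th tape *)
Definition tm_init (M : turing_machine) (ws : seq (seq bool)) : tm_config M :=
  TMConfig (tm_start M) (fun=> 0) (fun i => word_tape (nth [::] ws i)).

(* The output is read on the last tape: from cell 0 up to the first blank. *)
Definition tm_outputs (M : turing_machine) (ws : seq (seq bool)) (t : nat)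
  (w : seq bool) : Prop :=
  let c := iter t (@tm_step M) (tm_init M ws) in
  tm_halt (cf_state c) /\
  forall j : nat, (j <= size w)%N -> cf_tape c ord_max j%:Z = onth w j.

(* [f] is computed in time polynomial in [n]. The output length [m n] is given
   to the machine in unary: [m] is an arbitrary, possibly non-computable,
   function of [n]. *)
Definition explicit (d m : nat -> nat)
  (f : forall n : nat, n.-tuple bool -> (d n).-tuple bool -> (m n).-tuple bool)
  : Prop :=
  exists (M : turing_machine) (e : nat), \forall n \near \oo,
    forall (x : n.-tuple bool) (u : (d n).-tuple bool),
      tm_outputs M [:: tval x; tval u; nseq (m n) true] (n ^ e) (f n x u).

(* Main.v *)
Require Import Defs.
From HB Require Import structures.
From mathcomp Require Import all_boot all_order all_algebra.
From mathcomp Require Import all_classical all_reals all_analysis.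
From mathcomp Require Import zify ring lra.

(** The extractor is a variant of Trevisan's. Cut the seed restricted to a set of
positions into [s = log^(a+c+2) n] addresses, and output the xor of the addressed
bits of [x]: averaging over the addresses, two words at relative distance [b] are
correlated by [(1 - 2 b)^s], and a source of min-entropy [k] hits a Hamming ball of
radius [k / log n] with tiny probability, so this bit is almost unbiased by a second
moment computation, even after leaking a little less than [k] bits about [x].
The [i]-th output bit reads the seed at the positions [p^2 + (i mod p)], where [p]
runs over [s log n] primes of polylogarithmic size: the bits [j] and [i] share the
positions of the primes dividing [i - j], so the earlier bits leak at most
[sum_(j < i) 2^#{p | i - j} <= i * prod_p (1 + 1/p)] bits, which is [(1 + o(1)) i].
A hybrid argument then bounds the statistical distance.
Each output bit is an xor of polylogarithmically many bits selected by addresses of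
logarithmic length, which is in AC0. For the explicitness, the position of a head is
used as a counter, and all quantities are primitive recursive with polynomially
bounded values; the parameter [log n] is recovered as a root of the seed length. *)

Set Implicit Arguments.
Unset Strict Implicit.
Unset Printing Implicit Defensive.

Import Order.TTheory GRing.Theory Num.Theory.
Import numFieldNormedType.Exports.

Local Open Scope classical_set_scope.
Local Open Scope ring_scope.

(** * Counter programs *)

(** As [gamma] may be arbitrarily small, a leak of a constant factor times [m] bits is unaffordable:
    the overlaps must cost a factor tending to 1. Hence the moduli exceed [s ^ 2], so that the
    factor (1 + 1/s^2)^(s log n) is at most exp(log n / s). Constant depth is the other obstacle: no
    error-correcting code is applied to [x]; the xor of [s] addressed bits amplifies distance
    instead, and stays local. The exponent of [s] comes from the radius. A ball of radius about k /
    log n has at most 2^(small multiple of k) points, and words outside it are at relative distance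
    about 1 / log^(c+1) n, so the correlation drops below 2^-(log^a n) once [s] is a large multiple
    of log^(a+c+1) n; one more logarithm absorbs every constant. The sequences [k] and [m] may be
    noncomputable, so the bits themselves depend only on [A = a + c + 2] and on [l], about log n;
    [k] decides only how many bits are printed. The primes come from Chebyshev's lower bound via
    central binomial coefficients. The lower bound on the circuit depth is met by padding with
    double negations. *)

Definition upd (r : nat -> nat) (k v : nat) : nat -> nat :=
  fun j => if j == k then v else r j.

(** The only test is a predicate of the symbol under a head. It serves both to branch on an input
    bit and to compare a counter with zero: a counter at 0 sees its mark, and a blank elsewhere. *)
Inductive prog :=
  | CInc (i : nat) (P : option bool -> bool) (k : nat)
  | Dec (k : nat)
  | Out (i : nat) (P : option bool -> bool)
  | Seq (p q : prog)
  | While (i : nat) (P : option bool -> bool) (p : prog).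

Fixpoint uses (K : nat) (p : prog) : bool :=
  match p with
  | CInc i _ k => (i < K)%N && (k < K)%N
  | Dec k => (k < K)%N
  | Out i _ => (i < K)%N
  | Seq p q => uses K p && uses K q
  | While i _ p => (i < K)%N && uses K p
  end.

Fixpoint tapes_of (p : prog) : nat :=
  match p with
  | CInc i _ k => (i + k).+1
  | Dec k => k.+1
  | Out i _ => i.+1
  | Seq p q => (tapes_of p + tapes_of q)%N
  | While i _ p => (i + tapes_of p).+1
  end.

Lemma uses_le K K' p : (K <= K')%N -> uses K p -> uses K' p.
Proof.
by move=> h; elim: p => /= *; lia.
Qed.

Lemma uses_tapes_of p : uses (tapes_of p) p.
Proof.
elim: p => /=; try (move=> *; lia).
- move=> p ihp q ihq; rewrite (uses_le _ ihp) ?leq_addr //.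
  by rewrite (uses_le _ ihq) ?leq_addl.
- move=> i P p ih; rewrite (uses_le _ ih); last lia.
  by rewrite andbT; lia.
Qed.

(* The words on the tapes: the three inputs come first, and every counter tape
   carries a mark at cell 0, so that a counter is the position of its head. *)
Definition tape_word (x u : seq bool) (m : nat) (i : nat) : seq bool :=
  match i with 0 => x | 1 => u | 2 => nseq m true | _ => [:: true] end%N.

Definition sym x u m (r : nat -> nat) (i : nat) : option bool :=
  onth (tape_word x u m i) (r i).

(** The last index is an exact step count: compilation spends one transition on each elementary
    command and each loop test, and none on sequencing. [Dec] demands a positive counter, so that
    heads stay on nonnegative cells. *)
Inductive exec (x u : seq bool) (m : nat) :
    prog -> (nat -> nat) * seq bool -> (nat -> nat) * seq bool -> nat -> Prop :=
  | ExecCInc i P k r o : exec x u m (CInc i P k) (r, o)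
      (if P (sym x u m r i) then upd r k (r k).+1 else r, o) 1
  | ExecDec k r o : (0 < r k)%N ->
      exec x u m (Dec k) (r, o) (upd r k (r k).-1, o) 1
  | ExecOut i P r o :
      exec x u m (Out i P) (r, o) (r, rcons o (P (sym x u m r i))) 1
  | ExecSeq p q c c1 c2 t1 t2 : exec x u m p c c1 t1 -> exec x u m q c1 c2 t2 ->
      exec x u m (Seq p q) c c2 (t1 + t2)
  | ExecWhileF i P p r o : P (sym x u m r i) = false ->
      exec x u m (While i P p) (r, o) (r, o) 1
  | ExecWhileT i P p r o c1 c2 t1 t2 : P (sym x u m r i) = true ->
      exec x u m p (r, o) c1 t1 -> exec x u m (While i P p) c1 c2 t2 ->
      exec x u m (While i P p) (r, o) c2 (t1 + t2).+1.

(** * Compilation to Turing machines *)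

Section Compile.
Variable T : nat.

Let reads := {ffun 'I_T.+1 -> option bool}.
Let action := 'I_T.+1 -> option bool * move.

(* An automaton which leaves through [None]. *)
Record fragment := Fragment {
  fr_state : finType;
  fr_start : fr_state;
  fr_trans : fr_state -> reads -> option fr_state * action
}.

Definition keep (r : reads) : action := fun i => (r i, Stay).

Definition moving (k : nat) (mv : move) (r : reads) : action :=
  fun i => (r i, if (i : nat) == k then mv else Stay).

Definition writing (b : bool) (r : reads) : action :=
  fun i => if (i : nat) == T then (Some b, MoveRight) else (r i, Stay).

Definition step_fragment (a : reads -> action) : fragment :=
  @Fragment unit tt (fun _ r => (None, a r)).

Definition seq_fragment (F G : fragment) : fragment :=
  @Fragment (fr_state F + fr_state G)%type (inl (fr_start F)) (fun q r =>
    match q with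
    | inl q => let: (q', a) := fr_trans q r in
        (Some (if q' is Some q1 then inl q1 else inr (fr_start G)), a)
    | inr q => let: (q', a) := fr_trans q r in (omap inr q', a)
    end).

Definition while_fragment (i : nat) (P : option bool -> bool) (F : fragment) :
    fragment :=
  @Fragment (option (fr_state F)) None (fun q r =>
    match q with
    | None => (if P (r (inord i)) then Some (Some (fr_start F)) else None, keep r)
    | Some q => let: (q', a) := fr_trans q r in (Some q', a)
    end).

Fixpoint compile (p : prog) : fragment :=
  match p with
  | CInc i P k => step_fragment
      (fun r => if P (r (inord i)) then moving k MoveRight r else keep r)
  | Dec k => step_fragment (moving k MoveLeft)
  | Out i P => step_fragment (fun r => writing (P (r (inord i))) r)
  | Seq p q => seq_fragment (compile p) (compile q)
  | While i P p => while_fragment i P (compile p)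
  end.

Definition tconf := (('I_T.+1 -> int) * ('I_T.+1 -> int -> option bool))%type.

Definition look (c : tconf) : reads := [ffun i => c.2 i (c.1 i)].

Definition apply_action (a : action) (c : tconf) : tconf :=
  (fun i => move_head (c.1 i) (a i).2,
   fun i z => if z == c.1 i then (a i).1 else c.2 i z).

Inductive runs (F : fragment) : fr_state F -> tconf -> tconf -> nat -> Prop :=
  | RunsExit q c a : fr_trans q (look c) = (None, a) ->
      runs q c (apply_action a c) 1
  | RunsStep q c q' a c' t : fr_trans q (look c) = (Some q', a) ->
      runs q' (apply_action a c) c' t -> runs q c c' t.+1.

Lemma runs_seqr F G (q : fr_state G) c c' t :
  runs q c c' t -> @runs (seq_fragment F G) (inr q) c c' t.
Proof.
elim=> {q c c' t} [q c a e|q c q' a c' t e _ ih].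
- by apply: RunsExit; rewrite /= e.
- by apply: RunsStep ih; rewrite /= e.
Qed.

Lemma runs_seq F G (q : fr_state F) c c1 c2 t1 t2 :
  runs q c c1 t1 -> runs (fr_start G) c1 c2 t2 ->
  @runs (seq_fragment F G) (inl q) c c2 (t1 + t2).
Proof.
move=> h h2; elim: h h2 => {q c c1 t1} [q c a e|q c q' a c' t e _ ih] h2.
- rewrite add1n; apply: RunsStep; last exact: runs_seqr h2.
  by rewrite /= e.
- rewrite addSn; apply: RunsStep (ih h2).
  by rewrite /= e.
Qed.

Lemma runs_while_body i P F (q : fr_state F) c c1 c2 t1 t2 :
  runs q c c1 t1 -> @runs (while_fragment i P F) None c1 c2 t2 ->
  @runs (while_fragment i P F) (Some q) c c2 (t1 + t2).
Proof.
move=> h h2; elim: h h2 => {q c c1 t1} [q c a e|q c q' a c' t e _ ih] h2.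
- rewrite add1n; apply: RunsStep; last exact: h2.
  by rewrite /= e.
- rewrite addSn; apply: RunsStep (ih h2).
  by rewrite /= e.
Qed.

Variables (x u : seq bool) (m : nat).

(** Tape [T] receives the output, with its head just after the word written so far. The other tapes
    never change; only their heads move. *)
Definition conf_of (c : (nat -> nat) * seq bool) : tconf :=
  (fun i : 'I_T.+1 => (if (i : nat) == T then size c.2 else c.1 i)%:Z,
   fun i : 'I_T.+1 => word_tape (if (i : nat) == T then c.2 else tape_word x u m i)).

Lemma look_conf_of (i : 'I_T.+1) r o : (i < T)%N ->
  look (conf_of (r, o)) i = sym x u m r i.
Proof. by move=> h; rewrite ffunE /= ltn_eqF. Qed.

Lemma look_conf_ofE (i : 'I_T.+1) c :
  look (conf_of c) i = (conf_of c).2 i ((conf_of c).1 i).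
Proof. by rewrite ffunE. Qed.

Lemma apply_keep c : apply_action (keep (look c)) c = c.
Proof.
case: c => h t; rewrite /apply_action /keep /=; congr (_, _).
apply/funext => i; apply/funext => z; case: eqP => // ->.
by rewrite ffunE.
Qed.

Lemma apply_moving k mv r r' o : (k < T)%N ->
  (forall j, j != k -> r' j = r j) -> (r' k)%:Z = move_head (r k)%:Z mv ->
  apply_action (moving k mv (look (conf_of (r, o)))) (conf_of (r, o)) =
  conf_of (r', o).
Proof.
move=> kT h1 h2; rewrite /apply_action /moving; congr (_, _).
- apply/funext => i /=; case: (eqVneq (i : nat) T) => [->|iT].
    by rewrite gtn_eqF.
  by case: eqVneq => [->|/h1 ->].
- apply/funext => i; apply/funext => z; case: eqP => // ->.
  by rewrite look_conf_ofE.
Qed.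

Lemma onth_rcons (w : seq bool) b j :
  onth (rcons w b) j = if j == size w then Some b else onth w j.
Proof.
elim: w j => [|y w ih] [|j] //=.
by rewrite onthE /=; case: j.
Qed.

Lemma apply_writing b r o :
  apply_action (writing b (look (conf_of (r, o)))) (conf_of (r, o)) =
  conf_of (r, rcons o b).
Proof.
rewrite /apply_action /writing; congr (_, _).
- apply/funext => i /=; case: (eqVneq (i : nat) T) => //= _.
  by rewrite size_rcons -addn1 PoszD.
- apply/funext => i; apply/funext => z /=; case: (eqVneq (i : nat) T) => iT /=.
  + case: z => j //=; by rewrite onth_rcons eqz_nat.
  + case: eqP => // ->; by rewrite look_conf_ofE /= (negbTE iT).
Qed.

Lemma runs_step_fragment a c :
  @runs (step_fragment a) tt c (apply_action (a (look c)) c) 1.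
Proof. exact: RunsExit. Qed.

Lemma runs_compile p c c' t : exec x u m p c c' t -> uses T p ->
  runs (fr_start (compile p)) (conf_of c) (conf_of c') t.
Proof.
elim=> {p c c' t}.
- move=> i P k r o /= /andP[iT kT].
  have iE : (inord i : 'I_T.+1) = i :> nat by rewrite inordK // ltnW.
  have e : look (conf_of (r, o)) (inord i) = sym x u m r i.
    by rewrite look_conf_of iE.
  rewrite -e; case: ifP => h.
  + rewrite -(@apply_moving k MoveRight r (upd r k (r k).+1)) //.
    * have := runs_step_fragment (fun r : reads =>
        if P (r (inord i)) then moving k MoveRight r else keep r) (conf_of (r, o)).
      by rewrite h.
    * by move=> j jk; rewrite /upd (negbTE jk).
    * by rewrite /upd eqxx /= -addn1 PoszD.
  + rewrite -{2}[conf_of (r, o)]apply_keep.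
    have := runs_step_fragment (fun r : reads =>
      if P (r (inord i)) then moving k MoveRight r else keep r) (conf_of (r, o)).
    by rewrite h.
- move=> k r o rk /= kT.
  rewrite -(@apply_moving k MoveLeft r (upd r k (r k).-1)) //.
  + exact: runs_step_fragment.
  + by move=> j jk; rewrite /upd (negbTE jk).
  + by rewrite /upd eqxx /=; lia.
- move=> i P r o /= iT.
  have iE : (inord i : 'I_T.+1) = i :> nat by rewrite inordK // ltnW.
  have e : look (conf_of (r, o)) (inord i) = sym x u m r i.
    by rewrite look_conf_of iE.
  rewrite -e -apply_writing.
  exact: (runs_step_fragment (fun r => writing (P (r (inord i))) r)).
- move=> p q c c1 c2 t1 t2 _ ih1 _ ih2 /= /andP[/ih1 h1 /ih2 h2].
  exact: runs_seq h1 h2.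
- move=> i P p r o h /= /andP[iT _].
  have iE : (inord i : 'I_T.+1) = i :> nat by rewrite inordK // ltnW.
  rewrite -{2}[conf_of (r, o)]apply_keep.
  apply: (@RunsExit (compile (While i P p)) None _ (keep (look (conf_of (r, o))))).
  by rewrite /= look_conf_of iE // h.
- move=> i P p r o c1 c2 t1 t2 h _ ih1 _ ih2 /= /andP[iT up].
  have iE : (inord i : 'I_T.+1) = i :> nat by rewrite inordK // ltnW.
  apply: (@RunsStep (compile (While i P p)) None _ (Some (fr_start (compile p))) (keep (look (conf_of (r, o))))).
    by rewrite /= look_conf_of iE // h.
  rewrite apply_keep; apply: runs_while_body (ih1 up) _.
  by apply: ih2; rewrite /= iT.
Qed.

(* The machine first marks cell 0 of the counter tapes. *)
Definition machine (F : fragment) : turing_machine :=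
  @TuringMachine (option (option (fr_state F))) T (Some None)
    (fun q => ~~ isSome q) (fun q r =>
    match q with
    | None => (None, keep r)
    | Some None => (Some (Some (fr_start F)), fun i : 'I_T.+1 =>
        (if (2 < i)%N && (i < T)%N then Some true else r i, Stay))
    | Some (Some q) => let: (q', a) := fr_trans q r in (omap Some q', a)
    end).

Lemma machine_runs F (q : fr_state F) c c' t : runs q c c' t ->
  iter t (@tm_step (machine F)) (@TMConfig (machine F) (Some (Some q)) c.1 c.2)
  = @TMConfig (machine F) None c'.1 c'.2.
Proof.
elim=> {q c c' t} [q c a e|q c q' a c' t e _ ih].
- by rewrite /= /tm_step /= -/(look c) e.
- by rewrite iterSr /tm_step /= -/(look c) e /=; exact: ih.
Qed.

Lemma machine_outputs p r o t s : (2 < T)%N -> uses T p ->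
  exec x u m p (fun=> 0%N, [::]) (r, o) t -> (t < s)%N ->
  tm_outputs (machine (compile p)) [:: x; u; nseq m true] s o.
Proof.
move=> T2 up /runs_compile /(_ up) /machine_runs e ts.
pose M := machine (compile p).
have e0 : tm_step (tm_init M [:: x; u; nseq m true]) =
    @TMConfig M (Some (Some (fr_start (compile p))))
      (conf_of (fun=> 0%N, [::])).1 (conf_of (fun=> 0%N, [::])).2.
  rewrite /tm_step /=; congr TMConfig.
  - by apply/funext => i /=; case: ifP.
  - apply/funext => i; apply/funext => z /=; rewrite ffunE /=.
    case: i => i iT /=; have [->|iT'] := eqVneq i T.
      rewrite ltnn andbF.
      by case: T T2 => [|[|[|T']]] // _; case: eqP => [->|] //=; rewrite nth_nil.
    have -> : (i < T)%N by rewrite ltn_neqAle iT' -ltnS.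
    rewrite andbT; case: i iT iT' => [|[|[|i]]] iT iT' //=;
      try (by case: eqP => [->|]).
    by rewrite nth_nil; case: eqP => [->|] //=; case: z => // -[|[|z]].
(* A halted configuration is fixed by [tm_step], so every larger budget gives the same result. *)
have stop : forall k, iter (k + t.+1) (@tm_step M) (tm_init M [:: x; u; nseq m true])
    = @TMConfig M None (conf_of (r, o)).1 (conf_of (r, o)).2.
  elim=> [|k ih]; first by rewrite add0n iterSr e0 e.
  by rewrite addSn iterS ih.
rewrite /tm_outputs -(subnK ts) stop; split=> // j _ /=.
by rewrite eqxx.
Qed.

End Compile.

(** * Functions computed by counter programs in polynomial time *)

Section CounterPrograms.
Local Open Scope nat_scope.

Definition input := (seq bool * seq bool * nat)%type.

Definition runsto (I : input) p c c' (T : nat) : Prop :=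
  exists2 t, t <= T & exec I.1.1 I.1.2 I.2 p c c' t.

Lemma runsto_le I p c c' T T' : T <= T' -> runsto I p c c' T -> runsto I p c c' T'.
Proof. by move=> h [t tT e]; exists t => //; exact: leq_trans h. Qed.

Lemma runsto_seq I p q c c1 c2 T1 T2 :
  runsto I p c c1 T1 -> runsto I q c1 c2 T2 -> runsto I (Seq p q) c c2 (T1 + T2).
Proof.
move=> [t1 h1 e1] [t2 h2 e2]; exists (t1 + t2); first exact: leq_add.
exact: ExecSeq e1 e2.
Qed.

Definition Inc (k : nat) : prog := CInc 0 xpredT k.
Definition Nop : prog := CInc 0 xpred0 0.

Lemma runsto_Inc I k r o : runsto I (Inc k) (r, o) (upd r k (r k).+1, o) 1.
Proof. by exists 1 => //; exact: (@ExecCInc _ _ _ 0 xpredT). Qed.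

Lemma runsto_Nop I r o : runsto I Nop (r, o) (r, o) 1.
Proof. by exists 1 => //; exact: (@ExecCInc _ _ _ 0 xpred0). Qed.

Definition blank (s : option bool) : bool := ~~ isSome s.

Definition Loop (k : nat) (p : prog) : prog := While k blank (Seq (Dec k) p).

Lemma blank_counter x u m r k : 3 <= k -> blank (sym x u m r k) = (0 < r k).
Proof. by case: k => [|[|[|k]]] // _; rewrite /sym /=; case: (r _) => [|[]]. Qed.

Lemma updE r k v j : upd r k v j = if j == k then v else r j.
Proof. by []. Qed.

Lemma upd_upd r k v w : upd (upd r k v) k w = upd r k w.
Proof. by apply/funext => j; rewrite /upd; case: eqP. Qed.

Lemma upd_id r k : upd r k (r k) = r.
Proof. by apply/funext => j; rewrite /upd; case: eqP => [->|]. Qed.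

(** [S j] and [O j] are the registers and the output after [j] rounds. Register [k] is overridden
    throughout: it holds the number of rounds left, already decremented when the body starts. *)
Lemma runsto_Loop I k p (S : nat -> nat -> nat) (O : nat -> seq bool) v T :
  3 <= k ->
  (forall j, j < v -> runsto I p (upd (S j) k (v - j.+1), O j)
                              (upd (S j.+1) k (v - j.+1), O j.+1) T) ->
  runsto I (Loop k p) (upd (S 0) k v, O 0) (upd (S v) k 0, O v) ((T + 2) * v + 1).
Proof.
move=> k3; elim: v S O => [|v ih] S O h.
  exists 1; first by rewrite muln0.
  by apply: ExecWhileF; rewrite blank_counter // updE eqxx.
have {ih} [t tT e] := ih (fun j => S j.+1) (fun j => O j.+1) (fun j jv => h j.+1 jv).
have [t1 t1T e1] := h 0 isT; rewrite subn1 /= in e1.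
exists (1 + t1 + t).+1; first by rewrite mulnS; lia.
apply: ExecWhileT e; first by rewrite blank_counter // updE eqxx.
apply: ExecSeq e1.
have := @ExecDec I.1.1 I.1.2 I.2 k (upd (S 0) k v.+1) (O 0).
by rewrite upd_upd updE eqxx => /(_ isT).
Qed.

Lemma runsto_Loop_at I k p r r' o (S : nat -> nat -> nat) T :
  3 <= k ->
  (forall j, j < r k -> runsto I p (upd (S j) k (r k - j.+1), o)
                              (upd (S j.+1) k (r k - j.+1), o) T) ->
  S 0 = r -> upd (S (r k)) k 0 = r' ->
  runsto I (Loop k p) (r, o) (r', o) ((T + 2) * r k + 1).
Proof.
move=> k3 h S0 Sv.
have := runsto_Loop k3 h.
by rewrite Sv S0 upd_id.
Qed.

Ltac updt := apply/funext => ?; rewrite /upd;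
  repeat (case: eqP => ?); subst; try lia.

Definition Clear k := Loop k Nop.

Lemma runsto_Clear I k r o : 3 <= k ->
  runsto I (Clear k) (r, o) (upd r k 0, o) (3 * r k + 1).
Proof.
move=> k3; apply: (runsto_Loop_at (S := fun=> r) (T := 1) k3) => // j jr.
exact: runsto_Nop.
Qed.

Definition Move k k' := Loop k (Inc k').

Lemma runsto_Move I k k' r o : 3 <= k -> k != k' ->
  runsto I (Move k k') (r, o) (upd (upd r k' (r k' + r k)) k 0, o) (3 * r k + 1).
Proof.
move=> k3 /eqP kk'.
apply: (runsto_Loop_at (S := fun j => upd r k' (r k' + j)) (T := 1) k3) => // [j jr|].
  have -> : upd (upd r k' (r k' + j.+1)) k (r k - j.+1) =
    upd (upd (upd r k' (r k' + j)) k (r k - j.+1)) k'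
      ((upd (upd r k' (r k' + j)) k (r k - j.+1)) k').+1.
    by updt.
  exact: runsto_Inc.
by updt.
Qed.

(** Reading a counter empties it, so its value goes both to [k] and to the scratch register [t],
    from which [i] is restored. *)
Definition Copy i k t := Seq (Loop i (Seq (Inc k) (Inc t))) (Move t i).

Lemma runsto_Copy I i k t r o : 3 <= i -> 3 <= t -> i != k -> i != t -> k != t ->
  r t = 0 ->
  runsto I (Copy i k t) (r, o) (upd r k (r k + r i), o) (7 * r i + 2).
Proof.
move=> i3 t3 /eqP ik /eqP it /eqP kt rt.
pose r1 := upd (upd (upd r k (r k + r i)) t (r i)) i 0.
have h1 : runsto I (Loop i (Seq (Inc k) (Inc t))) (r, o) (r1, o) ((2 + 2) * r i + 1).
  apply: (runsto_Loop_at (S := fun j => upd (upd r k (r k + j)) t j) (T := 2) i3).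
  - move=> j jr; apply: (@runsto_seq _ _ _ _
      (upd (upd (upd r k (r k + j.+1)) t j) i (r i - j.+1), o) _ 1 1).
    + have -> : upd (upd (upd r k (r k + j.+1)) t j) i (r i - j.+1) =
        upd (upd (upd (upd r k (r k + j)) t j) i (r i - j.+1)) k
        ((upd (upd (upd r k (r k + j)) t j) i (r i - j.+1)) k).+1.
        by updt.
      exact: runsto_Inc.
    + have -> : upd (upd (upd r k (r k + j.+1)) t j.+1) i (r i - j.+1) =
        upd (upd (upd (upd r k (r k + j.+1)) t j) i (r i - j.+1)) t
        ((upd (upd (upd r k (r k + j.+1)) t j) i (r i - j.+1)) t).+1.
        by updt.
      exact: runsto_Inc.
  - by updt.
  - by rewrite /r1; updt.
have h2 : runsto I (Move t i) (r1, o) (upd r k (r k + r i), o) (3 * r1 t + 1).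
  have -> : upd r k (r k + r i) = upd (upd r1 i (r1 i + r1 t)) t 0.
    by rewrite /r1; updt.
  by apply: runsto_Move => //; apply/eqP => ti; apply: it.
apply: runsto_le (runsto_seq h1 h2).
have -> : r1 t = r i by rewrite /r1 /upd; repeat (case: eqP => ?); lia.
lia.
Qed.

(** The summand 2 keeps the size at least 2, so that constant factors in time bounds are absorbed by
    a larger exponent. *)
Definition sz (I : input) (env : seq nat) : nat :=
  2 + size I.1.1 + size I.1.2 + I.2 + sumn env.

(* The arguments are found in the registers [rs], the registers from [k] on are
   free, and the value is left in register [k]. *)
Definition computable (v : nat) (F : input -> seq nat -> nat) : Prop :=
  exists c, forall rs k, size rs = v -> all (fun i => 3 <= i < k) rs -> 3 <= k ->
  exists p, forall I r, r 0 = 0 -> r 1 = 0 -> r 2 = 0 ->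
    (forall j, k <= j -> r j = 0) ->
    F I (map r rs) <= sz I (map r rs) ^ c /\
    forall o, runsto I p (r, o) (upd r k (F I (map r rs)), o) (sz I (map r rs) ^ c).

Lemma sz_ge2 I env : 2 <= sz I env. Proof. by rewrite /sz; lia. Qed.

Lemma sz_nth I env i : nth 0 env i <= sz I env.
Proof.
suff : nth 0 env i <= sumn env by rewrite /sz; lia.
by elim: env i => [|a env ih] [|i] //=; [lia | have := ih i; lia].
Qed.

Lemma expn_le S a b : 2 <= S -> a <= b -> S ^ a <= S ^ b.
Proof. by move=> h; apply: leq_pexp2l; lia. Qed.

Lemma expn_mono m n e : m <= n -> m ^ e <= n ^ e.
Proof. by case: e => // e h; rewrite leq_exp2r. Qed.

Lemma expn_add1_le S c : 2 <= S -> S ^ c + 1 <= S ^ c.+2.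
Proof.
move=> S2; have e : 0 < S ^ c by rewrite expn_gt0; lia.
rewrite !expnS; apply: (@leq_trans (2 * (2 * S ^ c))); first lia.
by rewrite !leq_mul.
Qed.

Lemma mul_exp_le S c a : 2 <= S -> c <= 2 ^ a -> c * S <= S ^ a.+1.
Proof.
move=> S2 ca; rewrite expnSr leq_mul2r (leq_trans ca) ?orbT //.
exact: expn_mono.
Qed.

Lemma computable_ext v F G : (forall I env, size env = v -> F I env = G I env) ->
  computable v F -> computable v G.
Proof.
move=> h [c H]; exists c => rs k hrs h2 h3.
have [p Hp] := H rs k hrs h2 h3; exists p => I r r0 r1 r2 hk.
have := Hp I r r0 r1 r2 hk.
by rewrite h ?size_map.
Qed.

Lemma map_upd_lt r rs k k' v : all (fun i => 3 <= i < k) rs -> k <= k' ->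
  map (upd r k' v) rs = map r rs.
Proof.
move=> h kk'; apply/eq_in_map => i /(allP h) /andP[_ ik].
by rewrite updE ltn_eqF // (leq_trans ik).
Qed.

Lemma computable_zero v : computable v (fun _ _ => 0).
Proof.
exists 1 => rs k _ _ k3; exists Nop => I r _ _ _ hk; split=> // o.
have -> : upd r k 0 = r by rewrite -{2}(upd_id r k) hk.
apply: runsto_le (runsto_Nop _ _ _).
by rewrite expn1; have := sz_ge2 I (map r rs); lia.
Qed.

Lemma computable_nth v i : i < v -> computable v (fun _ env => nth 0 env i).
Proof.
move=> iv; exists 4 => rs k hrs h k3.
have i_rs : i < size rs by rewrite hrs.
have /andP[hi1 hi2] := allP h _ (mem_nth 0 i_rs).
exists (Copy (nth 0 rs i) k k.+1) => I r _ _ _ hk.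
rewrite (nth_map 0) //.
have S2 := sz_ge2 I (map r rs).
have le : r (nth 0 rs i) <= sz I (map r rs).
  by have := sz_nth I (map r rs) i; rewrite (nth_map 0).
have e : 8 * sz I (map r rs) <= sz I (map r rs) ^ 4 by exact: mul_exp_le.
split; first lia.
move=> o; have := @runsto_Copy I (nth 0 rs i) k k.+1 r o.
rewrite (hk k) // (hk k.+1) // add0n => H.
apply: (runsto_le _ (H _ _ _ _ _ _)) => //; try lia.
- by rewrite (ltn_eqF hi2).
- by rewrite (ltn_eqF (leqW hi2)).
Qed.

Lemma computable_succ v F : computable v F -> computable v (fun I env => (F I env).+1).
Proof.
move=> [c H]; exists c.+2 => rs k hrs h k3.
have [p Hp] := H rs k hrs h k3.
exists (Seq p (Inc k)) => I r r0 r1 r2 hk.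
have [le run] := Hp I r r0 r1 r2 hk.
have S2 := sz_ge2 I (map r rs).
have e := expn_add1_le c S2.
split; first lia.
move=> o; apply: runsto_le e _; apply: runsto_seq (run o) _.
have := runsto_Inc I k (upd r k (F I (map r rs))) o.
by rewrite upd_upd updE eqxx.
Qed.

Lemma computable_reindex v v' F (s : seq nat) : computable v F -> size s = v ->
  all (fun i => i < v') s ->
  computable v' (fun I env => F I [seq nth 0 env i | i <- s]).
Proof.
move=> [c H] hs h; exists (2 * c * v.+1) => rs k hrs hk k3.
have hrs' : all (fun i => 3 <= i < k) [seq nth 0 rs i | i <- s].
  by rewrite all_map; apply: sub_all h => i /= iv; apply: (allP hk); rewrite mem_nth // hrs.
have hsz : size [seq nth 0 rs i | i <- s] = v by rewrite size_map.
have [p Hp] := H _ k hsz hrs' k3.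
exists p => I r r0 r1 r2 hr.
have [] := Hp I r r0 r1 r2 hr.
have e : map r [seq nth 0 rs i | i <- s] = [seq nth 0 (map r rs) i | i <- s].
  rewrite -map_comp; apply/eq_in_map => i /(allP h) iv /=.
  by rewrite (nth_map 0) // hrs.
rewrite e.
set S := sz I (map r rs).
have S2 : 2 <= S by exact: sz_ge2.
have le1 : sz I [seq nth 0 (map r rs) i | i <- s] <= S * v.+1.
  rewrite -hs {e Hp hsz hrs' h H hs}.
  elim: s => [|i s ih]; first by rewrite muln1 /S /sz /=; lia.
  have := sz_nth I (map r rs) i; rewrite -/S.
  by move: ih; rewrite {1 2}/sz /= (mulnS _ (size s).+1); lia.
have le2 : S * v.+1 <= S ^ (2 * v.+1).
  rewrite mul2n -addnn expnD; apply: leq_mul.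
    by rewrite -{1}(expn1 S); exact: expn_le.
  apply: leq_trans (ltnW (ltn_expl v.+1 S2)) _; lia.
have le3 : sz I [seq nth 0 (map r rs) i | i <- s] ^ c <= S ^ (2 * c * v.+1).
  rewrite -mulnA (mulnC c) mulnA expnM.
  by apply: expn_mono; exact: leq_trans le2.
move=> f1 f2; split; first exact: leq_trans le3.
by move=> o; exact: runsto_le (f2 o).
Qed.

(** The value of [G] sits in register [k] as an argument while [F] computes into [k.+1]; clearing
    [k] and moving the result down restores the convention that all registers beyond the result are
    zero. *)
Lemma computable_let v F G : computable v G -> computable v.+1 F ->
  computable v (fun I env => F I (G I env :: env)).
Proof.
move=> [cG HG] [cF HF].
pose E := cG + (cG + 2) * cF + 1.
exists (E + 4) => rs k hrs h k3.
have [pG HpG] := HG rs k hrs h k3.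
have h' : all (fun i => 3 <= i < k.+1) (k :: rs).
  rewrite /= k3 ltnSn; apply: sub_all h => i; lia.
have [pF HpF] := HF (k :: rs) k.+1 (congr1 S hrs) h' (leqW k3).
exists (Seq pG (Seq pF (Seq (Clear k) (Move k.+1 k)))) => I r r0 r1 r2 hk.
have [leG runG] := HpG I r r0 r1 r2 hk.
set env := map r rs in leG runG *; set g := G I env in leG runG *.
have ek : map (upd r k g) (k :: rs) = g :: env.
  by rewrite /= updE eqxx (map_upd_lt _ _ h).
have hk' j : k < j -> upd r k g j = 0 by move=> kj; rewrite updE gtn_eqF // hk // ltnW.
have [] := HpF I (upd r k g) _ _ _ hk'; try (by rewrite updE ltn_eqF //; lia).
rewrite ek; set f := F I (g :: env) => leF runF.
set S := sz I env in leG runG *.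
have S2 : 2 <= S by exact: sz_ge2.
have leS : sz I (g :: env) <= S ^ (cG + 2).
  have -> : sz I (g :: env) = S + g by rewrite /S /sz /=; lia.
  have e1 : S <= S ^ cG.+1 by rewrite -{1}(expn1 S); exact: expn_le.
  have e2 : g <= S ^ cG.+1 by apply: leq_trans leG _; exact: expn_le.
  by rewrite addn2 expnS; nia.
have leT : sz I (g :: env) ^ cF <= S ^ E.
  apply: (@leq_trans (S ^ ((cG + 2) * cF))).
    by rewrite expnM; exact: expn_mono.
  by apply: expn_le => //; rewrite /E; lia.
have gE : S ^ cG <= S ^ E by apply: expn_le => //; rewrite /E; lia.
have tot : 10 * S ^ E <= S ^ (E + 4).
  by rewrite expnD mulnC leq_mul2l (leq_trans (_ : _ <= 2 ^ 4)) ?orbT // expn_mono.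
have E1 : 1 <= S ^ E by rewrite expn_gt0; lia.
split; first by lia.
move=> o.
apply: (runsto_le _ (runsto_seq (runG o) (runsto_seq (runF o) (runsto_seq
   (runsto_Clear _ _ _ k3) _)))); last first.
  have -> : upd r k f = upd (upd (upd (upd (upd r k g) k.+1 f) k 0) k
    ((upd (upd (upd r k g) k.+1 f) k 0) k + (upd (upd (upd r k g) k.+1 f) k 0) k.+1)) k.+1 0.
    by have hk1 := hk k.+1 (leqnSn k); updt.
  by apply: runsto_Move; [lia | apply/eqP; lia].
rewrite /upd ?eqxx ?(ltn_eqF (ltnSn k)) ?(gtn_eqF (ltnSn k)) ?eqxx.
lia.
Qed.

(** A counter costs as much time as its value, so iteration preserves polynomial time only if all
    intermediate values are polynomially bounded; this is the last premise. *)
Lemma computable_iter v N Z H :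
  computable v N -> computable v Z -> computable v.+2 H ->
  (exists c, forall I env, size env = v -> forall j, j <= N I env ->
     iteri j (fun i acc => H I [:: acc, i & env]) (Z I env) <= sz I env ^ c) ->
  computable v (fun I env =>
    iteri (N I env) (fun i acc => H I [:: acc, i & env]) (Z I env)).
Proof.
move=> [cN HN] [cZ HZ] [cH HH] [c0 Hc].
pose E := cN + cZ + (c0 + cN + 3) * cH + c0 + 1.
exists (7 * E) => rs k hrs h k3.
have [pN HpN] := HN rs k hrs h k3.
have h2 : all (fun i => 3 <= i < k.+2) rs by apply: sub_all h => i; lia.
have [pZ HpZ] := HZ rs k.+2 hrs h2 (leqW (leqW k3)).
have h3 : all (fun i => 3 <= i < k.+3) [:: k.+2, k.+1 & rs].
  by rewrite /=; apply/and3P; split; [lia | lia | apply: sub_all h => i; lia].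
have [pH HpH] := HH [:: k.+2, k.+1 & rs] k.+3 (congr1 (S \o S) hrs) h3
  (leqW (leqW (leqW k3))).
(* Register [k] counts the remaining rounds, [k.+1] holds the round index, [k.+2] the accumulator
   and [k.+3] its next value. *)
exists (Seq pN (Seq pZ (Seq (Loop k (Seq pH (Seq (Clear k.+2)
  (Seq (Move k.+3 k.+2) (Inc k.+1))))) (Seq (Clear k.+1) (Move k.+2 k)))))
  => I r r0 r1 r2 hk.
have [leN runN] := HpN I r r0 r1 r2 hk.
set env := map r rs in leN runN *; set n := N I env in leN runN *.
pose acc j := iteri j (fun i acc => H I [:: acc, i & env]) (Z I env).
have senv : size env = v by rewrite size_map.
have hacc j : j <= n -> acc j <= sz I env ^ c0 by move=> jn; exact: Hc.
set S := sz I env in leN runN hacc *.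
have S2 : 2 <= S by exact: sz_ge2.
have lift a : a <= E -> S ^ a <= S ^ E by exact: expn_le.
have E1 : 1 <= S ^ E by rewrite expn_gt0; lia.
have tot : 30 * (S ^ E) ^ 2 <= S ^ (7 * E).
  have B2 : 2 <= S ^ E.
    apply: leq_trans S2 _; rewrite -{1}(expn1 S); apply: lift; rewrite /E; lia.
  rewrite (mulnC 7) expnM (mulnC 30) (_ : 7 = 2 + 5) // expnD leq_mul2l.
  by rewrite (leq_trans (_ : _ <= 2 ^ 5)) ?orbT // expn_mono.
have hacc' j : j <= n -> acc j <= S ^ E.
  by move=> /hacc /leq_trans; apply; apply: lift; rewrite /E; lia.
have leN' : n <= S ^ E by apply: leq_trans leN (lift _ _); rewrite /E; lia.
split.
  rewrite -/(acc n); apply: leq_trans (hacc' _ (leqnn n)) _; apply: expn_le => //; lia.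
move=> o.
have upd0 w i : i < 3 -> upd r k w i = r i by move=> i3; rewrite updE ltn_eqF //; lia.
have hkZ j : k.+1 < j -> upd r k n j = 0.
  by move=> kj; rewrite updE gtn_eqF ?hk //; lia.
have [leZ runZ] := HpZ I (upd r k n) (etrans (upd0 n 0 isT) r0)
  (etrans (upd0 n 1 isT) r1) (etrans (upd0 n 2 isT) r2) hkZ.
rewrite (map_upd_lt _ _ h) // -/env -/(acc 0) -/S in leZ runZ.
pose St j := upd (upd r k.+1 j) k.+2 (acc j).
have body j : j < n -> runsto I
    (Seq pH (Seq (Clear k.+2) (Seq (Move k.+3 k.+2) (Inc k.+1))))
    (upd (St j) k (n - j.+1), o) (upd (St j.+1) k (n - j.+1), o) (10 * S ^ E).
  move=> jn; pose ra := upd (St j) k (n - j.+1).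
  have ra0 i : i < 3 -> ra i = r i.
    by move=> i3; rewrite /ra /St /upd !ltn_eqF //; lia.
  have ra1 i : k.+2 < i -> ra i = 0.
    by move=> i3; rewrite /ra /St /upd !gtn_eqF ?hk //; lia.
  have [] := HpH I ra (etrans (ra0 0 isT) r0) (etrans (ra0 1 isT) r1)
    (etrans (ra0 2 isT) r2) ra1.
  have -> : map ra [:: k.+2, k.+1 & rs] = [:: acc j, j & env].
    rewrite /= /ra /St (map_upd_lt _ _ h) // (map_upd_lt _ _ h) ?(map_upd_lt _ _ h) //;
      try lia.
    by congr [:: _, _ & _]; rewrite /upd; repeat (case: eqP => ?); lia.
  rewrite -/(acc j.+1) => leH runH.
  have leS : sz I [:: acc j, j & env] <= S ^ (c0 + cN + 3).
    have -> : sz I [:: acc j, j & env] = S + acc j + j by rewrite /S /sz /=; lia.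
    have e1 : S <= S ^ (c0 + cN + 1) by rewrite -{1}(expn1 S); apply: expn_le => //; lia.
    have e2 : acc j <= S ^ (c0 + cN + 1).
      apply: leq_trans (hacc _ (ltnW jn)) _; apply: expn_le => //; lia.
    have e3 : j <= S ^ (c0 + cN + 1).
      apply: leq_trans (ltnW jn) (leq_trans leN _); apply: expn_le => //; lia.
    have -> : c0 + cN + 3 = (c0 + cN + 1) + 2 by lia.
    rewrite (expnD _ _ 2); apply: (@leq_trans (S ^ (c0 + cN + 1) * 2 ^ 2)); first lia.
    by rewrite leq_mul2l expn_mono ?orbT.
  have leT : sz I [:: acc j, j & env] ^ cH <= S ^ E.
    apply: (@leq_trans (S ^ ((c0 + cN + 3) * cH))).
      by rewrite expnM; exact: expn_mono.
    by apply: lift; rewrite /E; lia.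
  have a1 := hacc' _ (ltnW jn); have a2 := hacc' _ jn.
  pose rb := upd ra k.+3 (acc j.+1).
  have f1 := runsto_Clear I rb o (leqW (leqW k3)).
  have e1 : rb k.+2 = acc j.
    by rewrite /rb /ra /St /upd; repeat (case: eqP => ?); lia.
  have f2 := @runsto_Move I k.+3 k.+2 (upd rb k.+2 0) o (leqW (leqW (leqW k3)))
    (negbT (gtn_eqF (ltnSn k.+2))).
  have e2 : upd rb k.+2 0 k.+3 = acc j.+1.
    by rewrite /rb /ra /St /upd; repeat (case: eqP => ?); lia.
  have e3 : upd rb k.+2 0 k.+2 = 0 by rewrite updE eqxx.
  rewrite e2 e3 add0n in f2; rewrite e1 in f1.
  have f3 := runsto_Inc I k.+1 (upd (upd (upd rb k.+2 0) k.+2 (acc j.+1)) k.+3 0) o.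
  have f := runsto_seq (runH o) (runsto_seq f1 (runsto_seq f2 f3)).
  have -> : upd (St j.+1) k (n - j.+1) =
    upd (upd (upd (upd rb k.+2 0) k.+2 (acc j.+1)) k.+3 0) k.+1
      (upd (upd (upd rb k.+2 0) k.+2 (acc j.+1)) k.+3 0 k.+1).+1.
    have hk3 := hk k.+3 (leqW (leqW (leqnSn k))).
    by rewrite /rb /ra /St; updt.
  by apply: runsto_le f; lia.
have loop := runsto_Loop (S := St) (O := fun=> o) k3 body.
have e0 : upd (upd r k n) k.+2 (acc 0) = upd (St 0) k n.
  by have hk1 := hk k.+1 (leqnSn k); rewrite /St; updt.
have f1 := runsto_Clear I (upd (St n) k 0) o (leqW k3).
have e1 : upd (St n) k 0 k.+1 = n.
  by rewrite /St /upd; repeat (case: eqP => ?); lia.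
have f2 := @runsto_Move I k.+2 k (upd (upd (St n) k 0) k.+1 0) o (leqW (leqW k3))
  (negbT (gtn_eqF (leqW (ltnSn k)))).
have e2 : upd (upd (St n) k 0) k.+1 0 k.+2 = acc n.
  by rewrite /St /upd; repeat (case: eqP => ?); lia.
have e3 : upd (upd (St n) k 0) k.+1 0 k = 0.
  by rewrite /St /upd; repeat (case: eqP => ?); lia.
rewrite e2 e3 add0n in f2; rewrite e1 in f1.
have e4 : upd (upd (upd (upd (St n) k 0) k.+1 0) k (acc n)) k.+2 0 = upd r k (acc n).
  have hk1 := hk k.+1 (leqnSn k); have hk2 := hk k.+2 (leqW (leqnSn k)).
  by rewrite /St; updt.
rewrite e4 in f2; rewrite e0 in runZ.
apply: runsto_le (runsto_seq (runN o) (runsto_seq (runZ o)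
  (runsto_seq loop (runsto_seq f1 f2)))).
have a1 := hacc' _ (leqnn n).
have a2 : S ^ cN <= S ^ E by apply: lift; rewrite /E; lia.
have a3 : S ^ cZ <= S ^ E by apply: lift; rewrite /E; lia.
apply: leq_trans tot; rewrite expnS expn1.
have a4 : (10 * S ^ E + 2) * n <= (12 * S ^ E) * S ^ E.
  by apply: leq_mul => //; lia.
have a5 : S ^ E <= S ^ E * S ^ E by rewrite leq_pmulr.
lia.
Qed.

(** The head of tape [i] runs to the first blank; [k] keeps the length found and [t] counts the
    steps for walking the head back. *)
Definition Scan (i k t : nat) : prog :=
  Seq (While i (@isSome bool) (Seq (Inc i) (Seq (Inc k) (Inc t)))) (Loop t (Dec i)).

Lemma runsto_Scan I i k t r o : i < 3 -> 3 <= k -> 3 <= t -> k != t ->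
  r i = 0 -> r k = 0 -> r t = 0 ->
  let w := tape_word I.1.1 I.1.2 I.2 i in
  runsto I (Scan i k t) (r, o) (upd r k (size w), o) (7 * size w + 2).
Proof.
move=> i3 k3 t3 /eqP kt ri rk rt w.
pose St j := upd (upd (upd r i j) k j) t j.
have h1 j : j <= size w -> runsto I (While i (@isSome bool)
    (Seq (Inc i) (Seq (Inc k) (Inc t)))) (St (size w - j), o) (St (size w), o) (4 * j + 1).
  elim: j => [|j ih] jw.
    exists 1 => //; rewrite subn0; apply: ExecWhileF.
    have -> : sym I.1.1 I.1.2 I.2 (St (size w)) i = onth w (size w).
      by rewrite /sym /St /upd; repeat (case: eqP => ?); subst; try lia.
    by rewrite onth_default.
  have [t1 t1T e1] := ih (ltnW jw).
  exists (3 + t1).+1; first lia.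
  pose l := size w - j.+1.
  apply: ExecWhileT e1.
    have -> : sym I.1.1 I.1.2 I.2 (St (size w - j.+1)) i = onth w (size w - j.+1).
      by rewrite /sym /St /upd; repeat (case: eqP => ?); subst; try lia.
    by rewrite onthTE; lia.
  have f k' r' o' : exec I.1.1 I.1.2 I.2 (Inc k') (r', o') (upd r' k' (r' k').+1, o') 1.
    exact: (@ExecCInc _ _ _ 0 xpredT).
  have := ExecSeq (f i (St l) o) (ExecSeq (f k _ o) (f t _ o)).
  congr exec; congr pair; rewrite /St /l; updt.
have h2 : runsto I (Loop t (Dec i)) (St (size w), o) (upd r k (size w), o)
    ((1 + 2) * (St (size w) t) + 1).
  have et : St (size w) t = size w by rewrite /St updE eqxx.
  apply: (runsto_Loop_at (S := fun j => upd (upd (upd r i (size w - j)) k (size w)) t (size w)) (T := 1) t3).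
  - rewrite et => j jw; exists 1 => //.
    have := @ExecDec I.1.1 I.1.2 I.2 i
      (upd (upd (upd (upd r i (size w - j)) k (size w)) t (size w)) t (size w - j.+1)) o.
    have -> : upd (upd (upd (upd r i (size w - j)) k (size w)) t (size w)) t
       (size w - j.+1) i = size w - j.
      by rewrite /upd; repeat (case: eqP => ?); subst; lia.
    move=> /(_ _); rewrite subn_gt0 => /(_ jw).
    by congr exec; congr pair; updt.
  - by rewrite /St; updt.
  - by rewrite et; updt.
have e0 : r = St (size w - size w) by rewrite subnn /St; updt.
rewrite {1}e0; apply: runsto_le (runsto_seq (h1 _ (leqnn _)) h2).
by rewrite /St updE eqxx; lia.
Qed.

Lemma computable_size v i : i < 3 ->
  computable v (fun I _ => size (tape_word I.1.1 I.1.2 I.2 i)).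
Proof.
move=> i3; exists 4 => rs k _ _ k3; exists (Scan i k k.+1) => I r r0 r1 r2 hk.
have ri : r i = 0 by case: i i3 => [|[|[|i]]].
set S := sz _ _; set w := tape_word _ _ _ _.
have S2 : 2 <= S by exact: sz_ge2.
have e : 8 * S <= S ^ 4 by exact: mul_exp_le.
have le : size w <= S.
  by rewrite /w /S /sz; case: i i3 {w ri} => [|[|[|i]]] //= _; rewrite ?size_nseq; lia.
split; first lia.
move=> o.
have := @runsto_Scan I i k k.+1 r o i3 k3 (leqW k3) (negbT (ltn_eqF (ltnSn k))) ri
  (hk k (leqnn k)) (hk _ (leqnSn k)).
by apply: runsto_le; rewrite -/w; lia.
Qed.

Definition is_one (s : option bool) : bool := s == Some true.

Definition Read (i a k : nat) : prog :=
  Seq (Copy a k.+1 k.+2) (Seq (Loop k.+1 (Seq (Inc i) (Inc k.+2)))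
    (Seq (CInc i is_one k) (Loop k.+2 (Dec i)))).

Lemma computable_read v i : i < 3 ->
  computable v.+1 (fun I env =>
    nth false (tape_word I.1.1 I.1.2 I.2 i) (nth 0 env 0)).
Proof.
move=> i3; exists 6 => -[|a rs] k //= _ /andP[/andP[a3 ak] _] k3.
exists (Read i a k) => I r r0 r1 r2 hk.
have ri : r i = 0 by case: i i3 => [|[|[|i]]].
set S := sz _ _; set w := tape_word _ _ _ _.
have S2 : 2 <= S by exact: sz_ge2.
have e : 32 * S <= S ^ 6 by exact: mul_exp_le.
have le : r a <= S by rewrite /S /sz /=; lia.
split; first by have := leq_b1 (nth false w (r a)); lia.
have hk0 := hk k (leqnn k); have hk1 := hk k.+1 (leqnSn k).
have hk2 := hk k.+2 (leqW (leqnSn k)).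
move=> o.
have f1 := @runsto_Copy I a k.+1 k.+2 r o a3 (leqW (leqW k3))
  (negbT (ltn_eqF (leqW ak))) (negbT (ltn_eqF (leqW (leqW ak))))
  (negbT (ltn_eqF (ltnSn k.+1))) hk2.
rewrite hk1 add0n in f1.
have f2 : runsto I (Loop k.+1 (Seq (Inc i) (Inc k.+2))) (upd r k.+1 (r a), o)
    (upd (upd r i (r a)) k.+2 (r a), o) ((2 + 2) * upd r k.+1 (r a) k.+1 + 1).
  have ek : upd r k.+1 (r a) k.+1 = r a by rewrite updE eqxx.
  apply: (runsto_Loop_at (S := fun j => upd (upd (upd r i j) k.+2 j) k.+1 (r a)) (T := 2)
    (leqW k3)); rewrite ?ek.
  - move=> j ja.
    have := runsto_seq (runsto_Inc I i (upd (upd (upd (upd r i j) k.+2 j) k.+1 (r a)) k.+1 (r a - j.+1)) o)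
      (runsto_Inc I k.+2 _ o).
    by congr runsto; congr pair; updt.
  - by updt.
  - by updt.
pose r3 := upd (upd r i (r a)) k.+2 (r a).
have f3 : runsto I (CInc i is_one k) (r3, o) (upd r3 k (nth false w (r a)), o) 1.
  exists 1 => //.
  have := @ExecCInc I.1.1 I.1.2 I.2 i is_one k r3 o.
  have -> : sym I.1.1 I.1.2 I.2 r3 i = onth w (r a).
    by rewrite /sym /r3 /upd; repeat (case: eqP => ?); subst; try lia.
  (* Past the end of the word the cell is blank and reads as [false], in agreement with the default
     of [nth]. *)
  have -> : is_one (onth w (r a)) = nth false w (r a).
    rewrite /is_one; have [lt|ge] := ltnP (r a) (size w).
      by rewrite onthE (nth_map false) //; case: (nth _ _ _).
    by rewrite onth_default // nth_default.
  congr exec; congr pair; case: (nth false w (r a)); rewrite /r3; updt.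
have f4 : runsto I (Loop k.+2 (Dec i)) (upd r3 k (nth false w (r a)), o)
    (upd r k (nth false w (r a)), o)
    ((1 + 2) * (upd r3 k (nth false w (r a)) k.+2) + 1).
  have ek : upd r3 k (nth false w (r a)) k.+2 = r a.
    by rewrite /r3 /upd; repeat (case: eqP => ?); subst; lia.
  set b : nat := nth false w (r a) in ek *.
  apply: (runsto_Loop_at (S := fun j => upd (upd (upd r i (r a - j)) k b) k.+2 (r a)) (T := 1)
    (leqW (leqW k3))); rewrite ?ek.
  - move=> j ja; exists 1 => //.
    have := @ExecDec I.1.1 I.1.2 I.2 i
      (upd (upd (upd (upd r i (r a - j)) k b) k.+2 (r a)) k.+2 (r a - j.+1)) o.
    have -> : upd (upd (upd (upd r i (r a - j)) k b) k.+2 (r a)) k.+2 (r a - j.+1) i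
       = r a - j.
      by rewrite /upd; repeat (case: eqP => ?); subst; lia.
    rewrite subn_gt0 => /(_ ja).
    by congr exec; congr pair; updt.
  - by rewrite /r3; updt.
  - by updt.
apply: runsto_le (runsto_seq f1 (runsto_seq f2 (runsto_seq f3 f4))).
have -> : upd r k.+1 (r a) k.+1 = r a by rewrite updE eqxx.
have -> : upd r3 k (nth false w (r a)) k.+2 = r a.
  by rewrite /r3 /upd; repeat (case: eqP => ?); subst; lia.
lia.
Qed.

Theorem computable_machine (F : input -> seq nat -> nat) : computable 1 F ->
  exists (M : turing_machine) (c : nat), forall x u m s,
    (2 + size x + size u + 2 * m) ^ c <= s ->
    tm_outputs M [:: x; u; nseq m true] s
      (mkseq (fun i => 0 < F (x, u, m) [:: i]) m).
Proof.
move=> [c HF].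
have [p Hp] := HF [:: 4] 5 erefl isT isT.
have [cm Hm] := @computable_size 0 2 isT.
have [q Hq] := Hm [::] 3 erefl isT isT.
(* Register 3 holds the number of bits left to print, 4 the index of the current bit, 5 its value. A
   positive counter sees a blank, so [Out 5 blank] prints whether the value is nonzero. *)
pose body := Seq p (Seq (Out 5 blank) (Seq (Clear 5) (Inc 4))).
pose prg := Seq q (Loop 3 body).
pose T := tapes_of prg + 3.
exists (machine (compile T prg)), (7 * (cm + c + 1)) => x u m s hs.
pose I : input := (x, u, m).
pose S := 2 + size x + size u + 2 * m.
have [] := Hq I (fun=> 0) erefl erefl erefl (fun _ _ => erefl).
rewrite /= size_nseq => _ /(_ [::]) f1.
pose St j := upd (fun=> 0) 4 j.
pose O j := mkseq (fun i => 0 < F I [:: i]) j.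
pose B := S ^ (cm + c + 1).
have S2 : 2 <= S by rewrite /S; lia.
have f2 j : j < m -> runsto I body (upd (St j) 3 (m - j.+1), O j)
    (upd (St j.+1) 3 (m - j.+1), O j.+1) (7 * B).
  move=> jm; set ra := upd (St j) 3 (m - j.+1).
  have ra5 i : 5 <= i -> ra i = 0.
    by move=> i5; rewrite /ra /St /upd !gtn_eqF //; lia.
  have [] := Hp I ra erefl erefl erefl ra5.
  have -> : map ra [:: 4] = [:: j] by [].
  set b := F I [:: j] => leb g1.
  have leS : sz I [:: j] <= S by rewrite /sz /S /=; lia.
  have leB : sz I [:: j] ^ c <= B.
    apply: leq_trans (expn_mono c leS) _; apply: expn_le => //; lia.
  have g2 : runsto I (Out 5 blank) (upd ra 5 b, O j) (upd ra 5 b, O j.+1) 1.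
    exists 1 => //; have := @ExecOut x u m 5 blank (upd ra 5 b) (O j).
    by rewrite blank_counter // updE eqxx /O mkseqS.
  have g3 := runsto_Clear I (upd ra 5 b) (O j.+1) (isT : 2 < 5).
  have g4 := runsto_Inc I 4 (upd (upd ra 5 b) 5 0) (O j.+1).
  have e : upd (upd (upd ra 5 b) 5 0) 4 (upd (upd ra 5 b) 5 0 4).+1 =
      upd (St j.+1) 3 (m - j.+1).
    rewrite /ra /St; updt.
  rewrite e in g4.
  apply: runsto_le (runsto_seq (g1 _) (runsto_seq g2 (runsto_seq g3 g4))).
  have -> : upd ra 5 b 5 = b by [].
  have B1 : 1 <= B by rewrite expn_gt0; lia.
  lia.
have f3 := runsto_Loop (isT : 2 < 3) f2.
have e0 : upd (fun=> 0) 3 m = upd (St 0) 3 m by rewrite /St; updt.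
rewrite e0 in f1.
have [t tT et] := runsto_seq f1 f3.
apply: (machine_outputs _ _ et).
- by rewrite /T; lia.
- by apply: uses_le (uses_tapes_of prg); rewrite /T; lia.
apply: leq_ltn_trans tT _; apply: leq_trans hs.
rewrite -/S (mulnC 7 (_ + _)) expnM -/B.
have leB : sz I [::] ^ cm <= B.
  have leS : sz I [::] <= S by rewrite /sz /S /=; lia.
  apply: leq_trans (expn_mono cm leS) _; apply: expn_le => //; lia.
have B2 : 2 <= B.
  by apply: leq_trans S2 _; rewrite -{1}(expn1 S); apply: expn_le => //; lia.
have mB : m <= B.
  apply: (@leq_trans S); first by rewrite /S; lia.
  by rewrite -{1}(expn1 S); apply: expn_le => //; lia.
have h1 : (7 * B + 2) * m <= (8 * B) * B by apply: leq_mul => //; lia.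
have h2 : B <= B * B by rewrite leq_pmulr //; lia.
have h3 : 32 * (B * B) <= B ^ 7.
  have -> : B ^ 7 = B ^ 5 * (B * B) by rewrite !expnS; lia.
  by rewrite leq_mul2r (leq_trans (_ : _ <= 2 ^ 5)) ?orbT // expn_mono.
have h4 : 1 <= B * B by rewrite muln_gt0; lia.
apply: leq_trans h3; rewrite -mulnA in h1.
move: h1 h2 h4 leB.
by move: (sz _ _ ^ cm) (B * B) ((7 * B + 2) * m) => *; lia.
Qed.

End CounterPrograms.

(** * The extractor *)

Section Extractor.
Local Open Scope nat_scope.

(** A search with exactly [B] rounds, which stalls at the first prime met: as a bounded iteration it
    falls under [computable_iter]. *)
Definition next_prime (B p : nat) : nat :=
  iteri B (fun _ q => if prime q then q else q.+1) p.+1.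

(* the [t]-th prime above [Q], provided that the gaps are shorter than [B] *)
Definition modulus (Q B t : nat) : nat :=
  iteri t.+1 (fun _ p => next_prime B p) Q.

(* the seed position holding the [t]-th bit which is read for output bit [i] *)
Definition slot (Q B i t : nat) : nat :=
  modulus Q B t * modulus Q B t + i %% modulus Q B t.

Definition address (l : nat) (w : nat -> bool) : nat :=
  iteri l (fun b acc => acc * 2 + w b) 0.

Definition sampled_xor (s l : nat) (x : seq bool) (w : nat -> nat -> bool) : bool :=
  iteri s (fun j acc => acc (+) nth false x (address l (w j))) false.

(** With [s = l ^ A], moduli above [s ^ 2] make the overlaps cheap, and searches of length [s ^ 4]
    always succeed for large [s], by [prime_pi_pow4]. *)
Definition ext_bit (A l : nat) (x u : seq bool) (i : nat) : bool :=
  sampled_xor (l ^ A) l x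
    (fun j b => nth false u (slot ((l ^ A) ^ 2) ((l ^ A) ^ 4) i (j * l + b))).

End Extractor.

(** * Explicitness *)

Section Explicit.
Local Open Scope nat_scope.

Lemma computable_weaken v w F : computable v F ->
  computable (w + v) (fun I env => F I (drop w env)).
Proof.
move=> cF.
have := @computable_reindex v (w + v) F (iota w v) cF (size_iota _ _).
have h : all (fun i => i < w + v) (iota w v).
  by apply/allP => i; rewrite mem_iota => /andP[].
move=> /(_ h); apply: computable_ext => I env se; congr (F I).
apply: (@eq_from_nth _ 0) => [|i].
  by rewrite size_map size_iota size_drop se addKn.
rewrite size_map size_iota => iv.
by rewrite (nth_map 0) ?size_iota // nth_iota // nth_drop.
Qed.

Lemma computable_comp1 v f G :
  computable 1 (fun I e => f I (nth 0 e 0)) -> computable v G ->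
  computable v (fun I e => f I (G I e)).
Proof.
move=> cf cG; apply: (computable_let (F := fun I e => f I (nth 0 e 0)) cG).
exact: (@computable_reindex 1 v.+1 _ [:: 0] cf).
Qed.

Lemma computable_comp2 v f G1 G2 :
  computable 2 (fun I e => f I (nth 0 e 0) (nth 0 e 1)) ->
  computable v G1 -> computable v G2 ->
  computable v (fun I e => f I (G1 I e) (G2 I e)).
Proof.
move=> cf c1 c2.
have := computable_let c2 (computable_let (computable_weaken 1 c1)
  (@computable_reindex 2 v.+2 _ [:: 0; 1] cf erefl isT)).
by apply: computable_ext => I e _ /=; rewrite drop0.
Qed.

Lemma computable_comp3 v f G1 G2 G3 :
  computable 3 (fun I e => f I (nth 0 e 0) (nth 0 e 1) (nth 0 e 2)) ->
  computable v G1 -> computable v G2 -> computable v G3 ->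
  computable v (fun I e => f I (G1 I e) (G2 I e) (G3 I e)).
Proof.
move=> cf c1 c2 c3.
have := computable_let c3 (computable_let (computable_weaken 1 c2)
  (computable_let (computable_weaken 2 c1)
  (@computable_reindex 3 v.+3 _ [:: 0; 1; 2] cf erefl isT))).
by apply: computable_ext => I e _ /=; rewrite !drop0.
Qed.

Lemma computable_const v n : computable v (fun _ _ => n).
Proof.
by elim: n => [|n ih]; [exact: computable_zero | exact: computable_succ ih].
Qed.

Lemma computable_iter_le v N Z H c :
  computable v N -> computable v Z -> computable v.+2 H ->
  (forall I e j, size e = v -> j <= N I e ->
     iteri j (fun i acc => H I [:: acc, i & e]) (Z I e) <= sz I e ^ c) ->
  computable v (fun I e =>
    iteri (N I e) (fun i acc => H I [:: acc, i & e]) (Z I e)).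
Proof.
move=> cN cZ cH h; apply: computable_iter => //.
by exists c => I e se j jN; exact: h.
Qed.

Lemma computable_add v F G : computable v F -> computable v G ->
  computable v (fun I e => F I e + G I e).
Proof.
apply: (computable_comp2 (f := fun=> addn)).
have E j z : iteri j (fun _ acc => acc.+1) z = j + z by elim: j => //= j ->.
have := @computable_iter_le 2 (fun I e => nth 0 e 0) (fun I e => nth 0 e 1)
  (fun I e => (nth 0 e 0).+1) 2.
move=> /(_ _ _ _ _) H; apply: computable_ext (H _ _ _ _) => /=.
- by move=> I e _; rewrite E.
- exact: computable_nth.
- exact: computable_nth.
- by apply: computable_succ; exact: computable_nth.
- move=> I e j _ jN; rewrite E.
  have h0 := sz_nth I e 0; have h1 := sz_nth I e 1; have h2 := sz_ge2 I e.
  by rewrite expnS expn1; nia.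
Qed.

Lemma computable_mul v F G : computable v F -> computable v G ->
  computable v (fun I e => F I e * G I e).
Proof.
apply: (computable_comp2 (f := fun=> muln)).
have E j z : iteri j (fun _ acc => acc + z) 0 = j * z.
  by elim: j => //= j ->; rewrite mulSn addnC.
have := @computable_iter_le 2 (fun I e => nth 0 e 0) (fun I e => 0)
  (fun I e => nth 0 e 0 + nth 0 e 3) 2.
move=> /(_ _ _ _ _) H; apply: computable_ext (H _ _ _ _) => /=.
- by move=> I e _; rewrite E.
- exact: computable_nth.
- exact: computable_zero.
- by apply: computable_add; exact: computable_nth.
- move=> I e j _ jN; rewrite E.
  have h0 := sz_nth I e 0; have h1 := sz_nth I e 1.
  by rewrite expnS expn1 leq_mul // (leq_trans jN).
Qed.

(** The predecessor is the index of the last round of a loop that forgets its accumulator. *)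
Lemma computable_pred v F : computable v F -> computable v (fun I e => (F I e).-1).
Proof.
apply: (computable_comp1 (f := fun=> predn)).
have := @computable_iter_le 1 (fun I e => nth 0 e 0) (fun I e => 0)
  (fun I e => nth 0 e 1) 1.
move=> /(_ _ _ _ _) H; apply: computable_ext (H _ _ _ _) => /=.
- by move=> I e _; case: (nth 0 e 0).
- exact: computable_nth.
- exact: computable_zero.
- exact: computable_nth.
- move=> I e j _ jN; have h0 := sz_nth I e 0.
  by case: j jN => //= j jN; lia.
Qed.

Lemma computable_sub v F G : computable v F -> computable v G ->
  computable v (fun I e => F I e - G I e).
Proof.
apply: (computable_comp2 (f := fun=> subn)).
have E j z : iteri j (fun _ acc => acc.-1) z = z - j.
  by elim: j => [|j /= ->]; rewrite ?subn0 // subnS.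
have := @computable_iter_le 2 (fun I e => nth 0 e 1) (fun I e => nth 0 e 0)
  (fun I e => (nth 0 e 0).-1) 1.
move=> /(_ _ _ _ _) H; apply: computable_ext (H _ _ _ _) => /=.
- by move=> I e _; rewrite E.
- exact: computable_nth.
- exact: computable_nth.
- by apply: computable_pred; exact: computable_nth.
- by move=> I e j _ jN; rewrite E; have h0 := sz_nth I e 0; lia.
Qed.

(** A loop whose body always returns the positive branch changes its initial value exactly when it
    runs at least once. *)
Lemma computable_if v F G H : computable v F -> computable v G -> computable v H ->
  computable v (fun I e => if 0 < F I e then G I e else H I e).
Proof.
apply: (computable_comp3 (f := fun _ a b c => if 0 < a then b else c)).
have := @computable_iter_le 3 (fun I e => nth 0 e 0) (fun I e => nth 0 e 2)
  (fun I e => nth 0 e 3) 1.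
move=> /(_ _ _ _ _) K; apply: computable_ext (K _ _ _ _) => /=.
- by move=> I e _; case: (nth 0 e 0).
- exact: computable_nth.
- exact: computable_nth.
- exact: computable_nth.
- move=> I e j _ _; have h1 := sz_nth I e 1; have h2 := sz_nth I e 2.
  by case: j => //= [|j]; lia.
Qed.

Lemma computable_leq v F G : computable v F -> computable v G ->
  computable v (fun I e => nat_of_bool (F I e <= G I e)).
Proof.
move=> cF cG.
have := computable_if (computable_sub cF cG) (computable_zero v) (computable_const v 1).
by apply: computable_ext => I e _; rewrite subn_gt0; case: leqP.
Qed.

Lemma computable_eq v F G : computable v F -> computable v G ->
  computable v (fun I e => nat_of_bool (F I e == G I e)).
Proof.
move=> cF cG.
have := computable_mul (computable_leq cF cG) (computable_leq cG cF).
by apply: computable_ext => I e _; rewrite eqn_leq mulnb.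
Qed.

Lemma computable_ifb v (b : input -> seq nat -> bool) G H :
  computable v (fun I e => nat_of_bool (b I e)) -> computable v G -> computable v H ->
  computable v (fun I e => if b I e then G I e else H I e).
Proof.
move=> cb cG cH; apply: computable_ext (computable_if cb cG cH) => I e _.
by rewrite lt0b.
Qed.

Lemma computable_mod v F G : computable v F -> computable v G ->
  computable v (fun I e => F I e %% G I e).
Proof.
apply: (computable_comp2 (f := fun=> modn)).
have E j p : iteri j (fun _ acc => if acc.+1 == p then 0 else acc.+1) 0 = j %% p.
  elim: j => [|j /= ->]; first by rewrite mod0n.
  rewrite modnS /dvdn -[j.+1]addn1 -modnDml addn1.
  case: p => [|p]; first by rewrite !modn0.
  have := ltn_pmod j (isT : 0 < p.+1).
  rewrite leq_eqVlt => /orP[/eqP [->]|lt]; first by rewrite eqxx modnn.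
  by rewrite (modn_small lt) ltn_eqF.
have := @computable_iter_le 2 (fun I e => nth 0 e 0) (fun I e => 0)
  (fun I e => if (nth 0 e 0).+1 == nth 0 e 3 then 0 else (nth 0 e 0).+1) 1.
move=> /(_ _ _ _ _) H; apply: computable_ext (H _ _ _ _) => /=.
- by move=> I e _; rewrite E.
- exact: computable_nth.
- exact: computable_zero.
- apply: (computable_ifb (b := fun I e => (nth 0 e 0).+1 == nth 0 e 3)).
  + by apply: computable_eq; [apply: computable_succ|]; exact: computable_nth.
  + exact: computable_zero.
  + by apply: computable_succ; exact: computable_nth.
- move=> I e j _ jN; rewrite E; have h0 := sz_nth I e 0.
  by rewrite expn1 (leq_trans (leq_mod _ _)) // (leq_trans jN).
Qed.


(** Trial division: the iteration counts the divisors among 2, ..., p - 1. *)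
Lemma primeE p : prime p =
  ((1 < p) && (iteri p.-2 (fun j acc => acc + (p %% j.+2 == 0)) 0 == 0)).
Proof.
have [p1|] := ltnP 1 p; last by case: p => [|[|]].
have h n : (iteri n (fun j acc => acc + (p %% j.+2 == 0)) 0 == 0) =
    [forall j : 'I_n, ~~ (j.+2 %| p)].
  elim: n => [|n /= ih]; first by rewrite eqxx; apply/esym/forallP => -[].
  rewrite addn_eq0 ih eqb0; apply/andP/forallP => [[/forallP h1 h2] j|h1].
    have [jn|jn|jn] := ltngtP j n; first exact: (h1 (Ordinal jn)).
      by have := ltn_ord j; lia.
    by rewrite jn.
  split; last exact: (h1 ord_max).
  by apply/forallP => j; exact: (h1 (widen_ord (leqnSn n) j)).
rewrite h; apply/idP/forallP => [pp j|h1].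
  apply/negP => d; have := dvdn_leq (ltnW p1) d.
  have := ltn_ord j; have /primeP[_ /(_ _ d)] := pp.
  by case/orP => /eqP; lia.
apply/primeP; split=> // d dp.
have d0 : 0 < d by apply: dvdn_gt0 dp; exact: ltnW.
have dle : d <= p := dvdn_leq (ltnW p1) dp.
have [//|d1] := eqVneq d 1; have [//|dp'] := eqVneq d p.
have dlt : d.-2 < p.-2 by lia.
by have := h1 (Ordinal dlt); rewrite /= (_ : d.-2.+2 = d) ?dp //; lia.
Qed.

Lemma computable_prime v F : computable v F ->
  computable v (fun I e => nat_of_bool (prime (F I e))).
Proof.
apply: (computable_comp1 (f := fun=> prime)).
pose G (I : input) (e : seq nat) := iteri (nth 0 e 0).-2
  (fun j acc => acc + (nth 0 e 0 %% j.+2 == 0)) 0.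
have E p j : iteri j (fun j acc => acc + (p %% j.+2 == 0)) 0 <= j.
  by elim: j => //= j ih; have := leq_b1 (p %% j.+2 == 0); lia.
suff cG : computable 1 G.
  have := computable_mul (computable_leq (computable_const 1 2) (computable_nth (isT : 0 < 1)))
    (computable_eq cG (computable_zero 1)).
  by apply: computable_ext => I e _; rewrite primeE mulnb.
have := @computable_iter_le 1 (fun I e => (nth 0 e 0).-2) (fun I e => 0)
  (fun I e => nth 0 e 0 + (nth 0 e 2 %% (nth 0 e 1).+2 == 0)) 1.
move=> /(_ _ _ _ _) H; apply: computable_ext (H _ _ _ _) => //=.
- by do 2 apply: computable_pred; exact: computable_nth.
- exact: computable_zero.
- apply: computable_add; first exact: computable_nth.
  apply: computable_eq; last exact: computable_zero.
  by apply: computable_mod; first exact: computable_nth;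
     do 2 apply: computable_succ; exact: computable_nth.
- move=> I e j _ jN; have h0 := sz_nth I e 0; have := E (nth 0 e 0) j.
  by rewrite expn1; lia.
Qed.

Lemma next_prime_le B p : next_prime B p <= p.+1 + B.
Proof.
rewrite /next_prime; elim: B => [|B ih] /=; first by rewrite addn0.
by case: ifP => _; lia.
Qed.

Lemma computable_next_prime v F G : computable v F -> computable v G ->
  computable v (fun I e => next_prime (F I e) (G I e)).
Proof.
apply: (computable_comp2 (f := fun=> next_prime)).
have := @computable_iter_le 2 (fun I e => nth 0 e 0) (fun I e => (nth 0 e 1).+1)
  (fun I e => if prime (nth 0 e 0) then nth 0 e 0 else (nth 0 e 0).+1) 2.
move=> /(_ _ _ _ _) H; apply: computable_ext (H _ _ _ _) => //=.
- exact: computable_nth.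
- by apply: computable_succ; exact: computable_nth.
- apply: (computable_ifb (b := fun I e => prime (nth 0 e 0))).
  + by apply: computable_prime; exact: computable_nth.
  + exact: computable_nth.
  + by apply: computable_succ; exact: computable_nth.
- move=> I e j _ jN; have := next_prime_le j (nth 0 e 1).
  rewrite /next_prime expnS expn1 => /leq_trans; apply.
  have : sumn e >= nth 0 e 0 + nth 0 e 1 by case: (e) => [|? [|? ?]] //=; lia.
  by rewrite /sz; nia.
Qed.

Lemma modulus_le Q B t : modulus Q B t <= Q + t.+1 * B.+1.
Proof.
rewrite /modulus; elim: t.+1 => [|n ih] /=; first by rewrite addn0.
by have := next_prime_le B (iteri n (fun=> [eta next_prime B]) Q); rewrite mulSn; lia.
Qed.

Lemma computable_modulus v F G H : computable v F -> computable v G -> computable v H ->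
  computable v (fun I e => modulus (F I e) (G I e) (H I e)).
Proof.
apply: (computable_comp3 (f := fun=> modulus)).
have := @computable_iter_le 3 (fun I e => (nth 0 e 2).+1) (fun I e => nth 0 e 0)
  (fun I e => next_prime (nth 0 e 3) (nth 0 e 0)) 6.
move=> /(_ _ _ _ _) K; apply: computable_ext (K _ _ _ _) => //=.
- by apply: computable_succ; exact: computable_nth.
- exact: computable_nth.
- by apply: computable_next_prime; exact: computable_nth.
- move=> I e j _; case: j => [|j] jN /=.
    by apply: leq_trans (sz_nth I e 0) _; rewrite -{1}(expn1 (sz _ _)) expn_le // sz_ge2.
  have := modulus_le (nth 0 e 0) (nth 0 e 1) j; rewrite /modulus /= => /leq_trans; apply.
  have h0 := sz_nth I e 0; have h1 := sz_nth I e 1; have h2 := sz_nth I e 2.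
  have S2 := sz_ge2 I e.
  apply: (@leq_trans (sz I e + (2 * sz I e) * (2 * sz I e))).
    by apply: leq_add => //; apply: leq_mul; lia.
  apply: (@leq_trans (2 ^ 4 * (sz I e) ^ 2)); first by rewrite -(mulnn (sz I e)); nia.
  by rewrite (expnD _ 4 2) leq_mul2r expn_mono ?orbT.
Qed.

Lemma computable_slot v F G H K :
  computable v F -> computable v G -> computable v H -> computable v K ->
  computable v (fun I e => slot (F I e) (G I e) (H I e) (K I e)).
Proof.
move=> cF cG cH cK; have cM := computable_modulus cF cG cK.
by apply: computable_add; [apply: computable_mul | apply: computable_mod].
Qed.

Lemma computable_letter v i F : i < 3 -> computable v F ->
  computable v (fun I e => nat_of_bool (nth false (tape_word I.1.1 I.1.2 I.2 i) (F I e))).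
Proof.
move=> i3; apply: (computable_comp1
  (f := fun I j => nat_of_bool (nth false (tape_word I.1.1 I.1.2 I.2 i) j))).
exact: computable_read.
Qed.

(* Capping the address at the length of the word keeps all values polynomial. *)
Lemma capped_addressE n l (w : nat -> bool) :
  iteri l (fun b acc => acc * 2 + w b - (acc * 2 + w b - n)) 0 = minn (address l w) n.
Proof.
rewrite /address; elim: l => [|l /= ->]; first by rewrite min0n.
by set a := iteri l _ 0; move: (nat_of_bool (w l)) => b; lia.
Qed.

Lemma nth_capped (x : seq bool) a : nth false x (minn a (size x)) = nth false x a.
Proof.
by case: leqP => // h; rewrite !nth_default // ltnW.
Qed.

(* the arguments are [l; Q; B; i; j] *)
Lemma computable_sample : computable 5 (fun I e => nat_of_bool (nth false I.1.1
  (address (nth 0 e 0) (fun b => nth false I.1.2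
     (slot (nth 0 e 1) (nth 0 e 2) (nth 0 e 3) (nth 0 e 4 * nth 0 e 0 + b)))))).
Proof.
have cs : computable 7 (fun I e => nth 0 e 0 * 2 + nth false I.1.2
     (slot (nth 0 e 3) (nth 0 e 4) (nth 0 e 5) (nth 0 e 6 * nth 0 e 2 + nth 0 e 1))).
  apply: computable_add.
    by apply: computable_mul; [exact: computable_nth | exact: computable_const].
  apply: (@computable_letter 7 1) => //.
  apply: computable_slot; try exact: computable_nth.
  by apply: computable_add; [apply: computable_mul|]; exact: computable_nth.
have cH := computable_sub cs (computable_sub cs (computable_size 7 (isT : 0 < 3))).
have := computable_iter_le (c := 1) (computable_nth (isT : 0 < 5)) (computable_zero 5) cH.
move=> /(_ _) c1; have {c1} := @computable_letter 5 0 _ isT (c1 _).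
move=> H; apply: computable_ext (H _) => [I e _|I e j _ _] /=.
  by rewrite capped_addressE nth_capped.
rewrite capped_addressE expn1 /sz; lia.
Qed.

(* the arguments are [s; l; Q; B; i] *)
Lemma computable_sampled_xor : computable 5 (fun I e => nat_of_bool
  (sampled_xor (nth 0 e 0) (nth 0 e 1) I.1.1 (fun j b => nth false I.1.2
     (slot (nth 0 e 2) (nth 0 e 3) (nth 0 e 4) (j * nth 0 e 1 + b))))).
Proof.
have c1 := @computable_reindex 5 7 _ [:: 3; 4; 5; 6; 1] computable_sample erefl isT.
have cH := computable_mod (computable_add (computable_nth (isT : 0 < 7)) c1)
  (computable_const 7 2).
have H := computable_iter_le (c := 1) (computable_nth (isT : 0 < 5))
  (computable_zero 5) cH.
have E I e s : iteri s (fun j acc => (acc + nth false I.1.1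
    (address (nth 0 e 1) (fun b => nth false I.1.2
     (slot (nth 0 e 2) (nth 0 e 3) (nth 0 e 4) (j * nth 0 e 1 + b))))) %% 2) 0 =
  sampled_xor s (nth 0 e 1) I.1.1 (fun j b => nth false I.1.2
     (slot (nth 0 e 2) (nth 0 e 3) (nth 0 e 4) (j * nth 0 e 1 + b))).
  rewrite /sampled_xor; elim: s => //= s ->.
  by case: (iteri s _ _); case: (nth _ _ _).
apply: computable_ext (H _) => [I e _|I e j _ _] /=; rewrite E //.
have := leq_b1 (sampled_xor j (nth 0 e 1) I.1.1 (fun j b => nth false I.1.2
     (slot (nth 0 e 2) (nth 0 e 3) (nth 0 e 4) (j * nth 0 e 1 + b)))).
by have := sz_ge2 I e; rewrite expn1; lia.
Qed.

Lemma computable_expn v F c : computable v F -> computable v (fun I e => F I e ^ c).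
Proof.
move=> cF; elim: c => [|c ih]; first exact: computable_const.
by apply: computable_ext (computable_mul cF ih) => I e _; rewrite expnS.
Qed.

(** Counts the [j] from 1 to [d] whose [c]-th power is at most [d], which yields the integer root by
    a plain iteration. *)
Definition root_floor (c d : nat) : nat :=
  iteri d (fun j acc => acc + (j.+1 ^ c <= d)) 0.

Lemma root_floorX c l : 0 < c -> root_floor c (l ^ c) = l.
Proof.
move=> c0; rewrite /root_floor.
have E j : iteri j (fun j acc => acc + (j.+1 ^ c <= l ^ c)) 0 = minn j l.
  elim: j => [|j /= ->]; first by rewrite min0n.
  by rewrite leq_exp2r //; case: leqP; lia.
rewrite E; apply/minn_idPr; case: l {E} => // l.
by rewrite -{1}(expn1 l.+1) leq_pexp2l.
Qed.

Lemma computable_root_floor v c F : computable v F ->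
  computable v (fun I e => root_floor c (F I e)).
Proof.
apply: (computable_comp1 (f := fun=> root_floor c)).
have := @computable_iter_le 1 (fun I e => nth 0 e 0) (fun I e => 0)
  (fun I e => nth 0 e 0 + ((nth 0 e 1).+1 ^ c <= nth 0 e 2)) 1.
move=> /(_ _ _ _ _) H; apply: computable_ext (H _ _ _ _) => //=.
- exact: computable_nth.
- exact: computable_zero.
- apply: computable_add; first exact: computable_nth.
  apply: computable_leq; last exact: computable_nth.
  by apply: computable_expn; apply: computable_succ; exact: computable_nth.
- move=> I e j _ jN; have h0 := sz_nth I e 0.
  suff : iteri j (fun i acc => acc + (i.+1 ^ c <= nth 0 e 0)) 0 <= j by rewrite expn1; lia.
  elim: j {jN} => //= j ih; have := leq_b1 (j.+1 ^ c <= nth 0 e 0); lia.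
Qed.

Theorem ext_bit_machine A E : 0 < E ->
  exists (M : turing_machine) (c : nat), forall x u l m s, size u = l ^ E ->
    (2 + size x + size u + 2 * m) ^ c <= s ->
    tm_outputs M [:: x; u; nseq m true] s (mkseq (ext_bit A l x u) m).
Proof.
move=> E0.
have cl : computable 1 (fun I e => root_floor E (size I.1.2)).
  exact: computable_root_floor (@computable_size 1 1 isT).
have cs := computable_expn A cl.
(* The nested lets push [i], [B = s ^ 4], [Q = s ^ 2], [l] and [s] in this order, so that the
   environment begins with [[s; l; Q; B; i]]. *)
have cF := computable_let (computable_nth (isT : 0 < 1))
 (computable_let (computable_weaken 1 (computable_expn 4 cs))
 (computable_let (computable_weaken 2 (computable_expn 2 cs))
 (computable_let (computable_weaken 3 cl)
 (computable_let (computable_weaken 4 cs)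
 (@computable_reindex 5 6 _ [:: 0; 1; 2; 3; 4] computable_sampled_xor erefl isT))))).
have [M [c hM]] := computable_machine cF.
exists M, c => x u l m s su hs.
have := hM x u m s hs; congr tm_outputs.
apply: (@eq_mkseq bool) => i /=.
by rewrite su root_floorX // lt0b.
Qed.

End Explicit.

(** * Primes in polynomial range *)

Section Primes.
Local Open Scope nat_scope.

Lemma central_bin_ge N : 2 ^ N <= 'C(N.*2, N).
Proof.
elim: N => [|N ih]; first by rewrite bin0.
have e : 'C(N.*2.+1, N.+1) = 'C(N.*2.+1, N).
  by rewrite -bin_sub; [congr 'C(_, _); lia | lia].
rewrite doubleS binS e addnn -mul2n expnS leq_mul2l /=.
by apply: leq_trans ih _; rewrite -e binS leq_addl.
Qed.

(** By Legendre's formula the exponent is the sum over [k] of floor(2N / p^k) - 2 floor(N / p^k).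
    Each term is 0 or 1, and vanishes once p^k > 2N. *)
Lemma central_bin_prime_power p N : prime p -> 0 < N ->
  p ^ logn p 'C(N.*2, N) <= N.*2.
Proof.
move=> pp N0; have p1 := prime_gt1 pp.
pose M := N.*2.
have M0 : 0 < M by rewrite double_gt0.
suff h : logn p 'C(M, N) <= trunc_log p M.
  by apply: leq_trans (trunc_logP p1 M0); rewrite leq_exp2l.
have NM : N <= M by rewrite /M; lia.
have e : logn p 'C(M, N) + (\sum_(1 <= k < M.+1) N %/ p ^ k).*2 =
    \sum_(1 <= k < M.+1) M %/ p ^ k.
  rewrite -logn_fact // -(bin_fact NM) (_ : M - N = N); last by rewrite /M; lia.
  rewrite !lognM ?muln_gt0 ?fact_gt0 ?bin_gt0 // addnn; congr (_ + _.*2).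
  rewrite logn_fact // (@big_cat_nat _ _ _ N.+1) //=.
  rewrite [X in _ + X]big_nat_cond [X in _ + X]big1 ?addn0 // => k /andP[/andP[Nk _] _].
  by rewrite divn_small // (leq_trans Nk) // ltnW // ltn_expl.
have term q : 0 < q -> M %/ q <= (N %/ q).*2 + (q <= M).
  move=> q0; have [qM|qM] := leqP q M; last by rewrite divn_small.
  rewrite addn1 -ltnS ltn_divLR //; have := ltn_ceil N q0.
  by rewrite /M -!muln2; nia.
have le : logn p 'C(M, N) <= \sum_(1 <= k < M.+1) (p ^ k <= M).
  rewrite -(leq_add2r (\sum_(1 <= k < M.+1) N %/ p ^ k).*2) e -mul2n big_distrr /=.
  rewrite -big_split /= leq_sum // => k _.
  by rewrite mul2n addnC term // expn_gt0 prime_gt0.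
apply: leq_trans le _.
apply: (@leq_trans (\sum_(1 <= k < M.+1) (k <= trunc_log p M))).
  apply: leq_sum => k _; have [h|//] := leqP (p ^ k) M.
  by rewrite trunc_log_max.
have -> : forall n T, \sum_(1 <= k < n.+1) (k <= T) = minn n T.
  move=> n T; elim: n => [|n ih]; first by rewrite big_geq // min0n.
  by rewrite big_nat_recr //= ih; case: leqP; lia.
exact: geq_minr.
Qed.

Definition prime_pi (n : nat) : nat := \sum_(i < n.+1) prime i.

Lemma prime_piS n : prime_pi n.+1 = prime_pi n + prime n.+1.
Proof. by rewrite /prime_pi big_ord_recr. Qed.

Lemma prime_pi_le n : prime_pi n <= n.
Proof.
elim: n => [|n ih]; first by rewrite /prime_pi big_ord1.
by rewrite prime_piS; have := leq_b1 (prime n.+1); lia.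
Qed.

Lemma leq_prime_pi m n : m <= n -> prime_pi m <= prime_pi n.
Proof.
move=> /subnK <-; elim: (n - m) => // k ih.
by rewrite addSn prime_piS (leq_trans ih) // leq_addr.
Qed.

Lemma prime_pi_gap m n : m <= n -> (forall q, m < q <= n -> ~~ prime q) ->
  prime_pi n = prime_pi m.
Proof.
move=> /subnK <-; elim: (n - m) => // k ih h.
rewrite addSn prime_piS ih => [|q hq]; last by apply: h; lia.
by rewrite (negbTE (h _ _)) ?addn0 //; lia.
Qed.

(** Chebyshev's bound: the central binomial coefficient is a product of at most [prime_pi N.*2]
    prime powers, each at most 2N. *)
Lemma prime_pi_ge N : 0 < N -> 2 ^ N <= N.*2 ^ prime_pi N.*2.
Proof.
move=> N0; apply: leq_trans (central_bin_ge N) _.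
have C0 : 0 < 'C(N.*2, N) by rewrite bin_gt0; lia.
have pr p : p \in primes 'C(N.*2, N) -> prime p && (p <= N.*2).
  rewrite mem_primes => /and3P[pp _ dv]; rewrite pp /=.
  apply: leq_trans (central_bin_prime_power pp N0).
  by rewrite -{1}(expn1 p) leq_exp2l ?prime_gt1 // logn_gt0 mem_primes pp C0.
rewrite {1}(prod_prime_decomp C0) prime_decompE big_map /=.
apply: (@leq_trans (\prod_(p <- primes 'C(N.*2, N)) N.*2)).
  rewrite !big_seq; apply: leq_prod => p /pr /andP[pp _].
  exact: central_bin_prime_power.
rewrite big_const_seq count_predT -Monoid.iteropE /= -/(expn _ _).
rewrite leq_pexp2l ?double_gt0 //.
have -> : prime_pi N.*2 = size [seq p <- iota 0 N.*2.+1 | prime p].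
  rewrite size_filter -sum1_count big_mkcond /prime_pi.
  rewrite -(big_mkord xpredT (fun i => nat_of_bool (prime i))) /index_iota subn0.
  by apply: eq_bigr => i _; case: prime.
apply: uniq_leq_size; first exact: primes_uniq.
by move=> p /pr /andP[pp pN]; rewrite mem_filter pp mem_iota.
Qed.

(** Otherwise Chebyshev's bound together with s < 2^s would bound 2^(s^4 / 2), up to rounding, by
    2^(8 s^3 + 8 s). The threshold 18 gives s^4 / 2 >= 9 s^3, which exceeds that exponent. *)
Lemma prime_pi_pow4 s : 18 <= s -> 2 * s ^ 2 + 2 < prime_pi (s ^ 4).
Proof.
move=> s18; rewrite ltnNge; apply/negP => h.
pose N := (s ^ 4)./2.
have N2 : N.*2 <= s ^ 4 <= N.*2.+1.
  by have := odd_double_half (s ^ 4); rewrite -/N; case: (odd _); lia.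
have s3 : 18 * s ^ 3 <= s ^ 4 by rewrite [s ^ 4]expnS leq_mul.
have s1 : 18 * 18 * s <= s ^ 3 by rewrite 2!expnSr leq_mul // leq_mul.
have N0 : 0 < N by lia.
have := prime_pi_ge N0; rewrite leqNgt => /negP; apply.
apply: (@leq_ltn_trans ((s ^ 4) ^ (2 * s ^ 2 + 2))).
  apply: (@leq_trans ((s ^ 4) ^ prime_pi N.*2)).
    by apply: expn_mono; lia.
  apply: expn_le; first lia.
  by apply: leq_trans h; apply: leq_prime_pi; lia.
rewrite -expnM; apply: (@leq_ltn_trans ((2 ^ s) ^ (4 * (2 * s ^ 2 + 2)))).
  by apply: expn_mono; rewrite ltnW // ltn_expl.
rewrite -expnM ltn_exp2l //.
have -> : s * (4 * (2 * s ^ 2 + 2)) = 8 * s ^ 3 + 8 * s by rewrite (expnS s 2); lia.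
lia.
Qed.

Lemma next_primeP B p (q := next_prime B p) :
  [/\ p < q, forall r, p < r < q -> ~~ prime r & prime q \/ q = p.+1 + B].
Proof.
rewrite /q /next_prime; elim: B {q} => [|B [lt gap ok]] /=.
  by split; [|lia|right; rewrite addn0].
case: ifP => pq; first by split=> //; left.
split; first exact: leqW.
- move=> r /andP[pr]; rewrite ltnS leq_eqVlt => /orP[/eqP ->|rq]; first by rewrite pq.
  by apply: gap; rewrite pr.
- by right; case: ok => [|->]; [rewrite pq | rewrite addnS].
Qed.

(** A failed search from [p] means that p + 1, ..., p + B are all composite, so p + B has as many
    primes below it as [p]. But [p] has at most Q + k of them, fewer than [B] has. *)
Lemma prime_modulus Q B t k : Q + t < prime_pi B -> k < t ->
  prime (modulus Q B k).
Proof.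
move=> hB kt.
have pi_le j : prime_pi (iteri j (fun=> next_prime B) Q) <= Q + j.
  elim: j => [|j ih] /=; first by rewrite addn0 prime_pi_le.
  set p := iteri j _ Q in ih *; have [lt gap _] := next_primeP B p.
  case: (next_prime B p) lt gap => // q pq gap.
  rewrite prime_piS (@prime_pi_gap p) //.
  by rewrite addnS; have := leq_b1 (prime q.+1); lia.
pose p := iteri k (fun=> next_prime B) Q.
have [lt gap [pq|e]] := next_primeP B p; first exact: pq.
have : prime_pi (p + B) = prime_pi p.
  apply: prime_pi_gap; first exact: leq_addr.
  by move=> r /andP[pr rq]; apply: gap; rewrite pr e addSn ltnS.
have := pi_le k; rewrite -/p => h1 h2.
by have := leq_prime_pi (leq_addl p B); lia.
Qed.

Lemma modulus_lt Q B j k : j < k -> modulus Q B j < modulus Q B k.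
Proof.
have step i : modulus Q B i < modulus Q B i.+1.
  by rewrite /modulus [in ltnRHS]/=; have [] := next_primeP B (modulus Q B i).
elim: k => // k ih; rewrite ltnS leq_eqVlt => /orP[/eqP ->//|/ih h].
exact: ltn_trans h (step k).
Qed.

Lemma modulus_gt Q B k : Q < modulus Q B k.
Proof.
have h : Q < modulus Q B 0 by have [] := next_primeP B Q.
by case: k => // k; exact: ltn_trans h (modulus_lt _ _ _).
Qed.

(** A modulus [p] owns the positions p^2, ..., p^2 + p - 1. Since (p + 1)^2 > p^2 + p, distinct
    moduli own disjoint intervals, so a position determines both the modulus and the residue. *)
Lemma slot_inj Q B i i' t t' : slot Q B i t = slot Q B i' t' ->
  t = t' /\ i = i' %[mod modulus Q B t].
Proof.
have m0 k : 0 < modulus Q B k by exact: leq_ltn_trans (modulus_gt Q B k).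
have lt j j' k k' : j < j' -> slot Q B k j < slot Q B k' j'.
  move=> /(@modulus_lt Q B); rewrite /slot => h.
  by have := ltn_pmod k (m0 j); nia.
have [h|h|<-] := ltngtP t t' => e.
- by have := lt _ _ i i' h; rewrite e ltnn.
- by have := lt _ _ i' i h; rewrite e ltnn.
- by split=> //; move/eqP: e; rewrite /slot eqn_add2l => /eqP.
Qed.

(** At most [s ^ 2] searches of length [s ^ 4] starting from [s ^ 2] keep the moduli below [s ^ 7],
    and p^2 + p < (p + 1)^2 then gives the exponent 14 of the seed length. *)
Lemma slot_lt s l i k : 3 <= s -> l <= s -> k < s * l ->
  slot (s ^ 2) (s ^ 4) i k < s ^ 14.
Proof.
move=> s3 ls ksl.
have m0 : 0 < modulus (s ^ 2) (s ^ 4) k by exact: leq_ltn_trans (modulus_gt _ _ _).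
have h : modulus (s ^ 2) (s ^ 4) k < s ^ 7.
  apply: leq_ltn_trans (modulus_le _ _ _) _.
  have k1 : k.+1 <= s ^ 2 by rewrite -mulnn (leq_trans ksl) // leq_mul.
  apply: (@leq_ltn_trans (s ^ 2 + s ^ 2 * (s ^ 4).+1)).
    by rewrite leq_add2l leq_mul.
  have e6 : s ^ 2 * s ^ 4 = s ^ 6 by rewrite -expnD.
  have e7 : 3 * s ^ 6 <= s ^ 7 by rewrite (expnS s 6) leq_mul.
  have e2 : s ^ 2 < s ^ 6 by rewrite ltn_exp2l //; lia.
  by rewrite mulnS e6; lia.
have -> : s ^ 14 = s ^ 7 * s ^ 7 by rewrite -expnD.
rewrite /slot; have := ltn_pmod i m0; move: h; move: (modulus _ _ _) (s ^ 7) => a b.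
nia.
Qed.

End Primes.

(** * The weak design *)

Section Design.
Local Open Scope set_scope.
Local Open Scope ring_scope.
Variable R : realType.

(* [2 ^ #|T|] counts the subsets [S] of [T], and, the moduli being coprime, [S] is
   a set of divisors of [i - j] for at most [i / \prod_(k in S) P k] indices [j]. *)
Lemma design_overlap (I : finType) (P : I -> nat) (Q i : nat) : (0 < Q)%N ->
  (forall k, (Q <= P k)%N) -> (forall k k', k != k' -> coprime (P k) (P k')) ->
  (\sum_(j < i) 2 ^ #|[set k | (P k %| i - j)%N]|)%:R
    <= i%:R * (1 + Q%:R^-1) ^+ #|I| :> R.
Proof.
move=> Q0 QP co.
have dvdS (S : {set I}) n : (S \subset [set k | (P k %| n)%N]) =
    (\prod_(k in S) P k %| n)%N.
  rewrite -big_enum /=.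
  have -> : (S \subset [set k | (P k %| n)%N]) = all (fun k => (P k %| n)%N) (enum S).
    by apply/fintype.subsetP/allP => h k; [rewrite mem_enum => /h|rewrite -mem_enum => /h];
      rewrite inE.
  elim: (enum S) (enum_uniq S) => [|k s ih] /=; first by rewrite big_nil dvd1n.
  move=> /andP[ks us]; rewrite big_cons Gauss_dvd ?ih //.
  rewrite big_seq; apply: (big_ind (fun x => coprime (P k) x)) => [|x y cx cy|k' k's].
  - exact: coprimen1.
  - by rewrite coprimeMr cx.
  - by apply: co; apply: contraNneq ks => ->.
have P0 k : (0 < P k)%N by exact: leq_trans (QP k).
have -> : (\sum_(j < i) 2 ^ #|[set k | (P k %| i - j)%N]| =
    \sum_(S : {set I}) i %/ \prod_(k in S) P k)%N.
  under eq_bigr => j _ do rewrite -card_powerset -sum1_card big_mkcond /=.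
  rewrite exchange_big /=; apply: eq_bigr => S _.
  rewrite divn_count_dvd -(big_mkord xpredT (fun j =>
    if S \in powerset [set k | (P k %| i - j)%N] then 1%N else 0%N)).
  (* Reversed, [i - j] runs over 1, ..., i, where the multiples of the product are counted by the
     quotient. *)
  rewrite big_add1 /= big_nat_rev /= add0n !big_mkord; apply: eq_bigr => j _.
  rewrite inE dvdS (_ : (i - (i - j.+1) = j.+1)%N); last by have := ltn_ord j; lia.
  by case: dvdn.
rewrite natr_sum.
apply: (@le_trans _ _ (\sum_(S : {set I}) i%:R * \prod_(k in S) (P k)%:R^-1)).
  apply: ler_sum => S _; rewrite prodfV -natr_prod.
  have D0 : (0 < \prod_(k in S) P k)%N by apply: prodn_gt0.
  by rewrite ler_pdivlMr ?ltr0n // -natrM ler_nat leq_trunc_div.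
rewrite -big_distrr /= ler_wpM2l //.
have -> : (1 + Q%:R^-1) ^+ #|I| = \prod_(k : I) (Q%:R^-1 + 1) :> R.
  by rewrite prodr_const addrC.
(* Expanding the product over all subsets matches the two sides term by term, each 1 / P k being at
   most 1 / Q. *)
rewrite bigA_distr; apply: ler_sum => S _; rewrite big_mkcond /=.
apply: ler_prod => k _; case: ifP => _; last by rewrite ler01 lexx.
by rewrite invr_ge0 ler0n /= lef_pV2 ?posrE ?ltr0n // ler_nat.
Qed.

End Design.

(** * Circuits *)

Section Addresses.
Local Open Scope nat_scope.

Definition address_bit (l a b : nat) : bool := odd (a %/ 2 ^ (l - b.+1)).

Lemma address_lt l w : address l w < 2 ^ l.
Proof.
rewrite /address; elim: l => //= l ih.
by rewrite expnS; have := leq_b1 (w l); lia.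
Qed.

Lemma eq_address l w w' : (forall b, b < l -> w b = w' b) -> address l w = address l w'.
Proof.
rewrite /address; elim: l => //= l ih h.
by rewrite ih => [|b bl]; rewrite h // ltnW.
Qed.

Lemma addressK l w b : b < l -> address_bit l (address l w) b = w b.
Proof.
rewrite /address_bit; elim: l => // l ih; rewrite ltnS leq_eqVlt subSS.
have e : address l.+1 w = address l w * 2 + w l by [].
case/orP=> [/eqP ->|bl]; rewrite e.
  by rewrite subnn divn1 oddD muln2 odd_double oddb.
have -> : l - b = (l - b.+1).+1 by lia.
rewrite expnS divnMA divnMDl // [_ %/ 2]divn_small ?addn0 ?ih //.
by case: (w l).
Qed.

Lemma address_bitK l a : a < 2 ^ l -> address l (address_bit l a) = a.
Proof.
move=> al.
suff h j : j <= l -> address j (address_bit l a) = a %/ 2 ^ (l - j).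
  by rewrite h // subnn divn1.
elim: j => [|j ih] jl; first by rewrite subn0 divn_small.
have -> : address j.+1 (address_bit l a) =
  address j (address_bit l a) * 2 + address_bit l a j by [].
rewrite ih 1?ltnW // /address_bit (_ : l - j = (l - j.+1).+1); last lia.
rewrite expnSr divnMA; set q := a %/ _.
by rewrite [in RHS](divn_eq q 2) modn2.
Qed.

Definition xors (k : nat) (h : nat -> bool) : bool :=
  iteri k (fun i acc => acc (+) h i) false.

Lemma xorsD m n h : xors (m + n) h = xors m h (+) xors n (fun j => h (m + j)).
Proof.
elim: n => [|n ih]; first by rewrite addn0 addbF.
by rewrite addnS /= /xors /= -!/(xors _ _) ih addbA.
Qed.

Lemma xorsM m n h : xors (m * n) h = xors m (fun b => xors n (fun j => h (b * n + j))).
Proof.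
elim: m => // m ih; rewrite mulSn addnC xorsD ih.
by rewrite [in RHS]/xors /= -/(xors _ _) mulnC.
Qed.

Lemma eq_xors k h h' : (forall i, i < k -> h i = h' i) -> xors k h = xors k h'.
Proof.
rewrite /xors; elim: k => //= k ih e.
by rewrite ih => [|i ik]; rewrite e // ltnW.
Qed.

(** The truth table of parity: one conjunction for each of the [2 ^ k] patterns, a polynomial number
    as long as [k] is logarithmic. *)
Lemma xors_dnf k h : xors k h =
  has (fun a => xors k (address_bit k a) &&
         all (fun i => address_bit k a i == h i) (iota 0 k)) (iota 0 (2 ^ k)).
Proof.
apply/idP/hasP => [xh|[a _ /andP[xa /allP ha]]].
  exists (address k h); first by rewrite mem_iota address_lt.
  apply/andP; split.
    by rewrite (@eq_xors k _ h) // => i ik; rewrite addressK.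
  by apply/allP => i; rewrite mem_iota => ik; rewrite addressK.
suff <- : xors k (address_bit k a) = xors k h by [].
by apply: eq_xors => i ik; apply/eqP/ha; rewrite mem_iota.
Qed.

(** A multiplexer of depth two: some position [h] carries a true bit (index 0 of the conjunction)
    and has the given address (the indices [b.+1]). An address past the end reads [false] and
    satisfies no conjunction. *)
Lemma nth_address (x : seq bool) l w : size x <= 2 ^ l ->
  nth false x (address l w) =
  has (fun h => all (fun j => if j is b.+1 then address_bit l h b == w b
                              else nth false x h) (iota 0 l.+1)) (iota 0 (size x)).
Proof.
move=> hx; apply/idP/hasP => [xh|[h]].
  have [lt|ge] := ltnP (address l w) (size x); last by rewrite nth_default in xh.
  exists (address l w); first by rewrite mem_iota.
  apply/allP => -[|b] //; rewrite mem_iota /= add0n ltnS => bl.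
  by rewrite addressK.
rewrite mem_iota /= add0n => hn /andP[xh /allP hb].
suff -> : address l w = h by [].
rewrite -(@address_bitK l h); last exact: leq_trans hx.
apply: eq_address => b bl; apply/esym/eqP/(hb b.+1).
by rewrite mem_iota add1n.
Qed.

End Addresses.

(** * Building circuits gate by gate, with control of size and depth *)

Section Circuits.
Local Open Scope nat_scope.
Variable N : nat.

Definition wire_vals (gs : seq gate) (x : seq bool) : seq bool :=
  foldl (fun v g => rcons v (gate_val v g)) x gs.

Definition wire_depths (gs : seq gate) : seq nat :=
  foldl (fun l g => rcons l (\max_(j <- gate_args g) nth 0 l j).+1) (nseq N 0) gs.

Definition gates_wf (gs : seq gate) : Prop := forall i, i < size gs ->
  all (fun j => j < N + i) (gate_args (nth (AndGate [::]) gs i)).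

Definition gates_size (gs : seq gate) : nat :=
  \sum_(g <- gs) (size (gate_args g)).+1.

Lemma wire_vals_rcons gs g x :
  wire_vals (rcons gs g) x = rcons (wire_vals gs x) (gate_val (wire_vals gs x) g).
Proof. by rewrite /wire_vals -cats1 foldl_cat. Qed.

Lemma wire_depths_rcons gs g : wire_depths (rcons gs g) =
  rcons (wire_depths gs) (\max_(j <- gate_args g) nth 0 (wire_depths gs) j).+1.
Proof. by rewrite /wire_depths -cats1 foldl_cat. Qed.

Lemma size_wire_vals gs x : size (wire_vals gs x) = size x + size gs.
Proof.
elim/last_ind: gs => [|gs g ih]; first by rewrite addn0.
by rewrite wire_vals_rcons !size_rcons ih addnS.
Qed.

Lemma size_wire_depths gs : size (wire_depths gs) = N + size gs.
Proof.
elim/last_ind: gs => [|gs g ih]; first by rewrite addn0 size_nseq.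
by rewrite wire_depths_rcons !size_rcons ih addnS.
Qed.

Lemma nth_wire_vals_cat gs gs' x j : j < size x + size gs ->
  nth false (wire_vals (gs ++ gs') x) j = nth false (wire_vals gs x) j.
Proof.
move=> h; elim/last_ind: gs' => [|gs' g ih]; first by rewrite cats0.
rewrite -rcons_cat wire_vals_rcons nth_rcons size_wire_vals size_cat ih ifT //.
by rewrite addnA (leq_trans h) // leq_addr.
Qed.

Lemma nth_wire_depths_cat gs gs' j : j < N + size gs ->
  nth 0 (wire_depths (gs ++ gs')) j = nth 0 (wire_depths gs) j.
Proof.
move=> h; elim/last_ind: gs' => [|gs' g ih]; first by rewrite cats0.
rewrite -rcons_cat wire_depths_rcons nth_rcons size_wire_depths size_cat ih ifT //.
by rewrite addnA (leq_trans h) // leq_addr.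
Qed.

Definition realizes gs w (f : seq bool -> bool) lo hi : Prop :=
  [/\ w < N + size gs,
      forall x, size x = N -> nth false (wire_vals gs x) w = f x
    & lo <= nth 0 (wire_depths gs) w <= hi].

Lemma realizes_cat gs gs' w f lo hi :
  realizes gs w f lo hi -> realizes (gs ++ gs') w f lo hi.
Proof.
move=> [h1 h2 h3]; split.
- by rewrite size_cat addnA (leq_trans h1) // leq_addr.
- by move=> x sx; rewrite nth_wire_vals_cat ?sx // h2.
- by rewrite nth_wire_depths_cat.
Qed.

(* [f] is computed, between depths [lo] and [hi], by [S] gates and wires added
   to an arbitrary circuit *)
Definition buildable (f : seq bool -> bool) lo hi S : Prop :=
  forall gs, gates_wf gs -> exists gs' w,
    [/\ gates_wf (gs ++ gs'), gates_size gs' <= S & realizes (gs ++ gs') w f lo hi].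

Lemma buildable_sub f f' lo hi S lo' hi' S' :
  (forall x, size x = N -> f x = f' x) -> lo' <= lo -> hi <= hi' -> S <= S' ->
  buildable f lo hi S -> buildable f' lo' hi' S'.
Proof.
move=> e h1 h2 h3 H gs wf; have [gs' [w [wf' sz [r1 r2 r3]]]] := H gs wf.
exists gs', w; split=> //; first exact: leq_trans h3.
by split=> // [x sx|]; [rewrite -e // r2 | lia].
Qed.

Lemma buildable_input i : i < N -> buildable (fun x => nth false x i) 0 0 0.
Proof.
move=> iN gs wf; exists [::], i; rewrite cats0; split=> //.
  by rewrite /gates_size big_nil.
split; first exact: leq_trans (leq_addr _ _).
- by move=> x sx; rewrite -[gs]cat0s nth_wire_vals_cat ?sx ?addn0.
- by rewrite -[gs]cat0s nth_wire_depths_cat ?addn0 //= nth_nseq iN.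
Qed.

Lemma gates_wf_rcons gs g : gates_wf gs ->
  all (fun j => j < N + size gs) (gate_args g) -> gates_wf (rcons gs g).
Proof.
move=> wf h i; rewrite size_rcons ltnS leq_eqVlt nth_rcons => /orP[/eqP ->|lt].
  by rewrite ltnn eqxx.
by rewrite lt; exact: wf.
Qed.

Lemma gates_size_cat gs gs' : gates_size (gs ++ gs') = gates_size gs + gates_size gs'.
Proof. by rewrite /gates_size big_cat. Qed.

Lemma add_gate gs gs' g f lo hi S : gates_wf (gs ++ gs') ->
  all (fun j => j < N + size (gs ++ gs')) (gate_args g) ->
  gates_size gs' + (size (gate_args g)).+1 <= S ->
  (forall x, size x = N -> gate_val (wire_vals (gs ++ gs') x) g = f x) ->
  lo <= (\max_(j <- gate_args g) nth 0 (wire_depths (gs ++ gs')) j).+1 <= hi ->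
  exists gs'' w,
    [/\ gates_wf (gs ++ gs''), gates_size gs'' <= S & realizes (gs ++ gs'') w f lo hi].
Proof.
move=> wf args sz vals deps; exists (rcons gs' g), (N + size (gs ++ gs')).
rewrite -rcons_cat; split.
- exact: gates_wf_rcons.
- by rewrite -cats1 gates_size_cat /gates_size [X in _ + X]big_seq1.
split.
- by rewrite size_rcons addnS.
- move=> x sx; rewrite wire_vals_rcons nth_rcons size_wire_vals sx ltnn eqxx.
  exact: vals.
- by rewrite wire_depths_rcons nth_rcons size_wire_depths ltnn eqxx.
Qed.

Lemma buildable_not f lo hi S : buildable f lo hi S ->
  buildable (fun x => ~~ f x) lo.+1 hi.+1 (S + 2).
Proof.
move=> H gs wf; have [gs' [w [wf' sz [r1 r2 r3]]]] := H gs wf.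
apply: (add_gate (g := NotGate w) wf') => //=.
- by rewrite r1.
- by rewrite leq_add2r.
- by move=> x sx; rewrite r2.
- by rewrite big_seq1.
Qed.

Lemma buildable_seq (f : nat -> seq bool -> bool) k lo hi S :
  (forall i, i < k -> buildable (f i) lo hi S) ->
  forall gs, gates_wf gs -> exists gs' ws,
    [/\ gates_wf (gs ++ gs'), gates_size gs' <= k * S, size ws = k
      & forall i, i < k -> realizes (gs ++ gs') (nth 0 ws i) (f i) lo hi].
Proof.
move=> H gs wf; elim: k H => [|k ih] H.
  by exists [::], [::]; rewrite cats0; split=> //; rewrite /gates_size big_nil.
have [gs1 [ws [wf1 sz1 sw1 r1]]] := ih (fun i ik => H i (ltnW ik)).
have [gs2 [w [wf2 sz2 r2]]] := H k (ltnSn k) _ wf1.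
exists (gs1 ++ gs2), (rcons ws w); rewrite catA; split=> //.
- by rewrite gates_size_cat mulSn addnC leq_add.
- by rewrite size_rcons sw1.
- move=> i; rewrite ltnS leq_eqVlt nth_rcons sw1 => /orP[/eqP ->|ik].
    by rewrite ltnn eqxx.
  by rewrite ik; apply: realizes_cat; exact: r1.
Qed.

Lemma max_nth_le (l : seq nat) (ws : seq nat) hi :
  (forall i, i < size ws -> nth 0 l (nth 0 ws i) <= hi) ->
  \max_(j <- ws) nth 0 l j <= hi.
Proof.
move=> h; rewrite big_seq; apply: (big_ind (fun m => m <= hi)) => // [a b ha hb|j].
  by rewrite geq_max ha.
by move=> /(nthP 0)[i iw <-]; exact: h.
Qed.

Lemma buildable_and (f : nat -> seq bool -> bool) k hi S :
  (forall i, i < k -> buildable (f i) 0 hi S) ->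
  buildable (fun x => all (fun i => f i x) (iota 0 k)) 0 hi.+1 (k * S + k + 1).
Proof.
move=> H gs wf; have [gs' [ws [wf' sz sw r]]] := buildable_seq H wf.
apply: (add_gate (g := AndGate ws) wf') => /=.
- by apply/allP => j /(nthP 0)[i iw <-]; case: (r i); rewrite ?sw // -sw.
- by rewrite sw; lia.
- move=> x sx; rewrite -{1}(mkseq_nth 0 ws) sw all_map; apply: eq_in_all => i.
  by rewrite mem_iota => ik /=; case: (r i) => // _ ->.
- by rewrite ltnS; apply: max_nth_le => i; rewrite sw => /r[_ _].
Qed.

Lemma buildable_or (f : nat -> seq bool -> bool) k hi S :
  (forall i, i < k -> buildable (f i) 0 hi S) ->
  buildable (fun x => has (fun i => f i x) (iota 0 k)) 0 hi.+1 (k * S + k + 1).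
Proof.
move=> H gs wf; have [gs' [ws [wf' sz sw r]]] := buildable_seq H wf.
apply: (add_gate (g := OrGate ws) wf') => /=.
- by apply/allP => j /(nthP 0)[i iw <-]; case: (r i); rewrite ?sw // -sw.
- by rewrite sw; lia.
- move=> x sx; rewrite -{1}(mkseq_nth 0 ws) sw has_map; apply: eq_in_has => i.
  by rewrite mem_iota => ik /=; case: (r i) => // _ ->.
- by rewrite ltnS; apply: max_nth_le => i; rewrite sw => /r[_ _].
Qed.

Lemma buildable_literal b f hi S : buildable f 0 hi S ->
  buildable (fun x => b == f x) 0 hi.+1 (S + 2).
Proof.
case: b => H.
  by apply: buildable_sub H => [x _|||]; [case: (f x)|lia..].
by apply: buildable_sub (buildable_not H) => [x _|||]; [case: (f x)|lia..].
Qed.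

Lemma buildable_xors (f : nat -> seq bool -> bool) k hi S :
  (forall i, i < k -> buildable (f i) 0 hi S) ->
  buildable (fun x => xors k (fun i => f i x)) 0 (hi + 3)
    (2 ^ k * (k * (S + 2) + k + 1) + 2 ^ k + 1).
Proof.
move=> H; pose S1 := k * (S + 2) + k + 1.
have H1 a : buildable (fun x => xors k (address_bit k a) &&
    all (fun i => address_bit k a i == f i x) (iota 0 k)) 0 hi.+2 S1.
  case: (xors k (address_bit k a)) => /=.
    by apply: buildable_and => i ik; apply: buildable_literal; exact: H.
  (* A pattern of even parity contributes the constant [false], obtained as an empty disjunction. *)
  have := @buildable_or (fun _ _ => false) 0 0 0 (fun i i0 => False_ind _ (notF i0)).
  by apply: buildable_sub => //; rewrite /S1; lia.
have := @buildable_or _ (2 ^ k) _ _ (fun a _ => H1 a).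
apply: buildable_sub => //; last by rewrite addn3.
by move=> x _; rewrite [in RHS]xors_dnf.
Qed.

(** A tree of arity [k] and height [A]: each level is a parity of [k] bits in depth 3. For
    logarithmic [k] the factor [q] per level is polynomial, and the height is why the depth grows
    with the exponent of the logarithm. *)
Lemma buildable_xors_tree (f : nat -> seq bool -> bool) k A hi S q :
  (forall i, i < k ^ A -> buildable (f i) 0 hi S) -> 0 < S ->
  2 ^ k * (3 * k + 2 * k + 2) + 1 <= q ->
  buildable (fun x => xors (k ^ A) (fun i => f i x)) 0 (hi + 3 * A) (q ^ A * S).
Proof.
move=> H S0 hq; elim: A f H => [|A ih] f H.
  apply: buildable_sub (H 0 isT) => //.
    by rewrite muln0 addn0.
  by rewrite expn0 mul1n.
have H1 b : b < k -> buildable (fun x =>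
    xors (k ^ A) (fun j => f (b * k ^ A + j) x)) 0 (hi + 3 * A) (q ^ A * S).
  move=> bk; apply: ih => j jA; apply: H.
  by rewrite expnS; nia.
apply: buildable_sub (buildable_xors H1) => [x _|||] //.
- by rewrite expnS [in RHS]xorsM.
- lia.
have q0 : 0 < q by lia.
have : 0 < q ^ A * S by rewrite muln_gt0 expn_gt0 q0.
rewrite expnS -mulnA; move: (q ^ A * S) => T T0.
apply: (@leq_trans ((2 ^ k * (3 * k + 2 * k + 2) + 1) * T)); last by rewrite leq_mul2r hq orbT.
have h1 : k * (T + 2) + k + 2 <= (3 * k + 2 * k + 2) * T by nia.
have h2 := leq_mul (leqnn (2 ^ k)) h1.
rewrite mulnDl mul1n -mulnA; lia.
Qed.

(** Double negations change nothing but the depth: they force it above the required lower bound. *)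
Lemma buildable_nots f hi S r : buildable f 0 hi S ->
  buildable f (2 * r) (hi + 2 * r) (S + 4 * r).
Proof.
move=> H; elim: r => [|r ih]; first by apply: buildable_sub H => //; lia.
apply: buildable_sub (buildable_not (buildable_not ih)) => [x _|||]; lia.
Qed.

(** The depth is a maximum over the outputs, so its lower bound relies on there being one, whence
    [0 < m]. *)
Lemma buildable_circuit (f : nat -> seq bool -> bool) m lo hi S : 0 < m ->
  (forall i, i < m -> buildable (f i) lo hi S) ->
  exists C, [/\ circuit_wf N C, circuit_size C <= m * S,
    lo <= circuit_depth N C <= hi
    & forall x, size x = N -> circuit_eval C x = mkseq (fun i => f i x) m].
Proof.
move=> m0 H; have wf0 : gates_wf [::] by [].
have [gs [ws [wf sz sw r]]] := buildable_seq H wf0.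
exists (Circuit gs ws); split=> //.
- split=> //=.
  by apply/allP => j /(nthP 0)[i iw <-]; case: (r i); rewrite // -sw.
- rewrite /circuit_depth /= -/(wire_depths gs); apply/andP; split; last first.
    by apply: max_nth_le => i; rewrite sw => /r[_ _ /andP[]].
  have [_ _ /andP[lo0 _]] := r 0 m0; apply: leq_trans lo0 _.
  apply: (leq_bigmax_seq (F := fun j => nth 0 (wire_depths gs) j)) => //.
  by rewrite mem_nth // sw.
- move=> x sx; rewrite /circuit_eval /= -/(wire_vals gs x).
  rewrite -{1}(mkseq_nth 0 ws) sw -map_comp; apply/eq_in_map => i.
  by rewrite mem_iota => im /=; case: (r i) => // _ ->.
Qed.

End Circuits.

(** * The circuit of the extractor *)

Section ExtractorCircuit.
Local Open Scope nat_scope.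

Lemma buildable_sample n d l (q : nat -> nat) : n <= 2 ^ l ->
  (forall b, b < l -> q b < d) ->
  buildable (n + d) (fun y => nth false (take n y)
      (address l (fun b => nth false (drop n y) (q b))))
    0 3 (n * ((l.+1) * 2 + l.+1 + 1) + n + 1).
Proof.
move=> nl hq.
have H h : h < n -> buildable (n + d) (fun y =>
    all (fun j => if j is b.+1 then address_bit l h b == nth false y (n + q b)
                  else nth false y h) (iota 0 l.+1)) 0 2 (l.+1 * 2 + l.+1 + 1).
  move=> hn; apply: buildable_and => -[|b] bl.
    by apply: buildable_sub (buildable_input _) => //; lia.
  apply: (@buildable_literal _ _ _ 0 0); apply: buildable_input.
  by rewrite ltn_add2l hq.
apply: buildable_sub (buildable_or H) => // y sy.
have sx : size (take n y) = n by rewrite size_takel // sy leq_addr.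
rewrite nth_address sx //; apply: eq_in_has => h; rewrite mem_iota => hn.
apply: eq_in_all => -[|b] _; first by rewrite nth_take.
by rewrite nth_drop.
Qed.

Theorem ext_bit_circuit n d l A m r : 0 < m -> n <= 2 ^ l ->
  (forall i k, k < l ^ A * l -> slot ((l ^ A) ^ 2) ((l ^ A) ^ 4) i k < d) ->
  exists C, [/\ circuit_wf (n + d) C,
    circuit_size C <= m * ((2 ^ l * (3 * l + 2 * l + 2) + 1) ^ A *
       (n * (l.+1 * 2 + l.+1 + 1) + n + 1) + 4 * r),
    2 * r <= circuit_depth (n + d) C <= 3 + 3 * A + 2 * r
    & forall x u, size x = n -> size u = d ->
       circuit_eval C (x ++ u) = mkseq (ext_bit A l x u) m].
Proof.
move=> m0 nl hs.
pose f i y := ext_bit A l (take n y) (drop n y) i.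
have H i : i < m -> buildable (n + d) (f i) (2 * r) (3 + 3 * A + 2 * r)
   ((2 ^ l * (3 * l + 2 * l + 2) + 1) ^ A *
       (n * (l.+1 * 2 + l.+1 + 1) + n + 1) + 4 * r).
  move=> _; apply: buildable_nots; apply: buildable_xors_tree => //; last lia.
  move=> j js; apply: buildable_sample => // b bl; apply: hs.
  by move: js; move: (l ^ A) => s js; nia.
have [C [wf sz dp ev]] := buildable_circuit m0 H.
exists C; split=> // x u sx su.
rewrite ev ?size_cat ?sx ?su //; apply: (@eq_mkseq bool) => i.
by rewrite /f take_size_cat // drop_size_cat.
Qed.

End ExtractorCircuit.

(** * Reduction to the prediction of one bit *)

Section Hybrid.
Variable R : realType.

Lemma sum_tuple_rcons m (F : seq bool -> R) :
  \sum_(z : m.+1.-tuple bool) F z =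
  \sum_(z : m.-tuple bool) (F (rcons z true) + F (rcons z false)).
Proof.
pose h (zc : m.-tuple bool * bool) := [tuple of rcons zc.1 zc.2].
have hinj : injective h.
  move=> [z c] [z' c'] /(congr1 val) /= /rcons_inj [e ->].
  by congr (_, _); exact: val_inj.
have hbij : bijective h.
  by apply: inj_card_bij => //; rewrite card_prod !card_tuple card_bool expnSr.
rewrite (reindex h) /=; last exact: onW_bij.
rewrite -(pair_big xpredT xpredT (fun (z : m.-tuple bool) c => F (rcons z c))) /=.
by apply: eq_bigr => z _; rewrite big_bool.
Qed.

(** Induction on the number of bits. If a prefix has mass [y] and the next bit has signed bias [e]
    on it, the two extensions have masses (y - e) / 2 and (y + e) / 2, so the triangle inequality
    charges the new bit with |e| only. *)
Lemma hybrid (X : finType) (p : X -> R) (b : X -> nat -> bool) (m : nat) :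
  \sum_x p x = 1 ->
  \sum_(z : m.-tuple bool) `|\sum_(x | mkseq (b x) m == z) p x - 2^-1 ^+ m| <=
  \sum_(i < m) \sum_(z : i.-tuple bool)
    `|\sum_(x | mkseq (b x) i == z) p x * (-1) ^+ (b x i)|.
Proof.
move=> p1; elim: m => [|m ih].
  rewrite big_ord0 big1 // => z _; rewrite expr0.
  rewrite (eq_bigl xpredT) ?p1 ?subrr ?normr0 // => x.
  by rewrite [z]tuple0 /mkseq /=.
rewrite big_ord_recr /= (sum_tuple_rcons _ (fun z =>
  `|\sum_(x | mkseq (b x) m.+1 == z) p x - 2^-1 ^+ m.+1|)).
apply: (@le_trans _ _ (\sum_(z : m.-tuple bool)
  (`|\sum_(x | mkseq (b x) m == z) p x - 2^-1 ^+ m| +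
   `|\sum_(x | mkseq (b x) m == z) p x * (-1) ^+ (b x m)|))); last first.
  by rewrite big_split /= lerD2r.
apply: ler_sum => z _.
have split c : \sum_(x | mkseq (b x) m.+1 == rcons z c) p x =
    \sum_(x | mkseq (b x) m == z) (if b x m == c then p x else 0).
  by rewrite -big_mkcondr; apply: eq_bigl => x; rewrite mkseqS eqseq_rcons.
rewrite !split.
set y := \sum_(x | _) p x; set e := \sum_(x | _) p x * _.
have -> : \sum_(x | mkseq (b x) m == z) (if b x m == true then p x else 0) = (y - e) / 2.
  rewrite /y /e -sumrB mulr_suml; apply: eq_bigr => x _.
  by case: (b x m) => /=; rewrite ?expr0 ?expr1; field.
have -> : \sum_(x | mkseq (b x) m == z) (if b x m == false then p x else 0) = (y + e) / 2.
  rewrite /y /e -big_split /= mulr_suml; apply: eq_bigr => x _.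
  by case: (b x m) => /=; rewrite ?expr0 ?expr1; field.
rewrite exprS; set t := 2^-1 ^+ m.
have -> : (y - e) / 2 - 2^-1 * t = ((y - t) - e) / 2 by field.
have -> : (y + e) / 2 - 2^-1 * t = ((y - t) + e) / 2 by field.
rewrite !normrM (ger0_norm (_ : 0 <= 2^-1 :> R)) ?invr_ge0 //.
have h1 := ler_normB (y - t) e; have h2 := ler_normD (y - t) e.
lra.
Qed.

Lemma stat_dist_hybrid n d m (p : n.-tuple bool -> R)
    (b : n.-tuple bool -> d.-tuple bool -> nat -> bool)
    (Ext : n.-tuple bool -> d.-tuple bool -> m.-tuple bool) :
  \sum_x p x = 1 ->
  (forall x u, Ext x u = mkseq (b x u) m :> seq bool) ->
  stat_dist
    (image_distr (fun xu : n.-tuple bool * d.-tuple bool =>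
          [tuple of xu.2 ++ Ext xu.1 xu.2])
       (indep_pair p (uniform R (d.-tuple bool))))
    (uniform R ((d + m).-tuple bool)) <=
  \sum_(i < m) (2^-1 ^+ d * \sum_(u : d.-tuple bool) \sum_(z : i.-tuple bool)
    `|\sum_(x | mkseq (b x u) i == z) p x * (-1) ^+ (b x u i)|).
Proof.
move=> p1 ExtE.
pose h (uz : d.-tuple bool * m.-tuple bool) := [tuple of uz.1 ++ uz.2].
have hinj : injective h.
  move=> [u z] [u' z'] /(congr1 val) /= /eqP; rewrite eqseq_cat ?size_tuple //.
  by case/andP=> /eqP e /eqP e'; congr (_, _); exact: val_inj.
have hbij : bijective h.
  by apply: inj_card_bij => //; rewrite card_prod !card_tuple expnD.
have half k : (2 ^ k)%:R^-1 = 2^-1 ^+ k :> R by rewrite natrX exprVn.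
rewrite /stat_dist (reindex h) /=; last exact: onW_bij.
rewrite -(pair_big xpredT xpredT (fun u z => `|_ (h (u, z)) - _ (h (u, z))|)) /=.
rewrite -[leRHS]big_distrr [in leRHS]exchange_big [leRHS]big_distrr [leLHS]big_distrr /=.
apply: ler_sum => u _.
apply: (@le_trans _ _ (2^-1 ^+ d * \sum_(z : m.-tuple bool)
  `|\sum_(x | mkseq (b x u) m == z) p x - 2^-1 ^+ m|)); last first.
  by rewrite ler_wpM2l ?exprn_ge0 ?invr_ge0 // hybrid.
rewrite mulrC big_distrl big_distrr /=; apply: ler_sum => z _.
have -> : image_distr (fun xu : n.-tuple bool * d.-tuple bool =>
          [tuple of xu.2 ++ Ext xu.1 xu.2])
       (indep_pair p (uniform R (d.-tuple bool))) (h (u, z)) =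
    2^-1 ^+ d * \sum_(x | mkseq (b x u) m == z) p x.
  rewrite /image_distr /indep_pair /uniform card_tuple card_bool half.
  rewrite (eq_bigl (fun xu : n.-tuple bool * d.-tuple bool =>
    (mkseq (b xu.1 u) m == z) && (xu.2 == u))).
    rewrite -(pair_big (fun x => mkseq (b x u) m == z) (fun u' => u' == u)
      (fun x _ => p x * 2^-1 ^+ d)) /= big_distrr /=; apply: eq_bigr => x _.
    by rewrite big_pred1_eq mulrC.
  move=> [x u']; rewrite -val_eqE /= eqseq_cat ?size_tuple // andbC ExtE val_eqE.
  by case: (eqVneq u' u) => [->|]; rewrite ?andbF.
rewrite /uniform card_tuple card_bool half exprD -mulrBr normrM.
rewrite ger0_norm ?exprn_ge0 ?invr_ge0 //.
(* The factor 1/2 of the statistical distance is given away here. *)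
by rewrite ler_piMr ?mulr_ge0 ?exprn_ge0 ?invr_ge0 // invf_le1 ?ler1n.
Qed.

End Hybrid.

(** * Resampling the seed *)

Lemma card_set_type (I : finType) : #|{set I}| = (2 ^ #|I|)%N.
Proof. by rewrite -[#|I|]cardsT -card_powerset powersetT cardsT. Qed.

Section Resample.
Local Open Scope set_scope.
Local Open Scope ring_scope.
Variables (R : realType) (I : finType) (d : nat) (sg : I -> 'I_d).
Hypothesis sg_inj : injective sg.

Definition put (u : d.-tuple bool) (w : {set I}) : d.-tuple bool :=
  [tuple if [pick t | sg t == k] is Some t then t \in w else tnth u k | k < d].

Lemma tnth_put u w t : tnth (put u w) (sg t) = (t \in w).
Proof.
rewrite tnth_mktuple; case: pickP => [t' /eqP /sg_inj -> //|/(_ t)].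
by rewrite eqxx.
Qed.

Lemma tnth_put_out u w k : (forall t, sg t != k) -> tnth (put u w) k = tnth u k.
Proof.
by move=> h; rewrite tnth_mktuple; case: pickP => // t; rewrite (negbTE (h t)).
Qed.

(** Exchanging [w] with the seed bits at the positions [sg] is an involution of the pairs, so
    overwriting a uniform seed by uniform bits leaves it uniform. *)
Lemma resample (G : d.-tuple bool -> R) :
  2 ^+ #|I| * \sum_u G u = \sum_u \sum_(w : {set I}) G (put u w).
Proof.
pose h (uw : d.-tuple bool * {set I}) :=
  (put uw.1 uw.2, [set t | tnth uw.1 (sg t)]).
have hK : involutive h.
  move=> [u w]; rewrite /h /=; congr (_, _).
    apply: eq_from_tnth => k; rewrite [LHS]tnth_mktuple.
    case: pickP => [t /eqP <-|hk]; first by rewrite inE.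
    by rewrite tnth_put_out // => t; rewrite hk.
  by apply/setP => t; rewrite inE tnth_put.
transitivity (\sum_u \sum_(w : {set I}) G u).
  rewrite mulr_sumr; apply: eq_bigr => u _.
  by rewrite sumr_const card_set_type -natrX mulr_natl.
by rewrite !pair_big /= (reindex_inj (inv_inj hK)).
Qed.

End Resample.

(** * Prediction of one bit *)

Section OneBit.
Local Open Scope set_scope.
Local Open Scope ring_scope.
Variable R : realType.

(** A weighted AM-GM inequality in the role of Cauchy-Schwarz: it passes to second moments without
    square roots, the weight being free to depend on the conditioning. *)
Lemma norm_le_AMGM (a eta : R) : 0 < eta -> `|a| <= 2^-1 * (eta + a ^+ 2 / eta).
Proof.
move=> e0; rewrite -subr_ge0.
have -> : 2^-1 * (eta + a ^+ 2 / eta) - `|a| = (2 * eta)^-1 * (eta - `|a|) ^+ 2.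
  by rewrite -(real_normK (num_real a)); field; rewrite gt_eqF.
by rewrite mulr_ge0 ?sqr_ge0 // invr_ge0 mulr_ge0 // ltW.
Qed.

(** Here [p] is the law of the source, [w] the fresh seed bits read by the predicted bit [c x w],
    and [tab x] a table from which [h] recovers the earlier output bits. The set [K] contains all
    tables, and [close] stands for small Hamming distance. *)
Variables (X W T Z : finType) (p : X -> R) (c : X -> W -> bool) (tab : X -> T)
  (K : {set T}) (h : T -> W -> Z) (close : rel X) (kap lam nu M : R).
Hypotheses (p_ge0 : forall x, 0 <= p x) (p_sum1 : \sum_x p x = 1)
  (p_le : forall x, p x <= kap) (tabK : forall x, tab x \in K)
  (kap0 : 0 < kap) (lam0 : 0 <= lam) (nu0 : 0 < nu) (M0 : 0 < M) (W0 : (0 < #|W|)%N)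
  (far : forall x x', #|W|%:R^-1 * \sum_w (-1) ^+ (c x w) * (-1) ^+ (c x' w)
     <= lam ^+ 2 + (close x x')%:R)
  (ball : forall x, \sum_x' (close x x')%:R <= M).

Let bias t w := \sum_(x | tab x == t) p x * (-1) ^+ (c x w).
Let mass t := \sum_(x | tab x == t) p x.

(** Conditioning on the whole table is finer than conditioning on the earlier bits, and the
    condition no longer depends on [w]. *)
Lemma refine_bias w :
  \sum_(z : Z) `|\sum_(x | h (tab x) w == z) p x * (-1) ^+ (c x w)|
  <= \sum_(t in K) `|bias t w|.
Proof.
have -> : \sum_(t in K) `|bias t w| =
    \sum_(t in K) \sum_(z : Z) (if h t w == z then `|bias t w| else 0).
  apply: eq_bigr => t _.
  by rewrite -big_mkcond (eq_bigl (pred1 (h t w))) ?big_pred1_eq // => z; rewrite eq_sym.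
rewrite exchange_big /=; apply: ler_sum => z _.
rewrite (partition_big tab (fun t => t \in K)) //=.
apply: le_trans (ler_norm_sum _ _ _) _; apply: ler_sum => t _.
rewrite (eq_bigl (fun x => (tab x == t) && (h t w == z))).
  case: eqP => _; last by rewrite big1 ?normr0 // => x; rewrite andbF.
  by under eq_bigl => x do rewrite andbT.
by move=> x; case: (eqVneq (tab x) t) => [->|]; rewrite ?andbF // andbT.
Qed.

Lemma mass_ge0 t : 0 <= mass t. Proof. exact: sumr_ge0. Qed.

(** Expanding the square leaves the correlations of pairs of words. Far pairs contribute at most
    [lam ^+ 2] times their mass; the words close to a given one have total mass at most
    [kap * M]. *)
Lemma second_moment t :
  #|W|%:R^-1 * \sum_w bias t w ^+ 2 <= lam ^+ 2 * mass t ^+ 2 + mass t * (kap * M).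
Proof.
have -> : #|W|%:R^-1 * \sum_w bias t w ^+ 2 = \sum_(x | tab x == t)
    \sum_(x' | tab x' == t) p x * p x' *
      (#|W|%:R^-1 * \sum_w (-1) ^+ (c x w) * (-1) ^+ (c x' w)).
  under eq_bigr => w _ do rewrite expr2 /bias mulr_suml.
  rewrite exchange_big mulr_sumr /=; apply: eq_bigr => x _.
  under eq_bigr => w _ do rewrite mulr_sumr.
  rewrite exchange_big mulr_sumr /=; apply: eq_bigr => x' _.
  rewrite mulrCA; congr (_ * _); rewrite mulr_sumr; apply: eq_bigr => w _.
  by ring.
apply: (@le_trans _ _ (\sum_(x | tab x == t) \sum_(x' | tab x' == t)
   (lam ^+ 2 * (p x * p x') + p x * (kap * (close x x')%:R)))).
  apply: ler_sum => x _; apply: ler_sum => x' _.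
  apply: le_trans (ler_wpM2l _ (far x x')) _; first by rewrite mulr_ge0.
  rewrite mulrDr mulrC lerD2l -mulrA ler_wpM2l // ler_wpM2r //.
under eq_bigr => x _ do rewrite big_split /=.
rewrite big_split /=; apply: lerD.
  rewrite [mass t ^+ 2]expr2 /mass mulr_suml mulr_sumr; apply: ler_sum => x _.
  by rewrite !mulr_sumr; apply: ler_sum => x' _.
rewrite /mass mulr_suml; apply: ler_sum => x _.
rewrite -!mulr_sumr ler_wpM2l // ler_wpM2l ?(ltW kap0) //.
apply: le_trans (ball x); rewrite big_mkcond; apply: ler_sum => x' _.
by case: ifP => // _; exact: ler0n.
Qed.

Lemma one_bit_bias :
  #|W|%:R^-1 * \sum_w \sum_(z : Z) `|\sum_(x | h (tab x) w == z) p x * (-1) ^+ (c x w)|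
  <= lam + nu + #|K|%:R * (kap * M / nu).
Proof.
have Winv : 0 <= #|W|%:R^-1 :> R by rewrite invr_ge0.
apply: (@le_trans _ _ (#|W|%:R^-1 * \sum_w \sum_(t in K) `|bias t w|)).
  by rewrite ler_wpM2l //; apply: ler_sum => w _; exact: refine_bias.
rewrite exchange_big mulr_sumr /=.
have kM0 : 0 < kap * M / nu by rewrite divr_gt0 // mulr_gt0.
(* The weight is chosen so that its square dominates the second moment: the product of its last two
   summands is exactly [mass t * (kap * M)]. Its sum over the tables is the claimed bound, the
   masses adding up to 1. *)
pose eta t := lam * mass t + nu * mass t + kap * M / nu.
apply: (@le_trans _ _ (\sum_(t in K) eta t)).
  apply: ler_sum => t _; have P0 := mass_ge0 t.
  have e0 : 0 < eta t by rewrite /eta ltr_wpDl // addr_ge0 // mulr_ge0 // ltW.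
  apply: (@le_trans _ _ (#|W|%:R^-1 * \sum_w (2^-1 * (eta t + bias t w ^+ 2 / eta t)))).
    by rewrite ler_wpM2l //; apply: ler_sum => w _; exact: norm_le_AMGM.
  rewrite -mulr_sumr big_split /= sumr_const -mulr_suml -[eta t *+ _]mulr_natl.
  have W1 : #|W|%:R != 0 :> R by rewrite pnatr_eq0 -lt0n.
  have -> : #|W|%:R^-1 * (2^-1 * (#|W|%:R * eta t + (\sum_w bias t w ^+ 2) / eta t)) =
      2^-1 * (eta t + (#|W|%:R^-1 * \sum_w bias t w ^+ 2) / eta t).
    by field; rewrite W1 gt_eqF.
  have h2 : (#|W|%:R^-1 * \sum_w bias t w ^+ 2) / eta t <= eta t.
    rewrite ler_pdivrMr // -expr2; apply: le_trans (second_moment t) _.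
    have -> : mass t * (kap * M) = (nu * mass t) * (kap * M / nu).
      by field; rewrite gt_eqF.
    rewrite /eta -exprMn; move: (lam * mass t) (nu * mass t) (kap * M / nu)
      (mulr_ge0 lam0 P0) (mulr_ge0 (ltW nu0) P0) (ltW kM0) => a b e a0 b0 e0'.
    rewrite -subr_ge0 (_ : _ - _ =
      b ^+ 2 + e ^+ 2 + 2 * a * b + 2 * a * e + b * e); last by ring.
    by do ?[apply: addr_ge0 | apply: sqr_ge0 | apply: mulr_ge0].
  lra.
have mass1 : \sum_(t in K) mass t = 1.
  by rewrite -p_sum1 (partition_big tab (fun t => t \in K)).
rewrite /eta big_split big_split /= sumr_const mulr_natl -2!mulr_sumr.
by rewrite mass1 !mulr1.
Qed.

End OneBit.

(** * Correlation of samples *)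

Section Samples.
Local Open Scope set_scope.
Local Open Scope ring_scope.
Variable R : realType.

(** A set of at most [w.+1] elements arises from one of at most [w] by adding an optional element,
    hence the base #|I| + 1. *)
Lemma card_small_sets (I : finType) w :
  (#|[set S : {set I} | (#|S| <= w)%N]| <= #|I|.+1 ^ w)%N.
Proof.
elim: w => [|w ih].
  rewrite expn0 (_ : [set S : {set I} | _] = [set finset.set0]) ?cards1 //.
  by apply/setP => S; rewrite !inE leqn0 cards_eq0.
pose f (oS : option I * {set I}) := if oS.1 is Some k then k |: oS.2 else oS.2.
pose B := finset.setX [set: option I] [set S : {set I} | (#|S| <= w)%N].
apply: (@leq_trans #|f @: B|); last first.
  apply: leq_trans (leq_imset_card _ _) _.
  by rewrite cardsX cardsT card_option expnS leq_mul2l ih orbT.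
apply/subset_leq_card/fintype.subsetP => S; rewrite inE => Sw.
have [->|/finset.set0Pn[k kS]] := eqVneq S finset.set0.
  by apply/imsetP; exists (None, finset.set0); rewrite // !inE cards0.
apply/imsetP; exists (Some k, S :\ k); last by rewrite /f /= finset.setD1K.
by rewrite !inE /=; move: Sw; rewrite (cardsD1 k S) kS.
Qed.

Definition distance n (x x' : n.-tuple bool) : nat :=
  #|[set k | tnth x k != tnth x' k]|.

Lemma card_ball n (x : n.-tuple bool) w :
  \sum_(x' : n.-tuple bool) ((distance x x' <= w)%N)%:R <= (n.+1 ^ w)%:R :> R.
Proof.
rewrite -natr_sum ler_nat -big_mkcond sum1_card.
apply: leq_trans (_ : _ <= #|[set S : {set 'I_n} | (#|S| <= w)%N]|)%N _; last first.
  by apply: leq_trans (card_small_sets _ _) _; rewrite card_ord.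
pose f (x' : n.-tuple bool) := [set k | tnth x k != tnth x' k].
have finj : injective f.
  move=> y y' /setP e; apply: eq_from_tnth => k; move: (e k); rewrite !inE.
  by case: (tnth x k); case: (tnth y k); case: (tnth y' k).
rewrite -(card_imset _ finj); apply/subset_leq_card/fintype.subsetP => S.
by case/imsetP => y yw ->; rewrite inE.
Qed.

Lemma sum_address l (phi : nat -> R) :
  \sum_(v : {set 'I_l}) phi (address l (fun b => [exists k in v, (k : nat) == b]))
  = \sum_(h < 2 ^ l) phi h.
Proof.
pose f (h : 'I_(2 ^ l)) := [set b : 'I_l | address_bit l h b].
have fE (h : 'I_(2 ^ l)) : address l (fun b => [exists k in f h, (k : nat) == b]) = h.
  rewrite -[RHS](@address_bitK l) //; apply: eq_address => b bl.
  apply/existsP/idP => [[k /andP[]]|hb].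
    by rewrite inE => hk /eqP <-.
  by exists (Ordinal bl); rewrite inE /= hb eqxx.
have finj : injective f by move=> h h' e; apply: val_inj; rewrite /= -fE e fE.
have fbij : bijective f.
  by apply: inj_card_bij => //; rewrite card_ord card_set_type card_ord.
rewrite (reindex f) /=; last exact: onW_bij.
by apply: eq_bigr => h _; rewrite fE.
Qed.

Definition pick_bit s l (w : {set 'I_s * 'I_l}) (j b : nat) : bool :=
  [exists t in w, ((t.1 : nat) == j) && ((t.2 : nat) == b)].

Lemma pick_bitE s l (w : {set 'I_s * 'I_l}) (j : 'I_s) (b : 'I_l) :
  pick_bit w j b = ((j, b) \in w).
Proof.
apply/existsP/idP => [[[j' b'] /andP[h /andP[/eqP e /eqP e']]]|h].
  by rewrite (_ : (j, b) = (j', b')) //; congr (_, _); exact: val_inj.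
by exists (j, b); rewrite h !eqxx.
Qed.

Lemma sign_sampled_xor s l x w :
  (-1) ^+ (sampled_xor s l x w) =
  \prod_(j < s) (-1) ^+ (nth false x (address l (w j))) :> R.
Proof.
rewrite /sampled_xor; elim: s => [|s ih]; first by rewrite big_ord0 expr0.
by rewrite big_ord_recr /= signr_addb ih.
Qed.

(** A set of pairs is a family of [s] independent addresses, so the sum of products factors. *)
Lemma sum_samples s l (phi : nat -> R) :
  \sum_(w : {set 'I_s * 'I_l}) \prod_(j < s) phi (address l (pick_bit w j))
  = (\sum_(h < 2 ^ l) phi h) ^+ s.
Proof.
pose f (g : {ffun 'I_s -> {set 'I_l}}) := [set t : 'I_s * 'I_l | t.2 \in g t.1].
have finj : injective f.
  move=> g g' /setP e; apply/ffunP => j; apply/setP => b.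
  by have := e (j, b); rewrite !inE.
have fbij : bijective f.
  apply: inj_card_bij => //.
  by rewrite card_ffun !card_set_type card_prod !card_ord -expnM mulnC.
rewrite (reindex f) /=; last exact: onW_bij.
transitivity (\sum_(g : {ffun 'I_s -> {set 'I_l}}) \prod_(j < s)
   phi (address l (fun b => [exists k in g j, (k : nat) == b]))).
  apply: eq_bigr => g _; apply: eq_bigr => j _; congr phi; apply: eq_address => b bl.
  rewrite (_ : b = Ordinal bl) // pick_bitE inE /=.
  apply/idP/existsP => [h|[k /andP[h /eqP e]]]; first by exists (Ordinal bl); rewrite h /=.
  by rewrite (_ : Ordinal bl = k) //; apply: val_inj.
rewrite -(bigA_distr_bigA (fun (j : 'I_s) (v : {set 'I_l}) =>
   phi (address l (fun b => [exists k in v, (k : nat) == b])))) /=.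
by rewrite (eq_bigr (fun=> \sum_(h < 2 ^ l) phi h)) ?prodr_const ?card_ord // => j _;
  rewrite sum_address.
Qed.

(** Addresses beyond the words read the default [false] in both of them and count as agreements. *)
Lemma sum_signs n l (x x' : n.-tuple bool) : (n <= 2 ^ l)%N ->
  \sum_(h < 2 ^ l) (-1) ^+ (nth false x h) * (-1) ^+ (nth false x' h)
  = (2 ^ l)%:R - 2 * (distance x x')%:R :> R.
Proof.
move=> nl.
have -> : \sum_(h < 2 ^ l) (-1) ^+ (nth false x h) * (-1) ^+ (nth false x' h) =
    \sum_(h < 2 ^ l) (1 - 2 * (nth false x h != nth false x' h)%:R) :> R.
  apply: eq_bigr => h _.
  by case: (nth false x h); case: (nth false x' h); rewrite /= ?expr0 ?expr1; ring.
rewrite sumrB sumr_const card_ord -mulr_sumr; congr (_ - _ * _).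
rewrite -natr_sum; congr (_%:R).
rewrite -(big_mkord xpredT (fun h => nat_of_bool (nth false x h != nth false x' h))).
rewrite (@big_cat_nat _ _ _ n) //= [X in (_ + X)%N]big_nat_cond [X in (_ + X)%N]big1 ?addn0.
  rewrite big_mkord /distance -sum1_card [RHS]big_mkcond /=; apply: eq_bigr => k _.
  by rewrite inE -!tnth_nth; case: (_ != _).
by move=> h /andP[/andP[nh _] _]; rewrite !nth_default ?size_tuple.
Qed.

(** One address has correlation y = 1 - 2 D / 2^l at distance [D], and [n * 2 <= 2 ^ l] makes it
    nonnegative. So y^s is at most 1 for close words and at most exp(-2 D s / 2^l) for far ones; the
    2 yields the square. *)
Lemma far_samples n s l w0 (x x' : n.-tuple bool) : (n * 2 <= 2 ^ l)%N ->
  #|{set 'I_s * 'I_l}|%:R^-1 * \sum_(w : {set 'I_s * 'I_l})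
    (-1) ^+ (sampled_xor s l x (pick_bit w)) * (-1) ^+ (sampled_xor s l x' (pick_bit w))
  <= expR (- (w0%:R * s%:R / (2 ^ l)%:R)) ^+ 2 + (distance x x' <= w0)%:R :> R.
Proof.
move=> nl.
have nl' : (n <= 2 ^ l)%N by lia.
have L0 : 0 < (2 ^ l)%:R :> R by rewrite ltr0n expn_gt0.
under eq_bigr => w _ do rewrite !sign_sampled_xor -big_split /=.
rewrite (sum_samples s l (fun h => (-1) ^+ nth false x h * (-1) ^+ nth false x' h)).
rewrite sum_signs // card_set_type card_prod !card_ord.
have -> : (2 ^ (s * l))%:R^-1 = (2 ^ l)%:R^-1 ^+ s :> R.
  by rewrite exprVn -natrX -expnM mulnC.
rewrite -exprMn mulrBr mulVf ?gt_eqF //.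
set y := _^-1 * _.
have Dn : (distance x x' <= n)%N by rewrite -[leqRHS]card_ord max_card.
have y0 : 0 <= y by rewrite /y !mulr_ge0 // invr_ge0 ltW.
have y1 : y <= 1.
  rewrite /y mulrC ler_pdivrMr // mul1r -natrM ler_nat; lia.
have [_|D] := leqP (distance x x') w0.
  apply: (@le_trans _ _ 1).
    by apply: exprn_ile1; lra.
  by rewrite lerDr sqr_ge0.
rewrite addr0 -expRM_natr.
apply: (@le_trans _ _ (expR (- y) ^+ s)).
  rewrite lerXn2r ?nnegrE ?expR_ge0 //; first lra.
  by have := expR_ge1Dx (- y).
rewrite -expRM_natr ler_expR /y.
have -> : - (w0%:R * s%:R / (2 ^ l)%:R) * 2%:R =
    - ((2 ^ l)%:R^-1 * (2 * w0%:R)) * s%:R :> R by ring.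
rewrite ler_wpM2r // lerN2 ler_wpM2l ?invr_ge0 ?(ltW L0) // ler_wpM2l // ler_nat.
exact: ltnW.
Qed.

End Samples.

(** * The error of the extractor *)

Lemma pair_index_lt s l (j : 'I_s) (b : 'I_l) : (j * l + b < s * l)%N.
Proof. by have := ltn_ord j; have := ltn_ord b; nia. Qed.

Section ExtractorError.
Local Open Scope set_scope.
Local Open Scope ring_scope.
Variables (R : realType) (n d l A : nat).
Let s := (l ^ A)%N.
Let P := modulus (s ^ 2) (s ^ 4).
Hypotheses (nl : (n * 2 <= 2 ^ l)%N)
  (slotd : forall i k, (k < s * l)%N -> (slot (s ^ 2) (s ^ 4) i k < d)%N)
  (prime_P : forall k, (k < s * l)%N -> prime (P k)).

Let index (t : 'I_s * 'I_l) : nat := (t.1 * l + t.2)%N.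

Let index_lt t : (index t < s * l)%N.
Proof. exact: pair_index_lt. Qed.

Let index_inj : injective index.
Proof.
move=> [j b] [j' b']; rewrite /index /= => e.
have l0 : (0 < l)%N by exact: leq_ltn_trans (ltn_ord b).
congr (_, _); apply: val_inj => /=.
  by have := congr1 (divn^~ l) e; rewrite !divnMDl // !divn_small // !addn0.
by have := congr1 (modn^~ l) e; rewrite !modnMDl !modn_small.
Qed.

Definition seed_pos (i : nat) (t : 'I_s * 'I_l) : 'I_d := Ordinal (slotd i (index_lt t)).

Definition shared (i j : nat) : {set 'I_s * 'I_l} := [set t | (P (index t) %| i - j)%N].

Lemma seed_pos_inj i : injective (seed_pos i).
Proof. by move=> t t' /(congr1 val) /slot_inj[/index_inj]. Qed.

Lemma seed_pos_shared i j t : (j < i)%N -> t \in shared i j ->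
  seed_pos j t = seed_pos i t.
Proof.
move=> ji; rewrite inE => h; apply: val_inj; rewrite /= /slot -/P; congr (_ + _)%N.
by apply/esym/eqP; rewrite eqn_mod_dvd // ltnW.
Qed.

Lemma seed_pos_other i j t t' : (j < i)%N -> t \notin shared i j ->
  seed_pos i t' != seed_pos j t.
Proof.
move=> ji; apply: contraNneq => /(congr1 val) /slot_inj[/index_inj <- /eqP].
by rewrite inE eqn_mod_dvd // ltnW.
Qed.

Lemma eq_sampled_xor (x : seq bool) (w w' : nat -> nat -> bool) :
  (forall (j : 'I_s) (b : 'I_l), w j b = w' j b) ->
  sampled_xor s l x w = sampled_xor s l x w'.
Proof.
move=> h; rewrite /sampled_xor.
have : forall j, (j < s)%N -> address l (w j) = address l (w' j).
  move=> j js; apply: eq_address => b bl; exact: (h (Ordinal js) (Ordinal bl)).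
elim: (s) => //= k ih e; rewrite ih => [|j jk]; last by apply: e; exact: ltnW.
by rewrite e.
Qed.

Lemma ext_bit_put (x : seq bool) i u (w : {set 'I_s * 'I_l}) :
  ext_bit A l x (put (seed_pos i) u w) i = sampled_xor s l x (pick_bit w).
Proof.
apply: eq_sampled_xor => j b; rewrite pick_bitE.
by rewrite -(tnth_put (@seed_pos_inj i) u) (tnth_nth false).
Qed.

(** Positions read by the earlier bit [j] and not shared with bit [i] are not overwritten, so only
    the shared part of [w] matters. *)
Lemma ext_bit_put_shared (x : seq bool) i j u (w : {set 'I_s * 'I_l}) : (j < i)%N ->
  ext_bit A l x (put (seed_pos i) u w) j =
  ext_bit A l x (put (seed_pos i) u (w :&: shared i j)) j.
Proof.
move=> ji; apply: eq_sampled_xor => a b.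
have E w' : nth false (put (seed_pos i) u w') (slot (s ^ 2) (s ^ 4) j (a * l + b)) =
    tnth (put (seed_pos i) u w') (seed_pos j (a, b)) by rewrite (tnth_nth false).
rewrite -/s !E; have [h|h] := boolP ((a, b) \in shared i j).
  by rewrite (seed_pos_shared ji h) !(tnth_put (@seed_pos_inj i)) finset.in_setI h andbT.
by rewrite !tnth_put_out // => t; exact: seed_pos_other.
Qed.

(** An entry [(j, r)] asks for output bit [j] when its shared positions hold [r]. A table of answers
    is a subset of [tables i], so it leaks as many bits about the word as there are entries. *)
Let tables i : {set 'I_i * {set 'I_s * 'I_l}} :=
  [set jr : 'I_i * {set 'I_s * 'I_l} | jr.2 \subset shared i jr.1].

Lemma card_tables i : #|tables i| = (\sum_(j < i) 2 ^ #|shared i j|)%N.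
Proof.
under [RHS]eq_bigr => j _ do rewrite -card_powerset -sum1_card.
rewrite pair_big_dep /= -sum1_card; apply: eq_bigl => -[j r].
by rewrite !inE.
Qed.

Variables (p : n.-tuple bool -> R) (kap nu : R) (w0 : nat).
Hypotheses (p_ge0 : forall x, 0 <= p x) (p_sum1 : \sum_x p x = 1)
  (p_le : forall x, p x <= kap) (kap0 : 0 < kap) (nu0 : 0 < nu).

Let lam : R := expR (- (w0%:R * s%:R / (2 ^ l)%:R)).

Lemma bit_error i :
  2^-1 ^+ d * \sum_(u : d.-tuple bool) \sum_(z : i.-tuple bool)
    `|\sum_(x : n.-tuple bool | mkseq (ext_bit A l x u) i == z) p x * (-1) ^+ (ext_bit A l x u i)|
  <= lam + nu + (2 ^ (\sum_(j < i) 2 ^ #|shared i j|))%:R *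
                (kap * (n.+1 ^ w0)%:R / nu).
Proof.
set bound := leRHS.
pose G (u : d.-tuple bool) : R := \sum_(z : i.-tuple bool)
    `|\sum_(x : n.-tuple bool | mkseq (ext_bit A l x u) i == z) p x * (-1) ^+ (ext_bit A l x u i)|.
have W0 : (0 < #|{set 'I_s * 'I_l}|)%N by rewrite card_set_type expn_gt0.
have step u : #|{set 'I_s * 'I_l}|%:R^-1 *
    \sum_(w : {set 'I_s * 'I_l}) G (put (seed_pos i) u w) <= bound.
  (* With the rest [u] of the seed fixed, the earlier bits depend on the source word only through
     this table. *)
  pose tab (x : n.-tuple bool) : {set 'I_i * {set 'I_s * 'I_l}} :=
    [set jr in tables i | ext_bit A l x (put (seed_pos i) u jr.2) jr.1].
  pose h (T : {set 'I_i * {set 'I_s * 'I_l}}) (w : {set 'I_s * 'I_l}) : i.-tuple bool :=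
    [tuple (j, w :&: shared i j) \in T | j < i].
  have hE (x : n.-tuple bool) w : h (tab x) w = mkseq (ext_bit A l x (put (seed_pos i) u w)) i :> seq bool.
    rewrite /mkseq -val_enum_ord -map_comp /=; apply: eq_map => j /=.
    rewrite !inE /= subsetIr /=.
    by rewrite -ext_bit_put_shared.
  have GE w : G (put (seed_pos i) u w) = \sum_(z : i.-tuple bool)
      `|\sum_(x : n.-tuple bool | h (tab x) w == z) p x * (-1) ^+ (sampled_xor s l x (pick_bit w))|.
    apply: eq_bigr => z _; congr `|_|; apply: eq_big => x.
      by rewrite -val_eqE /= -hE.
    by rewrite ext_bit_put.
  under eq_bigr => w _ do rewrite GE.
  have tabK x : tab x \in powerset (tables i).
    by rewrite inE; apply/fintype.subsetP => jr; rewrite inE => /andP[].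
  have M0 : 0 < (n.+1 ^ w0)%:R :> R by rewrite ltr0n expn_gt0.
  have := @one_bit_bias R _ _ _ _ p (fun x w => sampled_xor s l (tval x) (pick_bit w)) tab
    (powerset (tables i)) h (fun x x' => distance x x' <= w0)%N kap lam nu _
    p_ge0 p_sum1 p_le tabK kap0 (expR_ge0 _) nu0 M0 W0 (fun x x' => far_samples R s w0 x x' nl)
    (fun x => card_ball R x w0).
  by rewrite card_powerset card_tables.
(* The bound holds for every fixed [u] on average over [w]; resampling turns it into the average
   over seeds. *)
have := resample (@seed_pos_inj i) G.
have two0 : 0 < 2 ^+ #|{: 'I_s * 'I_l}| :> R by rewrite exprn_gt0.
move=> /(canRL (mulKf (lt0r_neq0 two0))) ->.
rewrite mulr_sumr mulr_sumr.
apply: (@le_trans _ _ (\sum_(u : d.-tuple bool) 2^-1 ^+ d * bound)).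
  apply: ler_sum => u _; rewrite ler_wpM2l ?exprn_ge0 ?invr_ge0 //.
  by apply: le_trans (step u); rewrite card_set_type natrX.
rewrite sumr_const card_tuple card_bool -mulrnAl -[2^-1 ^+ d *+ _]mulr_natr natrX -exprMn.
by rewrite mulVf ?pnatr_eq0 // expr1n mul1r.
Qed.

Theorem extractor_error m a (Ext : n.-tuple bool -> d.-tuple bool -> m.-tuple bool) :
  (forall x u, Ext x u = mkseq (ext_bit A l x u) m :> seq bool) ->
  (forall i, (i < m)%N -> (\sum_(j < i) 2 ^ #|shared i j| <= a)%N) ->
  stat_dist
    (image_distr (fun xu : n.-tuple bool * d.-tuple bool =>
          [tuple of xu.2 ++ Ext xu.1 xu.2])
       (indep_pair p (uniform R (d.-tuple bool))))
    (uniform R ((d + m).-tuple bool)) <=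
  m%:R * (lam + nu + (2 ^ a)%:R * (kap * (n.+1 ^ w0)%:R / nu)).
Proof.
move=> ExtE ha.
apply: le_trans (stat_dist_hybrid (b := fun x u => ext_bit A l x u) p_sum1 ExtE) _.
apply: (@le_trans _ _ (\sum_(i < m) (lam + nu + (2 ^ a)%:R * (kap * (n.+1 ^ w0)%:R / nu)))).
  apply: ler_sum => i _; apply: le_trans (bit_error i) _.
  rewrite lerD2l ler_wpM2r ?ler_nat ?leq_exp2l ?ha //.
  by rewrite divr_ge0 ?mulr_ge0 ?ltW.
by rewrite sumr_const card_ord -[leLHS]mulr_natl.
Qed.

Theorem overlap_bound i : (0 < s)%N ->
  (\sum_(j < i) 2 ^ #|shared i j|)%:R <= i%:R * (1 + (s ^ 2)%:R^-1) ^+ (s * l) :> R.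
Proof.
move=> s0.
have := @design_overlap R _ (fun t => P (index t)) (s ^ 2) i.
rewrite expn_gt0 s0 => /(_ isT) H.
rewrite card_prod !card_ord in H; apply: H => [t|t t' tt'].
  exact: ltnW (modulus_gt _ _ _).
rewrite prime_coprime ?prime_P // dvdn_prime2 ?prime_P //.
apply: contra_neq tt' => e; apply: index_inj.
by have [h|h|//] := ltngtP (index t) (index t');
  have := @modulus_lt (s ^ 2) (s ^ 4) _ _ h; rewrite -/P e ltnn.
Qed.

End ExtractorError.

(** * Asymptotics *)

Section Growth.
Local Open Scope nat_scope.

(** For q = floor(l / (D + 1)), 2^l contains D + 1 factors 2^q: one absorbs the constant, and each
    of the others is at least l / (D + 1). *)
Lemma exp2_dominates K D : exists l0, forall l, l0 <= l -> K * l ^ D <= 2 ^ l.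
Proof.
pose c := K * D.+1 ^ D; exists (D.+1 * c) => l hl.
pose q := l %/ D.+1.
have lq : l <= D.+1 * 2 ^ q.
  apply: (@leq_trans (D.+1 * q.+1)); last by rewrite leq_mul2l ltn_expl.
  by rewrite mulnC ltnW // ltn_ceil.
have cq : c <= 2 ^ q.
  apply: leq_trans (ltnW (ltn_expl q (ltnSn 1))).
  by rewrite leq_divRL // mulnC.
apply: (@leq_trans (K * (D.+1 * 2 ^ q) ^ D)).
  by rewrite leq_mul2l expn_mono ?orbT.
rewrite expnMn mulnA -/c -expnM; apply: (@leq_trans (2 ^ q * 2 ^ (q * D))).
  by rewrite leq_mul2r cq orbT.
by rewrite -expnD leq_exp2l // -mulnS leq_trunc_div.
Qed.

(* [2 ^ seed_log n] exceeds [2 * n], so that no two words of length [n] differ in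
   more than half of the addressed positions *)
Definition seed_log (n : nat) : nat := trunc_log 2 n + 2.

Lemma seed_log_bounds n : 0 < n -> n * 2 < 2 ^ seed_log n <= 4 * n.
Proof.
move=> n0; have /andP[h1 h2] := @trunc_log_bounds 2 n isT n0.
rewrite /seed_log addn2 !expnS in h1 h2 *; lia.
Qed.

Lemma seed_log_ge K n : 2 ^ K <= n -> K <= seed_log n.
Proof.
by move=> h; apply: leq_trans (leq_addr _ _); exact: trunc_log_max.
Qed.

Lemma near_seed_log K : \forall n \near \oo, K <= seed_log n.
Proof. by exists (2 ^ K) => // n /=; exact: seed_log_ge. Qed.

Lemma near_growth K D : \forall n \near \oo, K * seed_log n ^ D <= n.
Proof.
have [l0 h] := exp2_dominates (4 * K) D.
exists (2 ^ l0) => // n /= hn.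
have n0 : 0 < n by apply: leq_trans hn; rewrite expn_gt0.
have := h _ (seed_log_ge hn); have /andP[_] := seed_log_bounds n0.
by rewrite -mulnA; lia.
Qed.

End Growth.

(** * Real estimates for the error and the overlaps *)

Section RealBounds.
Variable R : realType.

Lemma Theta_bounds (f g : nat -> R) :
  (f : nat -> R^o) =Theta_\oo (g : nat -> R^o) ->
  exists k1 k2 : R, [/\ 0 < k1, 0 < k2 &
    \forall n \near \oo, k1 * `|g n| <= `|f n| <= k2 * `|g n|].
Proof.
move=> E.
(* The Theta relation is an equation between [f] and a function that lies in the class by
   construction; the bounds are transported along [E]. *)
have := bigThetaP [bigTheta of the_bigTheta the_tag (Phantom (set_system nat) \oo)
  (f : nat -> R^o) (g : nat -> R^o)].
rewrite /= -E => -[[k1 k2] /= /andP[k10 k20] h].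
exists k1, k2; split=> //; apply: filterS h => n [h1 h2].
by rewrite h1.
Qed.

Lemma ln2_gt0 : 0 < ln 2 :> R.
Proof. by rewrite ln_gt0 // ltr1n. Qed.

Lemma ln2_le1 : ln 2 <= 1 :> R.
Proof. by rewrite (_ : 2 = 1 + 1) //; apply: le_ln1Dx; lra. Qed.

Lemma powR2E (x : R) : 2 `^ x = expR (x * ln 2).
Proof. by rewrite /powR pnatr_eq0. Qed.

Lemma powR2D (x y : R) : 2 `^ (x + y) = 2 `^ x * 2 `^ y.
Proof. by rewrite !powR2E mulrDl expRD. Qed.

Lemma powR2N (x : R) : 2 `^ (- x) = (2 `^ x)^-1.
Proof. by rewrite !powR2E mulNr expRN. Qed.

Lemma powR2_nat n : 2 `^ n%:R = (2 ^ n)%:R :> R.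
Proof. by rewrite powR_mulrn // natrX. Qed.

Lemma ler_powR2 (x y : R) : x <= y -> 2 `^ x <= 2 `^ y.
Proof. by move=> h; rewrite ler_powR // ler1n. Qed.

Lemma powR2_gt0 (x : R) : 0 < 2 `^ x. Proof. by rewrite powR_gt0. Qed.

(** The entropy deficit gamma k is shared out: half of it stays unleaked, so [e] is (1 - gamma/2) k,
    an eighth pays for the Hamming ball, which fixes [w0] as a ball has at most 2^(l w0) points, and
    an eighth pays for dividing by [nu]. *)
Lemma error_parameters (n l a c m : nat) (k g gam ck Cg : R)
    (w0 := Num.truncn (gam * k / (8 * l%:R))) (e := Num.truncn ((1 - gam / 2) * k))
    (nu := 2 `^ (- (gam * k / 8))) :
  0 < gam < 1 -> (0 < l)%N -> (0 < a)%N -> 0 < ck -> 0 <= Cg ->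
  (2 ^ l <= 4 * n)%N -> (n.+1 <= 2 ^ l)%N -> (m <= n ^ 2)%N ->
  ck * n%:R <= k * l%:R ^+ c -> g <= Cg * l%:R ^+ a ->
  8 * (Cg + 4) * l%:R ^+ (a + c) <= gam * ck * n%:R ->
  64 * (Cg + 4) <= gam * ck * l%:R ->
  16 * l%:R * l%:R ^+ c <= gam * ck * n%:R ->
  m%:R * (expR (- (w0%:R * (l ^ (a + c + 2))%:R / (2 ^ l)%:R)) + nu +
    (2 ^ e)%:R * (2 `^ (- k) * (n.+1 ^ w0)%:R / nu)) <= 2 `^ (- g).
Proof.
move=> /andP[gam0 gam1] l0 a0 ck0 Cg0 l4n nl mn hk hg G1 G2 G3.
pose L : R := l%:R; rewrite -/L in hk hg G1 G2 G3.
have L1 : 1 <= L by rewrite ler1n.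
have L0 : 0 < L by lra.
have Lc0 j : 0 < L ^+ j by rewrite exprn_gt0.
have n0 : 0 < n%:R :> R.
  by rewrite ltr0n -(ltn_pmul2l (isT : 0 < 4)%N) muln0 (leq_trans _ l4n) ?expn_gt0.
have gk : gam * ck * n%:R <= gam * k * L ^+ c by rewrite -!mulrA ler_pM2l.
have k0 : 0 <= k.
  rewrite -(pmulr_lge0 _ (Lc0 c)); apply: le_trans hk; rewrite mulr_ge0 ?ltW //.
(* The 4 added to [Cg] makes room for the factor 3 m, which is at most 2^(2 L + 2). *)
pose E := (Cg + 4) * L ^+ a.
have La : L <= L ^+ a by rewrite -{1}(expr1 L) ler_weXn2l.
have E1 : g + 2 * L + 2 <= E.
  have : 4 * L <= 4 * L ^+ a by rewrite ler_pM2l.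
  rewrite /E mulrDl; lra.
have kE : E <= gam * k / 8.
  rewrite ler_pdivlMr // -(ler_pM2r (Lc0 c)); apply: le_trans gk; apply: le_trans G1.
  by rewrite /E exprD le_eqVlt; apply/orP; left; apply/eqP; ring.
(* Truncation costs at most a factor 2, since [G3] makes the halved quotient at least 1. *)
have w0_ge : gam * k / (16 * L) <= w0%:R.
  have h1 : 1 <= gam * k / (16 * L).
    rewrite ler_pdivlMr ?mulr_gt0 // mul1r -(ler_pM2r (Lc0 c)).
    exact: le_trans gk.
  have := truncnS_gt (gam * k / (8 * L)); rewrite -/w0 -(natr1 w0).
  have -> : gam * k / (8 * L) = 2 * (gam * k / (16 * L)) by field; rewrite gt_eqF.
  lra.
(* The exponent is at least gamma ck L^(a+1) / 64, where 64 combines the 16 of [w0_ge] with 2^l <= 4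
   n. Of the two extra factors of [L] in [s], one is lost in [w0] and the other beats the constants
   through [G2]. *)
have T1 : expR (- (w0%:R * (l ^ (a + c + 2))%:R / (2 ^ l)%:R)) <= 2 `^ (- E).
  rewrite powR2E ler_expR mulNr lerN2.
  have E0 : 0 <= E by rewrite /E mulr_ge0 // ?ltW //; lra.
  apply: (@le_trans _ _ E); first by rewrite ler_piMr // ln2_le1.
  rewrite ler_pdivlMr; last by rewrite ltr0n expn_gt0.
  apply: (@le_trans _ _ (E * (4 * n%:R))).
    apply: ler_wpM2l => //; have <- : (4 * n)%:R = 4 * n%:R :> R by rewrite natrM.
    by rewrite ler_nat.
  apply: (@le_trans _ _ (gam * k / (16 * L) * L ^+ (a + c + 2))); last first.
    by rewrite natrX -/L ler_wpM2r // ltW.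
  have -> : gam * k / (16 * L) * L ^+ (a + c + 2) = (gam * k * L ^+ c) * (L * L ^+ a / 16).
    by rewrite !exprD expr2; field; rewrite gt_eqF.
  apply: (@le_trans _ _ ((gam * ck * n%:R) * (L * L ^+ a / 16))).
    have -> : (gam * ck * n%:R) * (L * L ^+ a / 16) =
      (gam * ck * L) * (n%:R * L ^+ a / 16) by ring.
    apply: (@le_trans _ _ ((64 * (Cg + 4)) * (n%:R * L ^+ a / 16))).
      by rewrite /E le_eqVlt; apply/orP; left; apply/eqP; field.
    by rewrite ler_wpM2r // !mulr_ge0 // ltW.
  by rewrite ler_wpM2r // !mulr_ge0 // ltW.
have T2 : nu <= 2 `^ (- E) by rewrite ler_powR2 // lerN2.
(* The exponents add up to -gamma k / 4, and [nu] is only 2^(-gamma k / 8). *)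
have T3 : (2 ^ e)%:R * (2 `^ (- k) * (n.+1 ^ w0)%:R / nu) <= nu.
  have h1 : (2 ^ e)%:R <= 2 `^ ((1 - gam / 2) * k) :> R.
    rewrite -powR2_nat ler_powR2 // truncn_le mulr_ge0 //; lra.
  have h2 : (n.+1 ^ w0)%:R <= 2 `^ (gam * k / 8) :> R.
    apply: (@le_trans _ _ (2 ^ (l * w0))%:R).
      by rewrite ler_nat expnM expn_mono.
    rewrite -powR2_nat ler_powR2 // natrM -/L.
    have : w0%:R <= gam * k / (8 * L).
      rewrite truncn_le divr_ge0 ?mulr_ge0 // ltW //.
    rewrite ler_pdivlMr ?mulr_gt0 // ler_pdivlMr // => h.
    by apply: le_trans h; rewrite le_eqVlt; apply/orP; left; apply/eqP; ring.
  have nuV : nu^-1 = 2 `^ (gam * k / 8) by rewrite /nu powR2N invrK.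
  rewrite nuV.
  apply: (@le_trans _ _ (2 `^ ((1 - gam / 2) * k) * (2 `^ (- k) *
     2 `^ (gam * k / 8) * 2 `^ (gam * k / 8)))).
    by apply: ler_pM => //; rewrite ler_wpM2r ?powR_ge0 // ler_wpM2l ?powR_ge0.
  rewrite -!powR2D ler_powR2 //.
  have : 0 <= gam * k by rewrite mulr_ge0 // ltW.
  lra.
apply: (@le_trans _ _ (m%:R * (3 * 2 `^ (- E)))).
  by rewrite ler_wpM2l //; lra.
have m4 : m%:R * 3 <= 2 `^ (2 * L + 2).
  have -> : 2 * L + 2 = (2 * l + 2)%:R :> R by rewrite natrD natrM.
  have h : (m <= (2 ^ l) ^ 2)%N by exact: leq_trans mn (expn_mono 2 (ltnW nl)).
  have -> : m%:R * 3 = (m * 3)%:R :> R by rewrite natrM.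
  by rewrite powR2_nat ler_nat expnD (mulnC 2) expnM (leq_mul h).
rewrite mulrA; apply: (@le_trans _ _ (2 `^ (2 * L + 2) * 2 `^ (- E))).
  by rewrite ler_wpM2r ?powR_ge0.
by rewrite -powR2D ler_powR2 //; lra.
Qed.

(** The factor is at most exp(l / s) <= exp(1 / l) <= 1 / (1 - 1/l), and passing from 1 - gamma to 1
    - gamma/2 affords it as soon as 2 / l <= gamma. *)
Lemma overlap_parameters (i m l s : nat) (k gam : R) :
  0 < gam < 1 -> 0 <= k -> (i <= m)%N -> m%:R <= (1 - gam) * k ->
  (1 < l)%N -> 2 <= gam * l%:R -> (l ^ 2 <= s)%N ->
  i%:R * (1 + (s ^ 2)%:R^-1) ^+ (s * l) <= (1 - gam / 2) * k.
Proof.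
move=> /andP[gam0 gam1] k0 im mk l1 gl ls.
pose L : R := l%:R.
have L1 : 1 < L by rewrite ltr1n.
have L0 : 0 < L by lra.
have s0 : 0 < s%:R :> R.
  by rewrite ltr0n; apply: leq_trans ls; rewrite expn_gt0; lia.
have h1 : (1 + (s ^ 2)%:R^-1) ^+ (s * l) <= expR (L^-1) :> R.
  apply: (@le_trans _ _ (expR ((s ^ 2)%:R^-1) ^+ (s * l))).
    by rewrite lerXn2r ?nnegrE ?expR_ge0 ?expR_ge1Dx // addr_ge0 // invr_ge0.
  rewrite -expRM_natr ler_expR natrM natrX -/L.
  have -> : (s%:R ^+ 2)^-1 * (s%:R * L) = L / s%:R :> R.
    by field; rewrite gt_eqF.
  rewrite ler_pdivrMr // ler_pdivlMl // -expr2 -natrX ler_nat //.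
have h2 : expR (L^-1) * (1 - L^-1) <= 1.
  have := expR_ge1Dx (- L^-1).
  rewrite -(ler_pM2l (expR_gt0 (L^-1))) expRxMexpNx_1; exact.
have iL : 0 < L^-1 by rewrite invr_gt0.
have h3 : (1 - gam) <= (1 - gam / 2) * (1 - L^-1).
  have : 2 * L^-1 <= gam by rewrite ler_pdivrMr.
  nra.
have L2 : 0 < 1 - L^-1 by rewrite subr_gt0 invf_lt1.
apply: (@le_trans _ _ (((1 - gam) * k) * expR (L^-1))).
  by apply: ler_pM => //; apply: le_trans mk; rewrite ler_nat.
apply: (@le_trans _ _ (((1 - gam / 2) * (1 - L^-1) * k) * expR (L^-1))).
  by rewrite ler_wpM2r ?expR_ge0 // ler_wpM2r.
have -> : (1 - gam / 2) * (1 - L^-1) * k * expR (L^-1) =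
  ((1 - gam / 2) * k) * (expR (L^-1) * (1 - L^-1)) by ring.
rewrite ler_piMr // mulr_ge0 //; lra.
Qed.

Lemma source_le n (k : R) (p : n.-tuple bool -> R) x :
  is_source k p -> p x <= 2 `^ (- k).
Proof.
move=> [[p0 p1] hk]; move: hk; rewrite /min_entropy.
set M := \big[Num.max/0]_x p x => hk.
have pM y : p y <= M by exact: (le_bigmax_cond _ (fun x => p x)).
have M0 : 0 < M.
  rewrite lt_neqAle (le_trans (p0 x) (pM x)) andbT eq_sym.
  apply/eqP => M0; move: p1; rewrite big1 => [/eqP|y _]; first by rewrite eq_sym oner_eq0.
  by apply/eqP; rewrite eq_le p0 -M0 pM.
apply: le_trans (pM x) _; rewrite powR2E -[leLHS]lnK ?posrE // ler_expR.
move: hk; rewrite /log2 lerNr ler_pdivrMr ?ln2_gt0 //.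
Qed.

Lemma log2_bounds n : (0 < n)%N ->
  log2 (n%:R : R) <= (seed_log n)%:R <= log2 (n%:R : R) + 2.
Proof.
move=> n0; have /andP[h1 h2] := seed_log_bounds n0.
have n0' : 0 < n%:R :> R by rewrite ltr0n.
have e j : ln ((2 ^ j)%:R : R) = j%:R * ln 2 by rewrite natrX lnXn // mulr_natl.
rewrite /log2; apply/andP; split.
  rewrite ler_pdivrMr ?ln2_gt0 // -e ler_ln ?posrE ?ltr0n ?expn_gt0 // ler_nat; lia.
rewrite -(ler_pM2r ln2_gt0) mulrDl divfK ?gt_eqF ?ln2_gt0 // -e -(e 2%N) -lnM ?posrE //.
by rewrite ler_ln ?posrE ?mulr_gt0 ?ltr0n ?expn_gt0 // -natrM ler_nat mulnC.
Qed.

End RealBounds.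

(** * Eventual inequalities, seed length and circuit size *)

Section Thresholds.
Variable R : realType.

Lemma truncnS_mul_le (y : R) (q n : nat) : ((Num.truncn y).+1 * q <= n)%N ->
  y * q%:R <= n%:R.
Proof.
move=> h; apply: (@le_trans _ _ (((Num.truncn y).+1 * q)%N)%:R); last by rewrite ler_nat.
by rewrite natrM ler_wpM2r // ltW // truncnS_gt.
Qed.

Lemma near_growth_real (y : R) D :
  \forall n \near \oo, y * (seed_log n)%:R ^+ D <= n%:R.
Proof.
apply: filterS (near_growth (Num.truncn y).+1 D) => n /truncnS_mul_le.
by rewrite natrX.
Qed.

Lemma near_seed_log_real (y : R) : \forall n \near \oo, y <= (seed_log n)%:R.
Proof.
apply: filterS (near_seed_log (Num.truncn y).+1) => n.
by rewrite -[X in (X <= _)%N]muln1 => /truncnS_mul_le; rewrite mulr1.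
Qed.

Lemma near_log2_ge (y : R) : \forall n \near \oo, y <= log2 (n%:R : R).
Proof.
near=> n.
have n0 : (0 < n)%N by near: n; exists 1%N.
have /andP[_ h] := log2_bounds R n0.
have : y + 2 <= (seed_log n)%:R by near: n; exact: near_seed_log_real.
by lra.
Unshelve. all: by end_near. Qed.

(** Rounding the logarithm costs a squaring, as L + 2 <= L^2 for L >= 2; hence the 2 in
    [2 * E <= 100 * r]. *)
Lemma seed_length_bounds (L : R) (l r E : nat) :
  2 <= L -> L <= l%:R <= L + 2 -> (r <= E)%N -> (2 * E <= 100 * r)%N ->
  L ^+ r <= l%:R ^+ E <= L ^+ (100 * r).
Proof.
move=> L2 /andP[Ll lL] rE Er.
have L1 : 1 <= L by lra.
have L0 : 0 <= L by lra.
apply/andP; split.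
  apply: (@le_trans _ _ (L ^+ E)); first by rewrite ler_weXn2l.
  by rewrite lerXn2r ?nnegrE.
apply: (@le_trans _ _ ((L ^+ 2) ^+ E)); last by rewrite -exprM ler_weXn2l.
rewrite lerXn2r ?nnegrE ?exprn_ge0 //; apply: le_trans lL _.
by rewrite expr2; nra.
Qed.

Lemma circuit_size_bound n l A m r :
  (100 <= n -> l <= n -> 2 ^ l <= 4 * n -> m <= n ^ 2 -> r <= n ->
  m * ((2 ^ l * (3 * l + 2 * l + 2) + 1) ^ A *
    (n * (l.+1 * 2 + l.+1 + 1) + n + 1) + 4 * r) <= n ^ (4 * A + 8))%N.
Proof.
move=> n100 ln l4 mn rn.
have e1 : (2 ^ l * (3 * l + 2 * l + 2) + 1 <= n ^ 4)%N.
  apply: (@leq_trans (n ^ 2 * n ^ 2)%N); last by rewrite -expnD.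
  apply: (@leq_trans (4 * n * (7 * n) + 1)%N).
    by rewrite leq_add2r leq_mul //; lia.
  rewrite -mulnn; nia.
have e2 : (n * (l.+1 * 2 + l.+1 + 1) + n + 1 <= n ^ 3)%N.
  apply: (@leq_trans (n * (10 * n))%N); first by nia.
  by rewrite (expnS n 2) -mulnn leq_mul2l leq_mul2r; lia.
have e3 := leq_mul (expn_mono A e1) e2.
rewrite -expnM in e3.
have e4 : (4 * r <= n ^ (4 * A) * n ^ 3)%N.
  apply: (@leq_trans (1 * (4 * n))%N); first lia.
  apply: leq_mul; first by rewrite expn_gt0; lia.
  by rewrite expnSr leq_mul2r -mulnn; nia.
apply: (@leq_trans (n ^ 2 * (2 * (n ^ (4 * A) * n ^ 3)))%N).
  by apply: leq_mul => //; lia.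
apply: (@leq_trans (n ^ 2 * (n ^ 1 * (n ^ (4 * A) * n ^ 3)))%N).
  by rewrite leq_mul2l leq_mul2r expn1; lia.
by rewrite -!expnD leq_exp2l; lia.
Qed.

Lemma val_mktuple_nat m (f : nat -> bool) :
  [tuple f i | i < m] = mkseq f m :> seq bool.
Proof. by rewrite /= /mkseq -val_enum_ord -map_comp. Qed.

End Thresholds.

Theorem mainTheorem9 (R : realType) :
  exists C1 C2 : R, 0 < C1 /\ 0 < C2 /\
  forall (a c : nat) (a_gt0 : (0 < a)%N)
    (delta k : nat -> R)
    (delta_ge0 : forall n : nat, 0 <= delta n)
    (kE : forall n : nat, k n = delta n * n%:R)
    (k_Theta : (k : nat -> R^o) =Theta_\oo
       (fun n : nat => n%:R / log2 (n%:R : R) ^+ c : R^o))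
    (g eps : nat -> R)
    (g_ge0 : forall n : nat, 0 <= g n)
    (g_Theta : (g : nat -> R^o) =Theta_\oo
       (fun n : nat => log2 (n%:R : R) ^+ a : R^o))
    (epsE : forall n : nat, eps n = 1 / 2 `^ g n)
    (gamma : R) (gamma_in01 : 0 < gamma < 1)
    (m : nat -> nat)
    (mE : forall n : nat, m n = Num.truncn ((1 - gamma) * k n)),
  exists (d : nat -> nat)
    (Ext : forall n : nat,
       n.-tuple bool -> (d n).-tuple bool -> (m n).-tuple bool),
    [/\ \forall n \near \oo, strong_extractor (k n) (eps n) (Ext n),
        explicit Ext,
        in_AC0_of_depth (C1 * (a + c)%:R) (C2 * (a + c)%:R) Ext
      & \forall n \near \oo,
          log2 (n%:R : R) `^ (C1 * (a + c)%:R) <= (d n)%:R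
            <= log2 (n%:R : R) `^ (C2 * (a + c)%:R)].
Proof.
(* As a + c >= 1, [A = a + c + 2] is at most 3 (a + c). The seed exponent 14 A is then at most 42 (a
   + c), doubled to 84 (a + c) by rounding, and the depth 3 + 3 A + 2 (a + c) is at most 14 (a +
   c). *)
exists 1, 100; split=> //; split=> //.
move=> a c a_gt0 delta k delta_ge0 kE k_Theta g eps g_ge0 g_Theta epsE gamma
  gamma_in01 m mE.
have [ck [Ck [ck0 Ck0 hk]]] := Theta_bounds k_Theta.
have [cg [Cg [cg0 Cg0 hg]]] := Theta_bounds g_Theta.
have /andP[gam0 gam1] := gamma_in01.
have gck : 0 < gamma * ck by rewrite mulr_gt0.
pose A := (a + c + 2)%N.
pose l := seed_log.
pose s n := (l n ^ A)%N.
pose d n := (s n ^ 14)%N.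
pose Ext n (x : n.-tuple bool) (u : (d n).-tuple bool) : (m n).-tuple bool :=
  [tuple ext_bit A (l n) x u i | i < m n].
have ExtE n (x : n.-tuple bool) (u : (d n).-tuple bool) :
    Ext n x u = mkseq (ext_bit A (l n) x u) (m n) :> seq bool.
  exact: val_mktuple_nat.
have dE n : d n = (l n ^ (A * 14))%N by rewrite expnM.
have k0 n : 0 <= k n by rewrite kE mulr_ge0.
have nlarge (N : nat) : \forall n \near \oo, (N <= n)%N by exists N.
have l18 : \forall n \near \oo, (18 <= l n)%N by exact: near_seed_log.
have ls n : (18 <= l n)%N -> (l n ^ 2 <= s n)%N /\ (18 <= s n)%N.
  move=> h; rewrite /s /A addn2.
  have h2 : (l n ^ 2 <= l n ^ (a + c).+2)%N by rewrite leq_pexp2l //; lia.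
  by split=> //; apply: leq_trans h2; rewrite -mulnn; nia.
have slotd n : (18 <= l n)%N -> forall i q, (q < l n ^ A * l n)%N ->
    (slot ((l n ^ A) ^ 2) ((l n ^ A) ^ 4) i q < d n)%N.
  move=> h i q hq; have [h1 h2] := ls n h.
  apply: (@slot_lt _ (l n)) => //; first exact: ltnW (ltnW (leq_trans _ h2)).
  by apply: leq_trans h1; rewrite -mulnn leq_pmulr //; lia.
have m_le n : (m n)%:R <= (1 - gamma) * k n.
  by rewrite mE truncn_le mulr_ge0 //; lra.
have klow : \forall n \near \oo, ck * n%:R <= k n * (l n)%:R ^+ c.
  near=> n.
  have n0 : (0 < n)%N by near: n; exact: nlarge.
  have L1 : 1 <= log2 (n%:R : R) by near: n; exact: near_log2_ge.
  have /andP[Ll _] := log2_bounds R n0.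
  have : ck * `|n%:R / log2 (n%:R : R) ^+ c| <= `|k n| <= Ck * `|n%:R / log2 (n%:R : R) ^+ c|.
    by near: n; exact: hk.
  have Lc : 0 < log2 (n%:R : R) ^+ c by rewrite exprn_gt0 //; lra.
  move=> /andP[+ _]; rewrite (ger0_norm (k0 n)) ger0_norm; last by rewrite divr_ge0 // ltW.
  rewrite mulrA ler_pdivrMr // => h; apply: le_trans h _.
  by rewrite ler_wpM2l // lerXn2r ?nnegrE //; lra.
have kup : \forall n \near \oo, k n <= Ck * n%:R.
  near=> n.
  have L1 : 1 <= log2 (n%:R : R) by near: n; exact: near_log2_ge.
  have : ck * `|n%:R / log2 (n%:R : R) ^+ c| <= `|k n| <= Ck * `|n%:R / log2 (n%:R : R) ^+ c|.
    by near: n; exact: hk.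
  have Lc : 1 <= log2 (n%:R : R) ^+ c by rewrite exprn_ege1.
  have Lc0 : 0 < log2 (n%:R : R) ^+ c by lra.
  move=> /andP[_]; rewrite (ger0_norm (k0 n)) ger0_norm; last by rewrite divr_ge0 // ltW.
  move=> h; apply: le_trans h _; rewrite ler_pM2l // ler_pdivrMr //.
  by rewrite ler_peMr.
have m_n2 : \forall n \near \oo, (m n <= n ^ 2)%N.
  near=> n.
  have h1 : k n <= Ck * n%:R by near: n; exact: kup.
  have h2 : Ck <= n%:R.
    have : ((Num.truncn Ck).+1 <= n)%N by near: n; exact: nlarge.
    by rewrite -(ler_nat R); apply: le_trans; rewrite ltW // truncnS_gt.
  rewrite -(ler_nat R) -mulnn natrM.
  apply: le_trans (m_le n) _; apply: (@le_trans _ _ (k n)).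
    by rewrite ler_piMl //; lra.
  by apply: le_trans h1 _; rewrite ler_wpM2r.
have d_n : \forall n \near \oo, (d n <= n)%N.
  by apply: filterS (near_growth 1 (A * 14)) => n; rewrite mul1n -dE.
have m_gt0 : \forall n \near \oo, (0 < m n)%N.
  near=> n.
  rewrite mE truncn_gt0.
  have l0 : (0 < l n)%N.
    by apply: (@leq_trans 18) => //; near: n; exact: l18.
  have h1 : ck * n%:R <= k n * (l n)%:R ^+ c by near: n; exact: klow.
  have h2 : ((1 - gamma) * ck)^-1 * (l n)%:R ^+ c <= n%:R by near: n; exact: near_growth_real.
  have q0 : 0 < (1 - gamma) * ck by rewrite mulr_gt0 //; lra.
  have Lc : 0 < (l n)%:R ^+ c :> R by rewrite exprn_gt0 // ltr0n.
  rewrite -(ler_pM2r Lc) mul1r; apply: (@le_trans _ _ ((1 - gamma) * ck * n%:R)).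
    by rewrite -ler_pdivrMl.
  by rewrite -!mulrA ler_wpM2l //; lra.
exists d, Ext; split.
- near=> n; move=> p hp; have [[p0 p1] _] := hp.
  have n0 : (0 < n)%N by near: n; exact: nlarge.
  have h18 : (18 <= l n)%N by near: n; exact: l18.
  have [hs1 hs2] := ls n h18.
  have /andP[nl1 nl2] := seed_log_bounds n0.
  have /andP[Ll _] := log2_bounds R n0.
  have l1 : (0 < l n)%N := leq_trans (isT : 0 < 18)%N h18.
  have hpr q : (q < l n ^ A * l n)%N ->
      prime (modulus ((l n ^ A) ^ 2) ((l n ^ A) ^ 4) q).
    (* Here s^2 + s l must stay below the number of primes up to s^4; as l <= s, it is at most 2
       s^2. *)
    apply: prime_modulus; rewrite -/(s n).
    apply: leq_ltn_trans (prime_pi_pow4 hs2).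
    rewrite mul2n -addnn -addnA leq_add2l (leq_trans _ (leq_addr _ _)) //.
    rewrite -(mulnn (s n)) leq_mul2l (leq_trans _ hs1) ?orbT //.
    by rewrite -mulnn leq_pmulr.
  have hg1 : g n <= Cg * (l n)%:R ^+ a.
    have : cg * `|log2 (n%:R : R) ^+ a| <= `|g n| <= Cg * `|log2 (n%:R : R) ^+ a|.
      by near: n; exact: hg.
    have L1 : 1 <= log2 (n%:R : R) by near: n; exact: near_log2_ge.
    move=> /andP[_]; rewrite (ger0_norm (g_ge0 n)) ger0_norm; last by rewrite exprn_ge0 //; lra.
    move=> h; apply: le_trans h _; rewrite ler_pM2l // lerXn2r ?nnegrE //; lra.
  have G1 : 8 * (Cg + 4) * (l n)%:R ^+ (a + c) <= gamma * ck * n%:R.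
    rewrite -ler_pdivrMl // mulrA; near: n; exact: near_growth_real.
  have G2 : 64 * (Cg + 4) <= gamma * ck * (l n)%:R.
    rewrite -ler_pdivrMl //; near: n; exact: near_seed_log_real.
  have G3 : 16 * (l n)%:R * (l n)%:R ^+ c <= gamma * ck * n%:R.
    rewrite -mulrA -exprS -ler_pdivrMl // mulrA; near: n; exact: near_growth_real.
  have Gl : 2 <= gamma * (l n)%:R.
    rewrite -ler_pdivrMl //; near: n; exact: near_seed_log_real.
  have hm2 : (m n <= n ^ 2)%N by near: n; exact: m_n2.
  have hkl : ck * n%:R <= k n * (l n)%:R ^+ c by near: n; exact: klow.
  rewrite epsE div1r -powR2N.
  have nl3 : (n.+1 <= 2 ^ l n)%N := leq_ltn_trans (leq_pmulr n (isT : 0 < 2)%N) nl1.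
  have bound := error_parameters gamma_in01 l1 a_gt0 ck0 (ltW Cg0) nl2 nl3 hm2 hkl hg1 G1 G2 G3.
  have overlap i : (i < m n)%N -> (\sum_(j < i) 2 ^ #|shared (l n) A i j| <=
      Num.truncn ((1 - gamma / 2) * k n))%N.
    move=> im; rewrite truncn_ge_nat; last by rewrite mulr_ge0 //; lra.
    apply: le_trans (overlap_bound R hpr i (leq_trans (isT : 0 < 18)%N hs2)) _.
    exact: (overlap_parameters gamma_in01 (k0 n) (ltnW im) (m_le n)
      (leq_trans (isT : 1 < 18)%N h18) Gl hs1).
  exact: le_trans (extractor_error (ltnW nl1) (slotd n h18) _ p0 p1
    (fun x => source_le x hp) (powR2_gt0 _) (powR2_gt0 _) (ExtE n) overlap) bound.
- have A14 : (0 < A * 14)%N by rewrite muln_gt0 /A addn2.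
  have [M [e hM]] := ext_bit_machine A A14.
  (* The 4 appears because 2 + n + d + 2 m is eventually at most n^4, given d <= n and m <= n^2. *)
  exists M, (4 * e)%N; near=> n => x u.
  rewrite ExtE; apply: hM; first by rewrite size_tuple dE.
  have hm2 : (m n <= n ^ 2)%N by near: n; exact: m_n2.
  have hd : (d n <= n)%N by near: n; exact: d_n.
  have n3 : (3 <= n)%N by near: n; exact: nlarge.
  rewrite !size_tuple expnM; apply: expn_mono.
  have e2 : (n ^ 4 = n ^ 2 * n ^ 2)%N by rewrite -expnD.
  have : (9 <= n ^ 2)%N by rewrite -mulnn; nia.
  have : (n <= n ^ 2)%N by rewrite -mulnn leq_pmulr //; lia.
  rewrite e2; move: (n ^ 2)%N hm2 => q *; nia.
(* A circuit is chosen for each length; outside the asymptotic range the empty one is a dummy. *)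
- have /choice[C hC] n : exists C, (0 < m n)%N -> (n <= 2 ^ l n)%N -> (18 <= l n)%N ->
      [/\ circuit_wf (n + d n) C,
        (circuit_size C <= m n * ((2 ^ l n * (3 * l n + 2 * l n + 2) + 1) ^ A *
           (n * ((l n).+1 * 2 + (l n).+1 + 1) + n + 1) + 4 * (a + c)))%N,
        (2 * (a + c) <= circuit_depth (n + d n) C <= 3 + 3 * A + 2 * (a + c))%N
      & forall x u, size x = n -> size u = d n ->
         circuit_eval C (x ++ u) = mkseq (ext_bit A (l n) x u) (m n)].
    have [h1|h1] := boolP (0 < m n)%N; last by exists (Circuit [::] [::]).
    have [h2|h2] := boolP (n <= 2 ^ l n)%N; last by exists (Circuit [::] [::]).
    have [h3|h3] := boolP (18 <= l n)%N; last by exists (Circuit [::] [::]).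
    have [C hC] := ext_bit_circuit (a + c) h1 h2 (slotd n h3).
    by exists C.
  exists C, (4 * A + 8)%N; near=> n.
  have n0 : (100 <= n)%N by near: n; exact: nlarge.
  have h18 : (18 <= l n)%N by near: n; exact: l18.
  have hm2 : (m n <= n ^ 2)%N by near: n; exact: m_n2.
  have hm0 : (0 < m n)%N by near: n; exact: m_gt0.
  have hln : (1 * l n ^ 1 <= n)%N by near: n; exact: near_growth.
  have hr : (a + c <= n)%N by near: n; exact: nlarge.
  have /andP[nl1 nl2] := seed_log_bounds (leq_trans (isT : 0 < 100)%N n0).
  rewrite mul1n expn1 in hln.
  have nl : (n <= 2 ^ l n)%N by rewrite /l; lia.
  have [wf sz /andP[dl dh] ev] := hC n hm0 nl h18.
  split=> //.
  + exact: leq_trans sz (circuit_size_bound _ n0 hln nl2 hm2 hr).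
  + rewrite mul1r -natrM !ler_nat; apply/andP; split; first lia.
    by apply: leq_trans dh _; rewrite /A; lia.
  + by move=> x u; rewrite ev ?size_tuple // ExtE.
- near=> n.
  have n0 : (0 < n)%N by near: n; exact: nlarge.
  have L2 : 2 <= log2 (n%:R : R) by near: n; exact: near_log2_ge.
  have Ll := log2_bounds R n0.
  rewrite mul1r -natrM !powR_mulrn ?(le_trans _ L2) // dE natrX.
  by apply: seed_length_bounds; rewrite ?Ll // /A; clear -a_gt0; lia.
Unshelve. all: by end_near. Qed.
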